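(* Let $\Phi$ be a quantum interaction on $\mathbb{Z}^d$ with $\|\Phi\|_\kappa<\infty$ for some $\kappa>0$. Then there exists $\beta_{\max}>0$ such that for every $0<\beta\le\beta_{\max}$ and every self-adjoint matrix $X\in\mathcal{B}(\mathcal{H})$, the classical restriction $\mu^{\beta,X}$ of the (unique) quantum equilibrium state $\omega^\beta$ at inverse temperature $\beta$ is Gibbsian.
   Context: Quantum spin system: to each $i\in\mathbb{Z}^d$ attach $\mathcal{H}_i\cong\mathcal{H}=\mathbb{C}^m$ ($m\ge2$); for finite $\Lambda\subset\mathbb{Z}^d$, $\mathcal{H}_\Lambda=\bigotimes_{i\in\Lambda}\mathcal{H}_i$, $\mathcal{A}_\Lambda=\mathcal{B}(\mathcal{H}_\Lambda)$, with the standard embeddings $\mathcal{A}_{\Lambda'}\subset\mathcal{A}_\Lambda$ for $\Lambda'\subset\Lambda$. A quantum interaction is a family $\Phi=\{\Phi(A)\}_{A\subset\mathbb{Z}^d \text{ finite}}$ of self-adjoint $\Phi(A)\in\mathcal{B}(\mathcal{H}_A)$, $\Phi(\emptyset)=0$, translation invariant ($\Phi(A+i)$ is the copy of $\Phi(A)$ on $\mathcal{H}_{A+i}$), and $\Phi(A)=0$ unless $A$ is connected. Norm: $\|\Phi\|_\kappa=\sum_{A\ni0}e^{\kappa|A|}\|\Phi(A)\|$. Local Hamiltonian $H_\Lambda^\Phi=\sum_{A\subset\Lambda}\Phi(A)$; finite-volume Gibbs state $\omega_\Lambda^\beta(\cdot)=\mathrm{Tr}_\Lambda(e^{-\beta H^\Phi_\Lambda}\,\cdot)/\mathrm{Tr}_\Lambda(e^{-\beta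 H^\Phi_\Lambda})$; $\omega^\beta$ is its (unique for $\beta$ small) weak* thermodynamic limit $\Lambda\nearrow\mathbb{Z}^d$. Classical restriction: for self-adjoint $X\in\mathcal{B}(\mathcal{H})$ with spectral decomposition $X=\sum_{x\in\mathrm{sp}(X)}xQ(x)$, let $X_i,Q_i(x)$ be the copies at site $i$, $\Omega_\Lambda=\mathrm{sp}(X)^\Lambda$, $\Omega=\mathrm{sp}(X)^{\mathbb{Z}^d}$, $Q_\Lambda(x_\Lambda)=\prod_{i\in\Lambda}Q_i(x_i)$. The classical restriction of a state $\omega$ is the probability measure $\mu^X$ on $\Omega$ (product topology, Borel $\sigma$-algebra) with $\mu^X(x_\Lambda)=\omega(Q_\Lambda(x_\Lambda))$ for all finite $\Lambda$ and $x_\Lambda\in\Omega_\Lambda$; $\mu^{\beta,X}$ denotes that of $\omega^\beta$. Gibbsian: a classical potential is a translation-invariant family $\Psi=\{\Psi_A\}$, $A\subset\mathbb{Z}^d$ finite, of real functions $\Psi_A:\Omega_A\to\mathbb{R}$ with $\Psi_\emptyset=0$, with norm $\|\Psi\|_\kappa=\sum_{A\ni0}e^{\kappa|A|}\sup|\Psi_A|$. A probability measure $\mu$ on $\Omega$ is Gibbsian if there is a potential $\Psi$ with $\|\Psi\|_0<\infty$ such that for every finite $\Lambda$ and $\mu$-a.e. $x_{\Lambda^c}$, $\mu(x_\Lambda\mid x_{\Lambda^c})=\mathcal{Z}_\Lambda(x_{\Lambda^c})^{-1}\exp[-\sum_{A\cap\Lambda\neq\emptyset}\Psi_A(x)]$,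 with $\mathcal{Z}_\Lambda$ the normalizing sum over $x_\Lambda\in\Omega_\Lambda$. *)

(* Defs.v *)
From HB Require Import structures.
From mathcomp Require Import all_boot all_order all_algebra.
From mathcomp Require Import finmap.
From mathcomp Require Import all_classical all_reals all_analysis.
From mathcomp Require Import complex.

Set Implicit Arguments.
Unset Strict Implicit.
Unset Printing Implicit Defensive.

Import Order.TTheory GRing.Theory Num.Theory.
Import numFieldNormedType.Exports.
Local Open Scope classical_set_scope.
Local Open Scope ring_scope.

Definition site (d : nat) := {ffun 'I_d -> int}.

Section Lattice.
Variable d : nat.

Definition shift (A : {fset site d}) (i : site d) : {fset site d} :=
  [fset (x + i)%R | x in A]%fset.

Definition adj (x y : site d) : bool := (\sum_(k < d) `|x k - y k|)%R == 1%R.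

Definition connected_set (A : {fset site d}) : Prop :=
  forall x y : site d, x \in A -> y \in A ->
    exists p : seq (site d), [&& all (fun z => z \in A) p, path adj x p & last x p == y].

Definition box (n : nat) : {fset site d} :=
  seq_fset tt [seq ([ffun k => (f k)%:Z - n%:Z] : site d)
                | f : {ffun 'I_d -> 'I_(n.*2.+1)}].

End Lattice.

Section Kernels.
Variable R : realType.
Local Notation C := (R[i]).

(* an operator on C^I, written as its matrix (kernel) in the canonical basis *)
Definition kmul (I : finType) (A B : I -> I -> C) : I -> I -> C :=
  fun s t => \sum_(u : I) A s u * B u t.
Definition kone (I : finType) : I -> I -> C := fun s t => (s == t)%:R.
Definition kadd (I : finType) (A B : I -> I -> C) : I -> I -> C :=
  fun s t => A s t + B s t.
Definition kscale (I : finType) (a : C) (A : I -> I -> C) : I -> I -> C :=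
  fun s t => a * A s t.
Definition kpow (I : finType) (A : I -> I -> C) (n : nat) : I -> I -> C :=
  iter n (kmul A) (@kone I).
Definition ktrace (I : finType) (A : I -> I -> C) : C := \sum_(s : I) A s s.
Definition kadjoint (I : finType) (A : I -> I -> C) : I -> I -> C :=
  fun s t => conjc (A t s).
Definition kselfadjoint (I : finType) (A : I -> I -> C) : Prop :=
  forall s t, A s t = conjc (A t s).

Definition kexp_partial (I : finType) (A : I -> I -> C) (N : nat) : I -> I -> C :=
  fun s t => \sum_(k < N) (k`!%:R)^-1 * kpow A k s t.

Definition kexp (I : finType) (A : I -> I -> C) : I -> I -> C :=
  fun s t => Complex (lim ((fun N => complex.Re (kexp_partial A N s t) : R) @ \oo))
                     (lim ((fun N => complex.Im (kexp_partial A N s t) : R) @ \oo)).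

Definition cabs2 (z : C) : R := complex.Re z ^+ 2 + complex.Im z ^+ 2.
Definition vnorm (I : finType) (v : I -> C) : R :=
  Num.sqrt (\sum_(s : I) cabs2 (v s)).
Definition opnorm (I : finType) (A : I -> I -> C) : R :=
  sup [set r : R | exists v : I -> C,
         vnorm v <= 1 /\ r = vnorm (fun s => \sum_(t : I) A s t * v t)].

End Kernels.

(* Quantum spin system: H_Lambda = (C^m)^{otimes Lambda}, basis conf Lambda  *)

Section Quantum.
Variables (R : realType) (d m : nat).
Local Notation C := (R[i]).
Local Notation site := (site d).

(* basis of H_Lambda : product basis indexed by spin configurations on Lambda *)
Definition conf (L : {fset site}) := {ffun L -> 'I_m}.
Definition op (L : {fset site}) := conf L -> conf L -> C.

Definition agree (L' L : {fset site}) (s' : conf L') (s : conf L) : bool :=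
  [forall x : L', forall y : L, (val x == val y) ==> (s' x == s y)].
Definition offeq (L' L : {fset site}) (s t : conf L) : bool :=
  [forall y : L, (val y \notin L') ==> (s y == t y)].

(* standard embedding A_{L'} -> A_L, A |-> A (x) 1_{L \ L'} (for L' <= L) *)
Definition embed (L' L : {fset site}) (A : op L') : op L :=
  fun s t => if offeq L' s t then
               \sum_(s' : conf L' | agree s' s) \sum_(t' : conf L' | agree t' t) A s' t'
             else 0.
Arguments embed {L'} L A.

Definition interaction := forall A : {fset site}, op A.

Definition is_quantum_interaction (Phi : interaction) : Prop :=
  (forall A : {fset site}, kselfadjoint (Phi A)) /\
  (forall s t, Phi fset0 s t = 0) /\
  (forall (A : {fset site}) (i : site) (s t : conf A) (s2 t2 : conf (shift A i)),
     (forall (x : A) (y : shift A i), val y = (val x + i)%R -> s2 y = s x /\ t2 y = t x) ->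
     Phi (shift A i) s2 t2 = Phi A s t) /\
  (forall A : {fset site}, ~ connected_set A -> forall s t, Phi A s t = 0).

Definition qnorm (Phi : interaction) (kappa : R) : \bar R :=
  \esum_(A in [set A : {fset site} | (0 : site) \in A])
     (expR (kappa * (#|` A|)%:R) * opnorm (Phi A))%:E.

Definition hamiltonian (Phi : interaction) (L : {fset site}) : op L :=
  fun s t => \sum_(A <- fpowerset L) embed L (Phi A) s t.
Arguments hamiltonian Phi L.

Definition gibbs_state (Phi : interaction) (beta : R) (L : {fset site}) (B : op L) : C :=
  let rho := kexp (kscale (Complex (- beta) 0) (@hamiltonian Phi L)) in
  ktrace (kmul rho B) / ktrace rho.

End Quantum.
Arguments hamiltonian {R d m} Phi L.
Arguments embed {R d m L'} L A.

Section Classical.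
Variables (R : realType) (d m : nat).
Local Notation C := (R[i]).
Local Notation site := (site d).

Definition spectral_decomposition (X : 'I_m -> 'I_m -> C) (sp : seq R)
    (Q : R -> 'I_m -> 'I_m -> C) : Prop :=
  [/\ uniq sp,
      (forall x, x \in sp -> kselfadjoint (Q x) /\ kmul (Q x) (Q x) = Q x
                             /\ Q x <> (fun _ _ => 0)),
      (forall x y, x \in sp -> y \in sp -> x != y -> kmul (Q x) (Q y) = (fun _ _ => 0)),
      (fun s t => \sum_(x <- sp) Q x s t) = @kone R _ &
      X = (fun s t => \sum_(x <- sp) (Complex x 0) * Q x s t)].

(* sp(X) = x0 :: sp' is an enumeration of the (nonempty) spectrum of X *)
Variables (x0 : R) (sp' : seq R).
Definition spT := seq_sub (x0 :: sp').
HB.instance Definition _ := Finite.on spT.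
HB.instance Definition _ := isPointed.Build spT (SeqSub (mem_head x0 sp')).

Definition Omega := site -> spT.
Definition lconf (L : {fset site}) := {ffun L -> spT}.

Definition cyl (L : {fset site}) (xi : lconf L) : set Omega :=
  [set w | forall y : L, w (val y) = xi y].

Definition cylinders : set (set Omega) :=
  [set E | exists (L : {fset site}) (xi : lconf L), E = cyl xi].

Local Notation OmegaM := (g_sigma_algebraType cylinders).

Definition outside_sigma (L : {fset site}) : set (set Omega) :=
  <<s [set E | exists (L' : {fset site}) (xi : lconf L'),
                 (L' `&` L)%fset = fset0 /\ E = cyl xi] >>.

Definition Qprod (Q : R -> 'I_m -> 'I_m -> C) (L : {fset site}) (xi : lconf L) : op R m L :=
  fun s t => \prod_(y : L) Q (val (xi y)) (s y) (t y).

(* mu is the classical restriction of omega^beta, where omega^beta is the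
   thermodynamic limit (along the boxes [-n,n]^d) of the Gibbs states *)
Definition classical_restriction (Phi : interaction R d m) (beta : R)
    (Q : R -> 'I_m -> 'I_m -> C) (mu : probability OmegaM R) : Prop :=
  forall (L : {fset site}) (xi : lconf L),
    (fun n => complex.Re (gibbs_state Phi beta (embed (box d n) (Qprod Q xi))))
       @ \oo --> fine (mu (cyl xi)) /\
    (fun n => complex.Im (gibbs_state Phi beta (embed (box d n) (Qprod Q xi))))
       @ \oo --> 0.

(* classical potentials: Psi_A is a function on Omega_A, represented as a
   function on Omega depending only on the spins in A *)
Definition classical_potential (Psi : {fset site} -> Omega -> R) : Prop :=
  (forall (A : {fset site}) (w w' : Omega),
     (forall y, y \in A -> w y = w' y) -> Psi A w = Psi A w') /\
  (forall w, Psi fset0 w = 0) /\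
  (forall (A : {fset site}) (i : site) (w : Omega),
     Psi (shift A i) w = Psi A (fun y => w (y + i)%R)).

Definition cnorm0 (Psi : {fset site} -> Omega -> R) : \bar R :=
  \esum_(A in [set A : {fset site} | (0 : site) \in A])
     ereal_sup [set (`|Psi A w|)%:E | w in [set: Omega]].

(* sum_{A : A cap Lambda <> emptyset} Psi_A(w)  (absolutely convergent) *)
Definition energy (Psi : {fset site} -> Omega -> R) (L : {fset site}) (w : Omega) : R :=
  let S := [set A : {fset site} | (A `&` L)%fset != fset0] in
  fine (\esum_(A in S) (Num.max (Psi A w) 0)%:E) -
  fine (\esum_(A in S) (Num.max (- Psi A w) 0)%:E).

Definition glue (L : {fset site}) (xi : lconf L) (w : Omega) : Omega :=
  fun y => match (insub y : option L) with Some y' => xi y' | None => w y end.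

Definition gibbs_kernel (Psi : {fset site} -> Omega -> R) (L : {fset site})
    (xi : lconf L) (w : Omega) : R :=
  expR (- energy Psi L (glue xi w)) /
  \sum_(zeta : lconf L) expR (- energy Psi L (glue zeta w)).

(* mu is Gibbsian: mu(x_Lambda | x_{Lambda^c}) = gibbs_kernel, mu-a.e.;
   i.e. gibbs_kernel is a version of the conditional probability of the
   cylinder {x_Lambda} given the sigma-algebra of the outside spins *)
Definition gibbsian (mu : probability OmegaM R) : Prop :=
  exists Psi : {fset site} -> Omega -> R,
    classical_potential Psi /\ (cnorm0 Psi < +oo)%E /\
    forall (L : {fset site}) (xi : lconf L) (E : set Omega),
      outside_sigma L E ->
      (mu (cyl xi `&` E) = \int[mu]_(w in E) (gibbs_kernel Psi xi w)%:E)%E.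

End Classical.
Notation OmegaM R d x0 sp' := (g_sigma_algebraType (@cylinders R d x0 sp')).

(* Main.v *)
(* Replace each spin projection Q_i(x_i) by a pattern w that may also leave sites
   unspecified, and let Z_V(w) = tr(e^{-beta H_V} P_w) / tr(P_w) with P_w the product
   projection of w. Moebius inversion over families of interaction sets writes Z_V(w) as
   a sum of weights Y(g), with |Y(g)| <= prod_(A in g) (e^{beta |Phi(A)|} - 1), which
   factorise over disjoint families since tr(. P_w) / tr(P_w) is a product state.
   Peeling off the cluster of a site i gives a recursion for Z_V whose ratios stay close
   to 1 in the norm sum_A sup_w |moeb F A|. This norm is submultiplicative, so the
   power series of ln may be applied, and ln Z_V(w) = sum_(A subset V) phi_A(w) with phi
   local, translation invariant and absolutely summable at high temperature.
   Ratios of finite-volume probabilities of patterns then converge, and Kolmogorov's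
   theorem gives mu. The potential is -phi_A, corrected on single sites by the logarithm
   of the normalised trace of the projection. As phi is defined on partially specified
   patterns, the probability of x_L given finitely many spins outside L is exactly a
   Boltzmann ratio, whose energy differs from the energy of any extension by the tail of
   the summable potential: this yields the DLR equations on cylinders, and a pi-lambda
   argument extends them. *)
Require Import Defs.
From HB Require Import structures.
From mathcomp Require Import all_boot all_order all_algebra.
From mathcomp Require Import finmap.
From mathcomp Require Import all_classical all_reals all_analysis.
From mathcomp Require Import complex measurable_realfun.
From mathcomp Require Import ring lra zify.

Set Implicit Arguments.
Unset Strict Implicit.
Unset Printing Implicit Defensive.

Import Order.TTheory GRing.Theory Num.Theory.
Import numFieldNormedType.Exports.
Local Open Scope ring_scope.

(** * Moebius inversion and logarithms *)

Section Moebius.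
Import mathcomp.boot.fintype mathcomp.boot.finset.
Variables (T : finType) (R : comPzRingType).
Implicit Types (A B C V : {set T}) (F G f : {set T} -> R).

(** The terms of H_V do not commute with one another or with the projections, so e^{-beta H_V} does
    not factor over interaction sets. Moebius inversion is therefore applied to the scalars
    tau(e^{-beta H_g}), g a family: power by power, the coefficients obey the same recursion as for
    commuting numbers |Phi(A)|, which dominates them and sums to the product of the e^{beta
    |Phi(A)|} - 1. The functional tau = tr(. P_w) / tr(P_w) is bounded by the operator norm whatever
    the projections, so smallness is asked of Phi alone and beta_max is uniform in X; X enters only
    through a one-body term, of which just finiteness matters. No connected families are counted:
    the peeling identity is applied once more to a majorant partition function, which is an explicit
    product, and this bounds the cluster weights. With k = kappa and s = kappa/2, half of the
    exponential decay pays for the majorant and half for the ratios of partition functions.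
    Conditioning on all outside spins is in general conditioning on a null event; finite patterns
    have positive probability, so exact identities are available for them before any limit. *)

Definition moeb F A : R :=
  \sum_(B : {set T} | B \subset A) (-1) ^+ (#|A| + #|B|) * F B.

(** Toggling a point of [A] outside [C] is a sign-reversing involution of the interval between [C]
    and [A]. *)
Lemma sum_interval_sign C A :
  \sum_(B : {set T} | (C \subset B) && (B \subset A)) (-1) ^+ #|B| =
  (C == A)%:R * (-1) ^+ #|A| :> R.
Proof.
have [->|neqCA] := eqVneq C A.
  rewrite mul1r (big_pred1 A) // => B /=.
  by rewrite andbC -eqEsubset.
rewrite mul0r; have [sCA|nsCA] := boolP (C \subset A); last first.
  rewrite big_pred0 // => B; apply/negbTE/negP => /andP[CB BA].
  by move/negP: nsCA; apply; exact: subset_trans CB BA.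
have [x xA xC] : exists2 x, x \in A & x \notin C.
  by apply/subsetPn; apply: contra neqCA => sAC; rewrite eqEsubset sCA.
rewrite (bigID (fun B : {set T} => x \in B)) /=.
rewrite (reindex_onto (fun B : {set T} => x |: B) (fun B => B :\ x)) /=; last first.
  by move=> B /andP[_ xB]; rewrite setD1K.
rewrite (eq_bigl (fun B : {set T} => ((C \subset B) && (B \subset A)) && (x \notin B))).
  rewrite -big_split big1 //= => B /andP[_ xB].
  by rewrite cardsU1 xB exprS mulN1r addNr.
move=> B /=; rewrite setU11 andbT subUset ?sub1set xA /=.
have [xB|xB] := boolP (x \in B); rewrite ?andbF ?andbT.
  by apply/negbTE; apply: contraL xB => /andP[_ /eqP <-]; rewrite setD11.
rewrite setU1K // eqxx andbT.
have -> : (C \subset x |: B) = (C \subset B) => //.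
apply/subsetP/subsetP => h y yC; last by rewrite inE (h y yC) orbT.
by have := h y yC; rewrite !inE => /orP[/eqP yx|//]; rewrite -yx yC in xC.
Qed.

(** Signs carry the exponent [#|A| + #|B|] in place of a truncated difference; only its parity
    matters. *)
Lemma signDn n : (-1) ^+ (n + n) = 1 :> R.
Proof. by rewrite addnn -mul2n exprM sqrrN expr1n expr1n. Qed.

Lemma sum_moeb F V : \sum_(A : {set T} | A \subset V) moeb F A = F V.
Proof.
rewrite /moeb (exchange_big_dep (fun B : {set T} => B \subset V)) /=; last first.
  by move=> A B AV BA; exact: subset_trans BA AV.
rewrite (bigD1 V) //= [X in _ + X]big1 ?addr0.
  rewrite (big_pred1 V); last by move=> A /=; rewrite -eqEsubset.
  by rewrite signDn mul1r.
move=> B /andP[BV nBV]; rewrite -big_distrl /=.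
under eq_bigr do rewrite exprD.
rewrite -big_distrl /= (eq_bigl (fun A : {set T} => (B \subset A) && (A \subset V))).
  by rewrite sum_interval_sign (negbTE nBV) !mul0r.
by move=> A; rewrite andbC.
Qed.

Lemma moeb_sum f A : moeb (fun V => \sum_(C : {set T} | C \subset V) f C) A = f A.
Proof.
rewrite /moeb; under eq_bigr do rewrite big_distrr /=.
rewrite (exchange_big_dep (fun B : {set T} => B \subset A)) /=; last first.
  by move=> V B VA BV; exact: subset_trans BV VA.
rewrite (bigD1 A) //= [X in _ + X]big1 ?addr0.
  rewrite (big_pred1 A); last by move=> V /=; rewrite -eqEsubset.
  by rewrite signDn mul1r.
move=> B /andP[BA nBA]; rewrite -big_distrl /=.
under eq_bigr do rewrite exprD.
rewrite -big_distrr /= (eq_bigl (fun V : {set T} => (B \subset V) && (V \subset A))).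
  by rewrite sum_interval_sign (negbTE nBA) !(mul0r,mulr0).
by move=> V; rewrite andbC.
Qed.

Lemma eq_moeb F G A : (forall B, B \subset A -> F B = G B) -> moeb F A = moeb G A.
Proof. by move=> h; apply: eq_bigr => B /h ->. Qed.

Lemma moebD F G A : moeb (fun V => F V + G V) A = moeb F A + moeb G A.
Proof. by rewrite /moeb -big_split; apply: eq_bigr => B _; rewrite mulrDr. Qed.

Lemma moebZ c F A : moeb (fun V => c * F V) A = c * moeb F A.
Proof. by rewrite /moeb big_distrr; apply: eq_bigr => B _ /=; rewrite mulrCA. Qed.

Lemma moeb_superset (D : {set T}) A : moeb (fun V => (D \subset V)%:R) A = (A == D)%:R.
Proof.
rewrite -(moeb_sum (fun A => (A == D)%:R) A); apply: eq_moeb => V _.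
have [DV|nDV] := boolP (D \subset V).
  rewrite (bigD1 D) //= eqxx big1 ?addr0 // => C /andP[_ /negbTE ->]//.
by rewrite big1 // => C CV; case: eqP => // CD; rewrite -CD CV in nDV.
Qed.

(** Pairs with both [B] and [C] inside [V] are the pairs with [B :|: C] inside [V]: group the
    product of the two expansions by union and invert. *)
Lemma moebM F G A : moeb (fun V => F V * G V) A =
  \sum_(B : {set T}) \sum_(C : {set T} | B :|: C == A) moeb F B * moeb G C.
Proof.
rewrite -(moeb_sum (fun A => \sum_(B : {set T}) \sum_(C : {set T} | B :|: C == A)
  moeb F B * moeb G C) A); apply: eq_moeb => V _.
rewrite exchange_big /=.
rewrite -(sum_moeb F V) -(sum_moeb G V) big_distrl /= [RHS](bigID (fun B : {set T} => B \subset V)) /=.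
rewrite [X in _ = _ + X]big1 ?addr0; last first.
  move=> B nBV; rewrite big1 // => C CV; rewrite big1 // => E /eqP EC.
  by rewrite -EC subUset (negbTE nBV) in CV.
apply: eq_bigr => B BV; rewrite big_distrr /=.
rewrite (exchange_big_dep (fun C : {set T} => C \subset V)) /=; last first.
  by move=> C E CV /eqP EC; rewrite -EC subUset in CV; case/andP: CV.
apply: eq_bigr => C CV; rewrite (big_pred1 (B :|: C)) // => E /=.
by rewrite andbC eq_sym; case: eqP => // ->; rewrite subUset BV CV.
Qed.

End Moebius.

(** * The norm of Moebius coefficients *)

Section Norm.
Import mathcomp.boot.fintype mathcomp.boot.finset.
Variables (R : realType) (T W : finType) (w0 : W).
Implicit Types (F G H : {set T} -> W -> R) (f g : W -> R).

Definition maxabs f : R := \big[Num.max/0]_(w : W) `|f w|.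

Lemma maxabs_ge0 f : 0 <= maxabs f.
Proof. by rewrite /maxabs; elim/big_ind: _ => // x y x0 y0; rewrite le_max x0. Qed.

Lemma le_maxabs f w : `|f w| <= maxabs f.
Proof. by rewrite /maxabs (bigD1 w) //= le_max lexx. Qed.

Lemma maxabs_le f c : 0 <= c -> (forall w, `|f w| <= c) -> maxabs f <= c.
Proof.
by move=> c0 h; rewrite /maxabs; elim/big_ind: _ => // x y; rewrite ge_max => -> ->.
Qed.

Lemma maxabs_attained f : exists w, maxabs f = `|f w|.
Proof.
exists [arg max_(w > w0) `|f w|]%O; case: arg_maxP => //= w _ h.
by apply/eqP; rewrite eq_le le_maxabs andbT; apply: maxabs_le => // w'; exact: h.
Qed.

(* Submultiplicative, because Moebius coefficients of a product are convolved over unions. *)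
Definition nrm F : R := \sum_(A : {set T}) maxabs (fun w => moeb (F^~ w) A).

Lemma nrm_ge0 F : 0 <= nrm F.
Proof. by apply: sumr_ge0 => A _; exact: maxabs_ge0. Qed.

Lemma eq_nrm F G : (forall A w, F A w = G A w) -> nrm F = nrm G.
Proof.
move=> h; apply: eq_bigr => A _; apply: eq_bigr => w _.
by congr (`| _ |); apply: eq_moeb.
Qed.

Lemma nrm_pt F V w : `|F V w| <= nrm F.
Proof.
rewrite -(sum_moeb (F^~ w) V); apply: le_trans (ler_norm_sum _ _ _) _.
rewrite big_mkcond /=; apply: ler_sum => A _.
by case: ifP => _; [exact: (le_maxabs (fun w => moeb (F^~ w) A))|exact: maxabs_ge0].
Qed.

Lemma nrmD F G : nrm (fun V w => F V w + G V w) <= nrm F + nrm G.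
Proof.
rewrite /nrm -big_split; apply: ler_sum => A _ /=.
apply: maxabs_le => [|w]; first by rewrite addr_ge0 ?maxabs_ge0.
rewrite moebD; apply: le_trans (ler_normD _ _) _.
by apply: lerD; [exact: (le_maxabs (fun w => moeb (F^~ w) A))|exact: (le_maxabs (fun w => moeb (G^~ w) A))].
Qed.

Lemma nrmZ (c : W -> R) (b : R) F : (forall w, `|c w| <= b) ->
  nrm (fun V w => c w * F V w) <= b * nrm F.
Proof.
move=> h; have b0 : 0 <= b by apply: le_trans (h w0).
rewrite /nrm big_distrr; apply: ler_sum => A _ /=.
apply: maxabs_le => [|w]; first by rewrite mulr_ge0 ?maxabs_ge0.
rewrite moebZ normrM; apply: ler_pM => //.
exact: (le_maxabs (fun w => moeb (F^~ w) A)).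
Qed.

Lemma nrm_sum (I : finType) (P : pred I) (F : I -> {set T} -> W -> R) :
  nrm (fun V w => \sum_(i | P i) F i V w) <= \sum_(i | P i) nrm (F i).
Proof.
rewrite /nrm exchange_big /=; apply: ler_sum => A _.
apply: maxabs_le => [|w]; first by apply: sumr_ge0 => i _; exact: maxabs_ge0.
have -> : moeb (fun V => \sum_(i | P i) F i V w) A = \sum_(i | P i) moeb ((F i)^~ w) A.
  by rewrite /moeb exchange_big /=; apply: eq_bigr => B _; rewrite big_distrr.
apply: le_trans (ler_norm_sum _ _ _) _; apply: ler_sum => i _.
exact: (le_maxabs (fun w => moeb (F i ^~ w) A)).
Qed.

(** The recursion below constrains a set to lie in the volume, and the indicator of this constraint
    is itself a function of [V]. Having a single Moebius coefficient, it costs nothing in the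
    norm. *)
Lemma nrm_superset (D : {set T}) : nrm (fun V _ => (D \subset V)%:R) <= 1.
Proof.
rewrite /nrm (bigD1 D) //= big1 ?addr0.
  by apply: maxabs_le => // w; rewrite moeb_superset eqxx normr1.
move=> A AD; apply/eqP; rewrite eq_le maxabs_ge0 andbT.
by apply: maxabs_le => // w; rewrite moeb_superset (negbTE AD) normr0.
Qed.

Lemma nrm1 : nrm (fun _ _ => 1) <= 1.
Proof.
by apply: le_trans (nrm_superset set0); rewrite (@eq_nrm _ (fun V _ => (set0 \subset V)%:R)) // => A w; rewrite sub0set.
Qed.

Lemma nrmM F G : nrm (fun V w => F V w * G V w) <= nrm F * nrm G.
Proof.
rewrite [X in _ <= X]big_distrl /=.
under [X in _ <= X]eq_bigr do rewrite big_distrr /=.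
have -> : \sum_(B : {set T}) \sum_(C : {set T}) maxabs (fun w => moeb (F^~ w) B) *
    maxabs (fun w => moeb (G^~ w) C) =
  \sum_(A : {set T}) \sum_(B : {set T}) \sum_(C : {set T} | B :|: C == A)
    maxabs (fun w => moeb (F^~ w) B) * maxabs (fun w => moeb (G^~ w) C).
  rewrite [RHS]exchange_big /=; apply: eq_bigr => B _.
  rewrite (exchange_big_dep predT) //=; apply: eq_bigr => C _.
  by rewrite (big_pred1 (B :|: C)) // => A; rewrite eq_sym.
apply: ler_sum => A _; apply: maxabs_le => [|w].
  apply: sumr_ge0 => B _; apply: sumr_ge0 => C _.
  by rewrite mulr_ge0 ?maxabs_ge0.
rewrite moebM; apply: le_trans (ler_norm_sum _ _ _) _; apply: ler_sum => B _.
apply: le_trans (ler_norm_sum _ _ _) _; apply: ler_sum => C _.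
rewrite normrM; apply: ler_pM => //.
  exact: (le_maxabs (fun w => moeb (F^~ w) B)).
exact: (le_maxabs (fun w => moeb (G^~ w) C)).
Qed.

(** An a priori estimate replaces the Neumann series: the inverse u satisfies u = 1 - H u, and as
    [nrm u] is a finite real, nrm u <= 1 + e nrm u can be solved for it. *)
Lemma nrm_inv H e : nrm H <= e -> e < 1 ->
  nrm (fun V w => (1 + H V w)^-1) <= (1 - e)^-1.
Proof.
move=> He e1; set u := fun V w => (1 + H V w)^-1.
have pos V w : 0 < 1 + H V w.
  have := le_trans (nrm_pt H V w) He; rewrite ler_norml => /andP[h _]; lra.
have uE V w : u V w = 1 + (-1) * (H V w * u V w).
  by rewrite /u; field; rewrite gt_eqF.
have h : nrm u <= 1 + e * nrm u.
  rewrite {1}(eq_nrm uE); apply: le_trans (nrmD _ _) _.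
  apply: lerD; first exact: nrm1.
  apply: le_trans (nrmZ (b := 1) _ _) _ => [w|]; first by rewrite normrN1.
  rewrite mul1r; apply: le_trans (nrmM _ _) _.
  by apply: ler_wpM2r => //; exact: nrm_ge0.
rewrite -[leRHS]mul1r ler_pdivlMr ?subr_gt0 //; lra.
Qed.

(** The logarithm is reached along the segment 1 + t H. The norm is not differentiable in t, so for
    each [A] the maximising pattern [s A] and the sign [c A] are frozen at t = 1. The resulting [f]
    is linear in the coefficients, vanishes at 0 and equals the norm at 1; by the mean value theorem
    it is bounded by the norm of H / (1 + t H) for some t in (0,1), to which [nrm_inv] applies. *)
Lemma nrm_ln H e : nrm H <= e -> e < 1 ->
  nrm (fun V w => ln (1 + H V w)) <= e / (1 - e).
Proof.
move=> He e1; set L := fun V w => _.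
have e0 : 0 <= e := le_trans (nrm_ge0 H) He.
have pos (t : R) V w : 0 <= t <= 1 -> 0 < 1 + t * H V w.
  move=> /andP[t0 t1]; have := le_trans (nrm_pt H V w) He.
  rewrite ler_norml => /andP[h _].
  have : t * - e <= t * H V w by rewrite ler_wpM2l.
  have : t * e <= 1 * e by rewrite ler_wpM2r.
  lra.
have /choice[s sE] : forall A : {set T}, exists w, maxabs (fun w => moeb (L^~ w) A) = `|moeb (L^~ w) A|.
  by move=> A; exact: maxabs_attained.
pose c A := Num.sg (moeb (L^~ (s A)) A).
pose f (t : R) := \sum_(A : {set T}) c A * moeb (fun V => ln (1 + t * H V (s A))) A.
pose f' (t : R) := \sum_(A : {set T}) c A * moeb (fun V => H V (s A) * (1 + t * H V (s A))^-1) A.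
have f0 : f 0 = 0.
  rewrite /f big1 // => A _; rewrite /moeb big1 ?mulr0 // => B _.
  by rewrite mul0r addr0 ln1 mulr0.
have f1 : f 1 = nrm L.
  rewrite /f /nrm; apply: eq_bigr => A _; rewrite sE normrEsg.
  by congr (_ * _); apply: eq_moeb => V _; rewrite mul1r.
have df (t : R) : 0 <= t <= 1 -> is_derive t (1:R) f (f' t).
  move=> t01; rewrite /f /f' /moeb.
  have dln V w : is_derive t (1:R) (fun t : R => ln (1 + t * H V w))
      (H V w * (1 + t * H V w)^-1).
    have d1 : is_derive t (1:R) (fun t : R => 1 + t * H V w) (H V w).
      have -> : (fun t : R => 1 + t * H V w) = (cst 1 + (H V w \*: id)).
        by apply/funext => x; rewrite /= [RHS]/GRing.add /= mulrC.
      have d2 := is_deriveD (is_derive_cst (1:R) t 1) (is_deriveZ (H V w) (is_derive_id t 1)).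
      by apply: (is_derive_eq d2); rewrite add0r [LHS]mulr1.
    have d3 := @is_derive1_comp R (@ln R) (fun t : R => 1 + t * H V w) t _ _
      (is_derive1_ln (pos t V w t01)) d1.
    by apply: (is_derive_eq d3); rewrite mulrC.
  have -> : (fun t : R => \sum_(A : {set T}) c A * \sum_(B : {set T} | B \subset A)
       (-1) ^+ (#|A| + #|B|) * ln (1 + t * H B (s A))) =
     \sum_(A : {set T}) (c A \*: \sum_(B : {set T} | B \subset A)
       ((-1) ^+ (#|A| + #|B|) \*: (fun t : R => ln (1 + t * H B (s A)))))%R.
    apply/funext => x; rewrite fct_sumE; apply: eq_bigr => A _.
    by rewrite /= fct_sumE.
  have dsum (I : finType) (P : pred I) (h : I -> R -> R) (dh : I -> R) :
      (forall i, is_derive t 1 (h i) (dh i)) ->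
      is_derive t 1 (\sum_(i | P i) h i) (\sum_(i | P i) dh i).
    move=> hh; elim/big_ind2 : _ => // [|? ? ? ? ? ?]; first exact: is_derive_cst.
    exact: is_deriveD.
  apply: dsum => A; apply: is_deriveZ; apply: dsum => B; exact: is_deriveZ.
have [t|t|t] := @MVT R f f' 0 1 ltr01.
- by rewrite in_itv /= => /andP[t0 t1]; apply: df; rewrite !ltW.
- apply: derivable_within_continuous => x; rewrite in_itv /= => x01.
  by have := df x x01 => /@ex_derive.
rewrite in_itv /= => /andP[t0 t1].
rewrite f1 f0 !subr0 mulr1 => ->.
have te : t * e <= e by rewrite ler_piMl // ltW.
pose K := fun V w => H V w * (1 + t * H V w)^-1.
apply: (@le_trans _ _ (nrm K)).
  rewrite /f' /nrm; apply: ler_sum => A _.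
  apply: le_trans (ler_norm _) _; rewrite normrM.
  apply: (@le_trans _ _ (1 * `|moeb (K^~ (s A)) A|)).
    by rewrite ler_wpM2r // normr_sg; case: eqP.
  by rewrite mul1r; exact: (le_maxabs (fun w => moeb (K^~ w) A)).
apply: le_trans (nrmM _ _) _; apply: ler_pM => //; try exact: nrm_ge0.
apply: (@le_trans _ _ (1 - t * e)^-1).
  apply: nrm_inv; last lra.
  apply: le_trans (nrmZ (b := t) (fun _ => _) _) _ => [|].
    by rewrite ger0_norm // ltW.
  by rewrite ler_pM2l.
rewrite lef_pV2 ?posrE; lra.
Qed.

End Norm.

(** * Cluster expansion of an abstract partition function *)

Section Ratios.
Import mathcomp.boot.fintype mathcomp.boot.finset.
Variables (R : realType) (T W : finType) (w0 : W).
Variables (Z : {set T} -> W -> R) (a : T -> {set T} -> W -> R) (b : T -> {set T} -> R).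
Variables (G e : R).
Hypothesis Z0 : forall w, Z set0 w = 1.
Hypothesis Zrec : forall (V : {set T}) i w, i \in V ->
  Z V w = \sum_(B : {set T} | (i \in B) && (B \subset V)) a i B w * Z (V :\: B) w.
Hypothesis aE : forall i (B : {set T}) w, `|a i B w - (B == [set i])%:R| <= b i B.
Hypothesis bG : forall i, \sum_(B : {set T} | i \in B) b i B * G ^+ #|B|.-1 <= e.
Hypothesis e1 : e < 1.
Hypothesis eG : (1 - e)^-1 <= G.

Let G0 : 0 <= G.
Proof. by apply: le_trans eG; rewrite invr_ge0 subr_ge0 ltW. Qed.

Let b0 i B : 0 <= b i B. Proof. exact: le_trans (aE i B w0). Qed.

(** The site [i] is put back in the denominator by force, so that the quotient makes sense for every
    [V], whether or not it contains [i], and has Moebius coefficients in [V]. *)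
Definition ratio i (U : {set T}) (V : {set T}) w : R :=
  Z (V :\: (i |: U)) w / Z (i |: (V :\: U)) w.

Fixpoint ratios (U : {set T}) (s : seq T) (V : {set T}) w : R :=
  if s is i :: s' then ratio i U V w * ratios (i |: U) s' V w else 1.

(* The recursion says that the inverse of [ratio i U V w] is [1 + excess i U V w]. *)
Definition excess i (U : {set T}) (V : {set T}) w : R :=
  \sum_(B : {set T} | (i \in B) && [disjoint B & U])
    (a i B w - (B == [set i])%:R) *
    ((B :\ i \subset V)%:R * ratios (i |: U) (enum (B :\ i)) V w).

(** Telescoping: each factor deletes one more site. This turns the partition function left after the
    removal of a cluster into one with a single site removed, times ratios. *)
Lemma ratiosE (U : {set T}) s (V : {set T}) w :
  (forall U' V' : {set T}, U \subset U' -> 0 < Z (V' :\: U') w) ->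
  uniq s -> {subset s <= V} -> (forall x, x \in s -> x \notin U) ->
  Z (V :\: U) w * ratios U s V w = Z (V :\: (U :|: [set x in s])) w.
Proof.
elim: s U => [|i s IH] U pos /=.
  by move=> _ _ _; rewrite mulr1; congr (Z (_ :\: _) _); apply/setP => x; rewrite !inE orbF.
move=> /andP[nis us] sV sU.
have iV : i \in V by apply: sV; rewrite mem_head.
have iU : i \notin U by apply: sU; rewrite mem_head.
have eV : i |: (V :\: U) = V :\: U.
  by apply/setP => x; rewrite !inE; case: eqP => //= ->; rewrite iU iV.
rewrite /ratio eV mulrA [_ * (_ / _)]mulrCA mulfV ?gt_eqF ?pos // mulr1 IH //.
- congr (Z (_ :\: _) _); apply/setP => x; rewrite !inE; do !case: (_ == _) => //=;
  by rewrite ?orbT //= orbC.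
- by move=> U' V' h; apply: pos; apply: subset_trans h; rewrite subsetU1.
- by move=> x xs; apply: sV; rewrite inE xs orbT.
- move=> x xs; rewrite !inE negb_or sU ?inE ?xs ?orbT // andbT.
  by apply: contraNneq nis => <-.
Qed.

Lemma nrm_ratios (U : {set T}) s :
  (forall (U' : {set T}) i, U \subset U' -> i \notin U' -> nrm (ratio i U') <= G) ->
  uniq s -> (forall x, x \in s -> x \notin U) ->
  nrm (ratios U s) <= G ^+ size s.
Proof.
elim: s U => [|i s IH] U hG /=; first by move=> _ _; exact: nrm1.
move=> /andP[nis us] sU.
apply: le_trans (nrmM _ _) _; rewrite exprS; apply: ler_pM; rewrite ?nrm_ge0 //.
  by apply: hG => //; apply: sU; rewrite mem_head.
apply: IH => //.
- by move=> U' j h; apply: hG; apply: subset_trans h; rewrite subsetU1.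
- move=> x xs; rewrite !inE negb_or sU ?inE ?xs ?orbT // andbT.
  by apply: contraNneq nis => <-.
Qed.

(** Once [i] is gone, deleting the rest of [B] takes [#|B|.-1] ratios, each of norm at most [G]:
    this is the exponent in the hypothesis on [b]. *)
Lemma nrm_excess i (U : {set T}) :
  (forall (U' : {set T}) j, i |: U \subset U' -> j \notin U' -> nrm (ratio j U') <= G) ->
  nrm (excess i U) <= e.
Proof.
move=> hG; apply: le_trans (bG i); apply: le_trans (nrm_sum _ _) _.
rewrite big_mkcondr /=; apply: ler_sum => B iB.
case: ifP => [dBU|_]; last by rewrite mulr_ge0 ?exprn_ge0.
apply: le_trans (nrmZ w0 (b := b i B) _ _) _; first by move=> w; exact: aE.
apply: ler_wpM2l => //; apply: le_trans (nrmM _ _) _.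
rewrite -[leRHS]mul1r; apply: ler_pM; rewrite ?nrm_ge0 //.
  exact: (nrm_superset R W (B :\ i)).
have -> : #|B|.-1 = size (enum (B :\ i)).
  by rewrite -cardE [in LHS](cardsD1 i) iB.
apply: nrm_ratios => //; first exact: enum_uniq.
move=> x; rewrite mem_enum !inE => /andP[xi xB]; rewrite (negbTE xi) /=.
by rewrite (disjointFr dBU).
Qed.

(** The recursion at [i], divided by the partition function without [i]. The set [B = [set i]]
    supplies the leading 1, and the condition that [B] lies in [i |: (V :\: U)] is split into
    disjointness from [U], independent of [V], and an indicator in [V]. *)
Lemma excessE i (U V : {set T}) w :
  (forall U' V' : {set T}, i |: U \subset U' -> 0 < Z (V' :\: U') w) -> i \notin U ->
  Z (i |: (V :\: U)) w = Z (V :\: (i |: U)) w * (1 + excess i U V w).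
Proof.
move=> pos iU; rewrite (@Zrec _ i); last by rewrite setU11.
have step (B : {set T}) : (i \in B) && (B \subset i |: (V :\: U)) =
    ((i \in B) && [disjoint B & U]) && (B :\ i \subset V).
  have [iB|//] /= := boolP (i \in B).
  rewrite disjoint_subset; apply/subsetP/andP => [h|[/subsetP h1 /subsetP h2] x xB].
    split; apply/subsetP => x.
      by move=> /h; rewrite !inE => /orP[/eqP ->//|/andP[]].
    by rewrite !inE => /andP[/negbTE xi /h]; rewrite !inE xi /= => /andP[].
  rewrite !inE; have := h1 x xB; rewrite inE /= => ->.
  by case: (eqVneq x i) => //= xi; apply: h2; rewrite !inE xi.
rewrite (eq_bigl _ _ step) /excess mulrDr mulr1.
have key (B : {set T}) : (i \in B) && [disjoint B & U] -> B :\ i \subset V ->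
   Z ((i |: (V :\: U)) :\: B) w =
   Z (V :\: (i |: U)) w * ratios (i |: U) (enum (B :\ i)) V w.
  move=> /andP[iB dBU] BV; rewrite ratiosE //.
  - congr (Z _ w); apply/setP => x; rewrite !inE mem_enum !inE.
    by case: (eqVneq x i) => [->|_] /=; rewrite ?iB //; case: (x \in B); rewrite ?orbT //= orbF.
  - exact: enum_uniq.
  - by move=> x; rewrite mem_enum => /(subsetP BV).
  - move=> x; rewrite mem_enum !inE => /andP[xi xB]; rewrite (negbTE xi) /=.
    by rewrite (disjointFr dBU).
transitivity (\sum_(B : {set T} | (i \in B) && [disjoint B & U])
   a i B w * ((B :\ i \subset V)%:R * (Z (V :\: (i |: U)) w * ratios (i |: U) (enum (B :\ i)) V w))).
  rewrite big_mkcondr /=; apply: eq_bigr => B hB.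
  by case: ifP => BV; [rewrite mul1r key|rewrite mul0r mulr0].
have ii : (i \in [set i]) && [disjoint [set i] & U].
  by rewrite set11 /= disjoints1.
rewrite (bigD1 [set i]) //= [in RHS](bigD1 [set i]) //= !eqxx.
have -> : [set i] :\ i = set0 by apply/setP => x; rewrite !inE; case: (x == i).
rewrite sub0set enum_set0 /= !mul1r !mulr1 [in RHS]mulrDr addrA; congr (_ + _).
  by rewrite mulrBr mulr1 addrC subrK mulrC.
rewrite big_distrr /=; apply: eq_bigr => B /andP[_ /negbTE ->].
rewrite /= subr0; ring.
Qed.

(** Induction on the number of sites outside [U]: the excess at [i] and [U] only involves ratios at
    sets containing [i |: U]. Positivity is carried along because the recursion is divided by
    partition functions, and [(1 - e)^-1 <= G] returns the bound that was assumed. *)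
Lemma ratio_bounds n (U : {set T}) : (#|~: U| <= n)%N ->
  (forall V w, 0 < Z (V :\: U) w) /\
  (forall i, i \notin U -> nrm (ratio i U) <= G).
Proof.
elim: n U => [|n IH] U cU.
  have UT : U = setT.
    by apply/setP => x; move: cU; rewrite leqn0 cards_eq0 => /eqP/setP/(_ x); rewrite !inE => /negbFE.
  split; first by move=> V w; rewrite UT setDT Z0.
  by move=> i; rewrite UT inE.
have IH' i (U' : {set T}) : i \notin U -> i |: U \subset U' ->
  (forall V w, 0 < Z (V :\: U') w) /\
  (forall i, i \notin U' -> nrm (ratio i U') <= G).
  move=> iU iUU'; apply: IH; rewrite -ltnS; apply: leq_trans cU.
  apply: proper_card; apply/properP; split.
    by rewrite setCS; apply: subset_trans iUU'; rewrite subsetU1.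
  exists i; rewrite inE // negbK.
  by apply: (subsetP iUU'); rewrite setU11.
have ex i : i \notin U -> nrm (excess i U) <= e.
  move=> iU; apply: nrm_excess => U' j h; exact: (IH' i U' iU h).2.
have exE i V w : i \notin U -> Z (i |: (V :\: U)) w = Z (V :\: (i |: U)) w * (1 + excess i U V w).
  by move=> iU; apply: excessE => // U' V' h; exact: (IH' i U' iU h).1.
have expos i V w : i \notin U -> 0 < 1 + excess i U V w.
  move=> iU; have := le_trans (nrm_pt (excess i U) V w) (ex i iU).
  by rewrite ler_norml => /andP[h _]; move: e1; lra.
have pos i V w : i \notin U -> 0 < Z (V :\: (i |: U)) w.
  by move=> iU; apply: (IH' i _ iU _).1.
split.
  move=> V w; have [->|[i iV]] := set_0Vmem (V :\: U); first by rewrite Z0.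
  have iU : i \notin U by move: iV; rewrite inE => /andP[].
  have -> : V :\: U = i |: (V :\: U).
    by apply/setP => x; rewrite !inE; case: eqP => //= ->; move: iV; rewrite inE.
  by rewrite exE // mulr_gt0 ?pos ?expos.
move=> i iU; apply: le_trans eG; rewrite (@eq_nrm _ _ _ _ (fun V w => (1 + excess i U V w)^-1)).
  by apply: nrm_inv => //; exact: ex.
move=> V w; rewrite /ratio exE // invfM mulrA mulfV ?mul1r //.
by rewrite gt_eqF ?pos.
Qed.

Lemma recursion_pos V w : 0 < Z V w.
Proof. by have [h _] := @ratio_bounds _ set0 (leqnn _); rewrite -(setD0 V). Qed.

Lemma nrm_ln_ratio i :
  nrm (fun V w => ln (Z (i |: V) w) - ln (Z (V :\ i) w)) <= e / (1 - e).
Proof.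
have i0 : i \notin set0 by rewrite inE.
rewrite (@eq_nrm _ _ _ _ (fun V w => ln (1 + excess i set0 V w))).
  apply: nrm_ln => //; apply: nrm_excess => U' j _ jU.
  exact: (@ratio_bounds _ U' (leqnn _)).2.
move=> V w; have pos := recursion_pos.
have := @excessE i set0 V w (fun U' V' _ => pos _ _) i0.
rewrite setD0 setU0 => E.
rewrite -ln_div ?posrE // E mulrC mulKf ?gt_eqF //.
Qed.

(** For [A] not containing [i], the coefficient of ln Z at [i |: A] is the coefficient at [A] of the
    difference between ln Z with [i] and ln Z without [i]. The sum over sets through [i] is thus
    part of the norm of the logarithm of one ratio. *)
Lemma moeb_ln_bound i :
  \sum_(A : {set T} | i \in A) maxabs (fun w => moeb (fun V => ln (Z V w)) A) <= e / (1 - e).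
Proof.
apply: le_trans (nrm_ln_ratio i); rewrite /nrm.
rewrite (reindex_onto (fun A => i |: A) (fun A => A :\ i)) /=; last first.
  by move=> A iA; rewrite setD1K.
rewrite big_mkcond /=; apply: ler_sum => A _.
case: ifP => [/andP[_ /eqP Ai]|_]; last exact: maxabs_ge0.
have iA : i \notin A by rewrite -Ai setD11.
rewrite le_eqVlt; apply/orP; left; apply/eqP; apply: eq_bigr => w _; congr (`| _ |).
rewrite /moeb (bigID (fun B : {set T} => i \in B)) /=.
rewrite (reindex_onto (fun B => i |: B) (fun B => B :\ i)) /=; last first.
  by move=> B /andP[_ iB]; rewrite setD1K.
have c1 (B : {set T}) : [&& i |: B \subset i |: A, i \in i |: B & (i |: B) :\ i == B] = (B \subset A).
  apply/and3P/idP => [[h _ /eqP <-]|h].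
    by rewrite -Ai setSD.
  split; first exact: setUS.
    exact: setU11.
  by rewrite setU1K //; apply: contra iA; exact: (subsetP h).
rewrite (eq_bigl (fun B : {set T} => B \subset A)); last by move=> B; rewrite -andbA c1.
have c2 (B : {set T}) : (B \subset i |: A) && (i \notin B) = (B \subset A).
  by rewrite -subsetD1 setU1K.
rewrite [X in _ + X](eq_bigl (fun B : {set T} => B \subset A)) //.
rewrite -big_split; apply: eq_bigr => B BA /=.
have iB : i \notin B by apply: contra iA; exact: (subsetP BA).
have -> : B :\ i = B by apply/setP => x; rewrite !inE; case: eqP => // ->; rewrite (negbTE iB).
rewrite !cardsU1 iA iB !(addnS,addSn,add0n,addn0) !exprS mulrBr.
by rewrite !mulN1r opprK mulNr.
Qed.

End Ratios.

(** * Families of sets and the cluster of a site *)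

Section Clusters.
Import mathcomp.boot.fintype mathcomp.boot.finset.
Variable (T : finType).
Implicit Types (A B V S : {set T}) (g h : {set {set T}}).

(** The empty set is left out: lying both in a set and in its complement, it would make the
    splitting of a family ambiguous. *)
Definition psubsets V : {set {set T}} := [set A : {set T} | (A \subset V) && (A != set0)].

Definition saturated g S := [forall A in g, [disjoint A & S] || (A \subset S)].

(** The union of all overlapping chains of members of [g] that start at [i], described as a closure
    so that no chains have to be handled. It contains [i] even when no member of [g] does. *)
Definition component i g : {set T} := \bigcap_(S : {set T} | (i \in S) && saturated g S) S.

Lemma component_min i g S : i \in S -> saturated g S -> component i g \subset S.
Proof. by move=> iS sS; apply: bigcap_inf; rewrite iS sS. Qed.

Lemma mem_component i g : i \in component i g.
Proof. by apply/bigcapP => S /andP[]. Qed.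

Lemma saturatedP g S :
  reflect (forall A x y, A \in g -> x \in A -> x \in S -> y \in A -> y \in S) (saturated g S).
Proof.
apply: (iffP forall_inP) => [h A x y Ag xA xS yA|h A Ag].
  have /orP[d|/subsetP] := h A Ag; last exact.
  by move: xS; rewrite (disjointFr d).
case: (boolP [disjoint A & S]) => //= /pred0Pn[x /andP[xA xS]].
by apply/subsetP => y; exact: h xA xS.
Qed.

Lemma component_saturated i g : saturated g (component i g).
Proof.
apply/saturatedP => A x y Ag xA /bigcapP xC yA; apply/bigcapP => S hS.
have := xC S hS; case/andP: hS => _ /saturatedP hS xS; exact: hS Ag xA xS yA.
Qed.

Lemma saturated_sub g h S : h \subset g -> saturated g S -> saturated h S.
Proof. by move=> /subsetP hg /saturatedP hS; apply/saturatedP => A x y /hg; exact: hS. Qed.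

Lemma component_sub i g h : h \subset g -> component i h \subset component i g.
Proof.
move=> hg; apply: component_min; first exact: mem_component.
exact: saturated_sub hg (component_saturated i g).
Qed.

Lemma psubsetsP V A : reflect (A \subset V /\ exists x, x \in A) (A \in psubsets V).
Proof.
rewrite inE; apply: (iffP andP) => -[-> h]; split=> //; first exact/set0Pn.
exact/set0Pn.
Qed.

(** Members of [h] avoid [B], so the closure that starts inside [B] never meets them. *)
Lemma component_setU i B V g h : g \subset psubsets B -> h \subset psubsets (V :\: B) ->
  (component i (g :|: h) == B) = (component i g == B).
Proof.
move=> /subsetP gB /subsetP hB.
have hd A x : A \in h -> x \in A -> x \notin B.
  by move=> /hB /psubsetsP[/subsetP AV _] /AV; rewrite inE => /andP[].
apply/eqP/eqP => E.
  apply/eqP; rewrite eqEsubset -{1}E component_sub ?subsetUl //=.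
  rewrite -E; apply: component_min; first exact: mem_component.
  apply/saturatedP => A x y; rewrite inE => /orP[Ag|Ah] xA xS.
    exact: (saturatedP _ _ (component_saturated i g)) Ag xA xS.
  have xB : x \in B by rewrite -E; apply: (subsetP (component_sub i _)) xS; rewrite subsetUl.
  by rewrite (negbTE (hd A x Ah xA)) in xB.
apply/eqP; rewrite eqEsubset; apply/andP; split; last by rewrite -{1}E component_sub ?subsetUl.
apply: component_min; first by rewrite -E mem_component.
apply/saturatedP => A x y; rewrite inE => /orP[Ag|Ah] xA xS yA.
  by have /psubsetsP[/subsetP AB _] := gB A Ag; exact: AB.
by rewrite (negbTE (hd A x Ah xA)) in xS.
Qed.

Lemma component0 i : component i set0 = [set i].
Proof.
apply/eqP; rewrite eqEsubset sub1set mem_component andbT.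
by apply: component_min; [rewrite set11|apply/saturatedP => A x y; rewrite in_set0].
Qed.

(** A nonempty family whose cluster fills [B] must cover [i], and then covers [B]. This transfers
    exponential decay in the sizes of the members to decay in the size of the cluster. *)
Lemma card_component i g B : g \subset psubsets B -> component i g = B -> g != set0 ->
  (#|B| <= \sum_(A in g) #|A|)%N.
Proof.
move=> gB E g0.
have iu : i \in \bigcup_(A in g) A.
  apply/negPn/negP => ni.
  have E1 : component i g = [set i].
    apply/eqP; rewrite eqEsubset sub1set mem_component andbT.
    apply: component_min; first by rewrite set11.
    apply/saturatedP => A x y Ag xA; rewrite inE => /eqP xi.
    by case/bigcupP: ni; exists A; rewrite // -xi.
  have [A Ag] := set0Pn _ g0.
  have /psubsetsP[AB [x xA]] := subsetP gB A Ag.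
  have xi : x = i by apply/set1P; rewrite -E1 E; exact: (subsetP AB).
  by case/bigcupP: ni; exists A; rewrite // -xi.
have sB : B \subset \bigcup_(A in g) A.
  rewrite -E; apply: component_min => //.
  by apply/saturatedP => A x y Ag _ _ yA; apply/bigcupP; exists A.
apply: leq_trans (subset_leq_card sB) _.
elim/big_rec2: _ => [|A n S _ h]; first by rewrite cards0.
by apply: leq_trans (leq_card_setU _ _) _; rewrite leq_add2l.
Qed.

Variable R : comPzRingType.

Definition clusterw (Y : {set {set T}} -> R) i B : R :=
  \sum_(g : {set {set T}} | (g \subset psubsets B) && (component i g == B)) Y g.

(** With [B] the cluster of [i], every member of the family lies inside [B] or is disjoint from it;
    the family splits uniquely, and the weight with it. *)
Lemma cluster_decomposition (Y : {set {set T}} -> R) (V : {set T}) i :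
  (forall B g h, g \subset psubsets B -> h \subset psubsets (~: B) -> Y (g :|: h) = Y g * Y h) ->
  i \in V ->
  \sum_(g : {set {set T}} | g \subset psubsets V) Y g =
  \sum_(B : {set T} | (i \in B) && (B \subset V)) clusterw Y i B *
    \sum_(g : {set {set T}} | g \subset psubsets (V :\: B)) Y g.
Proof.
move=> Ymul iV.
have compV g : g \subset psubsets V -> component i g \subset V.
  move=> gV; apply: component_min => //; apply/saturatedP => A x y Ag _ _ yA.
  by have /psubsetsP[/subsetP AV _] := subsetP gV A Ag; exact: AV.
rewrite (partition_big (component i) (fun B => (i \in B) && (B \subset V))) /=; last first.
  by move=> g gV; rewrite mem_component compV.
apply: eq_bigr => B /andP[iB BV].
rewrite /clusterw big_distrl /=; under [RHS]eq_bigr do rewrite big_distrr /=.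
rewrite pair_big /=.
have disj g h : g \subset psubsets B -> h \subset psubsets (V :\: B) ->
    (g :|: h) :&: psubsets B = g /\ (g :|: h) :&: psubsets (V :\: B) = h.
  move=> /subsetP gB /subsetP hB; split; apply/setP => A; rewrite in_setI in_setU.
    have [Ag|nAg] /= := boolP (A \in g); first by rewrite gB.
    apply/negP => /andP[/hB /psubsetsP[/subsetP AV [x xA]] /psubsetsP[/subsetP AB _]].
    by have := AV x xA; rewrite inE (AB x xA).
  have [Ah|nAh] /= := boolP (A \in h); first by rewrite orbT hB.
  rewrite orbF; apply/negP => /andP[/gB /psubsetsP[/subsetP AB [x xA]] /psubsetsP[/subsetP AV _]].
  by have := AV x xA; rewrite inE (AB x xA).
rewrite (reindex_onto (fun p : {set {set T}} * {set {set T}} => p.1 :|: p.2)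
   (fun g => (g :&: psubsets B, g :&: psubsets (V :\: B)))) /=; last first.
  move=> g /andP[gV /eqP E]; rewrite -setIUr; apply/setIidPl; apply/subsetP => A Ag.
  have /psubsetsP[AV nA] := subsetP gV A Ag; rewrite in_setU.
  have /forall_inP/(_ A Ag) := component_saturated i g; rewrite E => /orP[d|AB].
    apply/orP; right; apply/psubsetsP; split=> //.
    by rewrite subsetD AV.
  by apply/orP; left; apply/psubsetsP.
apply: eq_big => [[g h]|[g h]] /=.
  apply/idP/idP => [/andP[/andP[ghV /eqP E] /eqP[Eg Eh]]|/andP[/andP[gB cg] hV]].
    have gB : g \subset psubsets B by rewrite -Eg subsetIr.
    have hV : h \subset psubsets (V :\: B) by rewrite -Eh subsetIr.
    by rewrite gB hV -(component_setU i gB hV) E eqxx.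
  have [Eg Eh] := disj g h gB hV.
  rewrite Eg Eh eqxx (component_setU i gB hV) cg !andbT subUset.
  apply/andP; split; apply/subsetP => A.
    move=> /(subsetP gB)/psubsetsP[AB nA]; apply/psubsetsP; split=> //.
    exact: subset_trans AB BV.
  move=> /(subsetP hV)/psubsetsP[AB nA]; apply/psubsetsP; split=> //.
  by apply: subset_trans AB _; rewrite subsetDl.
move=> /andP[_ /eqP[Eg Eh]]; apply: (Ymul B); first by rewrite -Eg subsetIr.
rewrite -Eh; apply: subset_trans (subsetIr _ _) _; apply/subsetP => A.
move=> /psubsetsP[AB nA]; apply/psubsetsP; split=> //.
by apply: subset_trans AB _; rewrite setDE subsetIr.
Qed.

End Clusters.

(** * Moebius coefficients of products and powers *)

Section SubsetExpansion.
Import mathcomp.boot.fintype mathcomp.boot.finset.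
Variables (T : finType) (R : comPzRingType).
Implicit Types (f g h : {set T}) (F : {set T} -> R).

Lemma prod_subsets (P : {set T}) (x y : T -> R) :
  \prod_(A in P) (x A + y A) =
  \sum_(f : {set T} | f \subset P) \prod_(A in f) x A * \prod_(A in P :\: f) y A.
Proof.
rewrite [LHS]big_mkcond /=.
transitivity (\prod_(A : T) ((if A \in P then x A else 0) + (if A \in P then y A else 1))).
  by apply: eq_bigr => A _; case: ifP; rewrite ?add0r.
rewrite bigA_distr [RHS]big_mkcond /=; apply: eq_bigr => f _.
case: ifP => [fP|/negbT/subsetPn[A Af AP]]; last first.
  by rewrite (bigD1 A) //= Af (negbTE AP) mul0r.
rewrite [X in X * _]big_mkcond [X in _ * X]big_mkcond -big_split /=.
apply: eq_bigr => A _; rewrite inE.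
by case: ifP => [/(subsetP fP) ->|_] /=; rewrite ?mulr1 ?mul1r.
Qed.

Lemma prod1D_subsets (P : {set T}) (x : T -> R) :
  \prod_(A in P) (1 + x A) = \sum_(f : {set T} | f \subset P) \prod_(A in f) x A.
Proof.
under eq_bigr do rewrite addrC; rewrite prod_subsets; apply: eq_bigr => f _.
by rewrite [X in _ * X]big1 ?mulr1.
Qed.

Lemma moeb_prod (x : T -> R) f :
  moeb (fun g => \prod_(A in g) x A) f = \prod_(A in f) (x A - 1).
Proof.
rewrite prod_subsets /moeb; apply: eq_bigr => g gf.
rewrite mulrC prodr_const; congr (_ * _).
by rewrite -(cardsID g f) (setIidPr gf) addnAC exprD signDn mul1r.
Qed.

(** An additive function of the family has coefficients only at singletons; a singleton [A] and a
    set [C] have union [f] only if [C] is [f] or [f :\ A]. Iterated, this is the recursion for the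
    coefficients of the powers of a Hamiltonian. *)
Lemma moeb_sum_mul (x : T -> R) F f :
  moeb (fun g => (\sum_(A in g) x A) * F g) f =
  \sum_(A in f) x A * (moeb F f + moeb F (f :\ A)).
Proof.
rewrite moebM.
have mx B : moeb (fun g => \sum_(A in g) x A) B = \sum_A x A * (B == [set A])%:R.
  have -> : moeb (fun g => \sum_(A in g) x A) B =
     moeb (fun g => \sum_A x A * ([set A] \subset g)%:R) B.
    apply: eq_moeb => g _; rewrite big_mkcond /=; apply: eq_bigr => A _.
    by rewrite sub1set; case: ifP; rewrite ?mulr1 ?mulr0.
  rewrite /moeb; under eq_bigr do rewrite big_distrr /=.
  rewrite exchange_big /=; apply: eq_bigr => A _.
  by rewrite -moeb_superset -moebZ.
under eq_bigr => B _ do under eq_bigr => C _ do rewrite mx big_distrl /=.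
under eq_bigr => B _ do rewrite exchange_big /=.
rewrite exchange_big /= [RHS]big_mkcond /=; apply: eq_bigr => A _.
rewrite (bigD1 [set A]) //= [X in _ + X]big1 ?addr0; last first.
  by move=> B /negbTE BA; rewrite big1 // => C _; rewrite BA mulr0 mul0r.
rewrite eqxx -big_distrr /= mulr1.
case: ifP => [Af|nAf]; last first.
  rewrite big_pred0 ?mulr0 // => C; apply/negbTE; apply: contraFN nAf => /eqP <-.
  exact: setU11.
congr (_ * _); rewrite (bigD1 f) /=; last first.
  by apply/eqP; apply/setP => y; rewrite !inE; case: eqP => // ->.
congr (_ + _); rewrite (big_pred1 (f :\ A)) // => C /=.
apply/andP/eqP => [[/eqP <- nC]|->].
  apply/esym; apply: setU1K; apply: contra nC => AC.
  by apply/eqP; apply/setP => y; rewrite !inE; case: eqP => // ->.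
rewrite setD1K // eqxx; split=> //; apply/eqP => /setP/(_ A).
by rewrite !inE eqxx Af.
Qed.

(** Source of the factorisation of the weights: the subsets of a disjoint union are pairs of
    subsets, and the signs multiply. *)
Lemma moeb_setU F g h : [disjoint g & h] ->
  (forall g' h', g' \subset g -> h' \subset h -> F (g' :|: h') = F g' * F h') ->
  moeb F (g :|: h) = moeb F g * moeb F h.
Proof.
move=> dgh FM; rewrite /moeb big_distrl /=.
under [RHS]eq_bigr do rewrite big_distrr /=.
rewrite pair_big /=.
rewrite (reindex_onto (fun p : {set T} * {set T} => p.1 :|: p.2)
   (fun f => (f :&: g, f :&: h))) /=; last first.
  by move=> f fgh; rewrite -setIUr; apply/setIidPl.
have dj A : A \in g -> A \in h -> False.
  by move=> Ag Ah; rewrite (disjointFr dgh Ag) in Ah.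
apply: eq_big => [[g' h']|[g' h']] /=.
  apply/andP/andP => [[s /eqP[E1 E2]]|[/subsetP s1 /subsetP s2]].
    by rewrite -E1 -E2 !subsetIr.
  rewrite setUSS ?(introT subsetP) //; split=> //; apply/eqP; congr (_, _);
  apply/setP => A; rewrite !inE.
    have [Ag|nAg] := boolP (A \in g'); first by rewrite s1.
    by apply/negbTE/negP => /andP[/s2 Ah Ag]; exact: dj Ag Ah.
  have [Ah|nAh] := boolP (A \in h'); first by rewrite orbT s2.
  by rewrite orbF; apply/negbTE/negP => /andP[/s1 Ag Ah]; exact: dj Ag Ah.
move=> /andP[_ /eqP[E1 E2]].
have s1 : g' \subset g by rewrite -E1 subsetIr.
have s2 : h' \subset h by rewrite -E2 subsetIr.
rewrite FM // !cardsU.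
have -> : g :&: h = set0 by apply/setP => A; rewrite !inE; apply/negbTE/negP => /andP[]; exact: dj.
have -> : g' :&: h' = set0.
  by apply/setP => A; rewrite !inE; apply/negbTE/negP => /andP[/(subsetP s1) + /(subsetP s2)]; exact: dj.
by rewrite !cards0 !subn0 !exprD; ring.
Qed.

End SubsetExpansion.

(** * Convergence from summability of the weights *)

Section ClusterExpansion.
Import mathcomp.boot.fintype mathcomp.boot.finset.
Variables (R : realType) (T W : finType) (w0 : W).
Variables (Y : {set {set T}} -> W -> R) (c : {set T} -> R) (k s : R).
Hypothesis Y0 : forall w, Y set0 w = 1.
Hypothesis YM : forall w (B : {set T}) (g h : {set {set T}}), g \subset psubsets B ->
  h \subset psubsets (~: B) -> Y (g :|: h) w = Y g w * Y h w.
Hypothesis c0 : forall A, 0 <= c A.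
Hypothesis Yc : forall g w, `|Y g w| <= \prod_(A in g) c A.
Hypothesis cs : forall i, \sum_(A : {set T} | i \in A) c A * expR k ^+ #|A| <= s.
Hypothesis s0 : 0 <= s.
Hypothesis sk : s + s <= k.

Definition clusterZ V w : R := \sum_(g : {set {set T}} | g \subset psubsets V) Y g w.

Let b i B : R := \sum_(g : {set {set T}} | [&& g \subset psubsets B, component i g == B & g != set0])
  \prod_(A in g) c A.

Let c' A := c A * expR k ^+ #|A|.
Let E V : R := \prod_(A in psubsets V) (1 + c' A).

Let c'0 A : 0 <= c' A. Proof. by rewrite mulr_ge0 ?exprn_ge0 ?expR_ge0. Qed.

Let E0 V : 0 < E V.
Proof. by apply: prodr_gt0 => A _; rewrite ltr_wpDr. Qed.

(** Deleting [B] from the majorant product only loses the factors of sets meeting [B]. Each is at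
    most the exponential of its weight, and these weights add up to at most [s] per site of [B]. *)
Let ED (B : {set T}) : expR (- s) ^+ #|B| * E setT <= E (~: B).
Proof.
have -> : E setT = E (~: B) * \prod_(A in psubsets setT | ~~ [disjoint A & B]) (1 + c' A).
  rewrite /E (bigID (fun A : {set T} => [disjoint A & B])) /=; congr (_ * _); apply: eq_bigl => A.
  by rewrite !inE subsetT /= andbC disjoints_subset.
rewrite mulrCA -[leRHS]mulr1 ler_pM2l // -expRM_natl mulrN.
rewrite expRN ler_pdivrMl ?expR_gt0 // mulr1.
apply: (@le_trans _ _ (expR (\sum_(A in psubsets setT | ~~ [disjoint A & B]) c' A))).
  rewrite expR_sum; apply: ler_prod => A _.
  by rewrite expR_ge1Dx andbT addr_ge0.
rewrite ler_expR.
apply: (@le_trans _ _ (\sum_(i in B) \sum_(A : {set T} | i \in A) c' A)); last first.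
  apply: le_trans (ler_sum (G := fun=> s) _ _) _; first by move=> i _; exact: cs.
  by rewrite sumr_const mulr_natl.
rewrite (exchange_big_dep predT) //= big_mkcond /=.
apply: ler_sum => A _; case: ifP => [/andP[_ /pred0Pn[x /andP[xA xB]]]|_]; last exact: sumr_ge0.
rewrite (bigD1 x) /=; last exact/andP.
by rewrite lerDl sumr_ge0.
Qed.

(** The majorant weights are multiplicative, so their partition function [E] obeys the peeling
    identity too. Divided by [E setT], that identity writes 1 as a sum of cluster weights times E(~:
    B) / E(setT), and [ED] bounds these quotients from below by e^{-s |B|}. *)
Let b_bound i : \sum_(B : {set T} | i \in B) b i B * expR s ^+ #|B|.-1 <= 1 - expR (- s).
Proof.
have Y'M (B : {set T}) (g h : {set {set T}}) : g \subset psubsets B -> h \subset psubsets (~: B) ->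
   \prod_(A in g :|: h) c' A = \prod_(A in g) c' A * \prod_(A in h) c' A.
  move=> /subsetP gB /subsetP hB; rewrite -bigU //=.
    by apply: eq_bigl => A; rewrite in_setU.
  apply/pred0P => A /=; apply/negbTE/negP => /andP[/gB/psubsetsP[/subsetP AB [x xA]]].
  by move=> /hB/psubsetsP[/subsetP AB' _]; have := AB' x xA; rewrite inE AB.
have EE V : \sum_(g : {set {set T}} | g \subset psubsets V) \prod_(A in g) c' A = E V.
  by rewrite /E prod1D_subsets.
have := cluster_decomposition Y'M (in_setT i).
rewrite EE; under eq_bigr do rewrite EE; move=> dec.
have : \sum_(B : {set T} | i \in B) clusterw (fun g => \prod_(A in g) c' A) i B * expR (- s) ^+ #|B| <= 1.
  rewrite -(ler_pM2r (E0 setT)) mul1r {2}dec big_distrl /=.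
  rewrite [X in _ <= X](eq_bigl (fun B : {set T} => i \in B)); last by move=> B; rewrite subsetT andbT.
  apply: ler_sum => B _; rewrite -mulrA ler_wpM2l ?setTD ?ED //.
  by apply: sumr_ge0 => g _; exact: prodr_ge0.
have wE (B : {set T}) : i \in B -> (B == [set i])%:R + b i B * expR k ^+ #|B| <=
    clusterw (fun g => \prod_(A in g) c' A) i B.
  move=> iB; rewrite /clusterw (bigID (fun g => g == set0)) /=; apply: lerD.
    case: eqP => [->|_]; last by apply: sumr_ge0 => g _; exact: prodr_ge0.
    rewrite (big_pred1 set0) ?big_set0 // => g /=.
    by case: (eqVneq g set0) => [->|]; rewrite ?andbF // sub0set component0 eqxx.
  rewrite /b big_distrl /= [X in _ <= X](eq_bigl (fun g : {set {set T}} => [&& g \subset psubsets B, component i g == B & g != set0])); last by move=> g; rewrite andbA.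
  apply: ler_sum => g /and3P[gB /eqP gc g0].
  rewrite /c' big_split /= ler_wpM2l ?prodr_ge0 // -expr_sum.
  rewrite ler_weXn2l ?(card_component gB gc) //.
  by rewrite -expR0 ler_expR; move: s0 sk; lra.
move=> H; rewrite lerBrDr; apply: le_trans H.
(* The empty family has cluster [[set i]]; its share e^{-s} is what is subtracted from 1. *)
rewrite addrC -(expr1 (expR (- s))) -{1}(cards1 i).
apply: (@le_trans _ _ (\sum_(B : {set T} | i \in B)
  ((B == [set i])%:R + b i B * expR k ^+ #|B|) * expR (- s) ^+ #|B|)); last first.
  by apply: ler_sum => B iB; rewrite ler_wpM2r ?exprn_ge0 ?expR_ge0 ?wE.
under [X in _ <= X]eq_bigr do rewrite mulrDl.
rewrite big_split /= [X in _ <= X + _](bigD1 [set i]) ?set11 //= eqxx mul1r.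
rewrite [X in _ <= _ + X + _]big1 ?addr0; last by move=> B /andP[_ /negbTE ->]; rewrite mul0r.
rewrite lerD2l; apply: ler_sum => B iB; rewrite -mulrA ler_wpM2l //.
  by apply: sumr_ge0 => g _; exact: prodr_ge0.
(* Half of [k] absorbs the factor e^{-s |B|} of the deletion, the other half supplies the power of G
   = e^s. *)
rewrite -exprMn -expRD; apply: (@le_trans _ _ (expR s ^+ #|B|)).
  by rewrite ler_weXn2l ?leq_pred // -expR0 ler_expR.
by rewrite lerXn2r ?nnegrE ?expR_ge0 // ler_expR; move: sk; lra.
Qed.

Let hyp_a i B w : `|clusterw (Y^~ w) i B - (B == [set i])%:R| <= b i B.
Proof.
have [iB|iB] := boolP (i \in B); last first.
  rewrite /clusterw big1 /b; last first.
    by move=> g /andP[_ /eqP E1]; rewrite -E1 mem_component in iB.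
  rewrite sub0r normrN; case: eqP => [E1|_]; first by rewrite E1 set11 in iB.
  by rewrite normr0; apply: sumr_ge0 => g _; exact: prodr_ge0.
rewrite /clusterw (bigID (fun g => g == set0)) /=.
rewrite [X in X + _ - _](_ : _ = (B == [set i])%:R); last first.
  case: eqP => [->|nB].
    rewrite (big_pred1 set0) // => g /=.
    by case: (eqVneq g set0) => [->|]; rewrite ?andbF // sub0set component0 eqxx.
  rewrite big_pred0 // => g; apply/negbTE/negP => /andP[/andP[_ /eqP E1] /eqP E2].
  by apply: nB; rewrite -E1 E2 component0.
rewrite addrAC subrr add0r; apply: le_trans (ler_norm_sum _ _ _) _.
rewrite /b [X in _ <= X](eq_bigl (fun g : {set {set T}} => ((g \subset psubsets B) && (component i g == B)) && (g != set0))).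
  by apply: ler_sum => g _; exact: Yc.
by move=> g; rewrite andbA.
Qed.

(** With e = 1 - e^{-s} and G = e^s the condition closing the recursion is an equality, and e / (1 -
    e) is the final bound e^s - 1. *)
Let hyp_e : (1 - (1 - expR (- s)))^-1 <= expR s.
Proof. by rewrite opprB addrC subrK expRN invrK. Qed.

Let hyp_e1 : 1 - expR (- s) < 1.
Proof. by rewrite ltrBlDr ltrDl expR_gt0. Qed.

Let Zrec (V : {set T}) i w : i \in V -> clusterZ V w =
  \sum_(B : {set T} | (i \in B) && (B \subset V)) clusterw (Y^~ w) i B * clusterZ (V :\: B) w.
Proof. by move=> iV; apply: cluster_decomposition => // B g h; exact: YM. Qed.

Let Z0 w : clusterZ set0 w = 1.
Proof.
rewrite /clusterZ (big_pred1 set0) // => g /=.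
apply/subsetP/eqP => [h|->]; last by move=> A; rewrite in_set0.
apply/setP => A; rewrite in_set0; apply/negbTE/negP => /h/psubsetsP[/subsetP A0 [x /A0]].
by rewrite in_set0.
Qed.

Lemma clusterZ_gt0 V w : 0 < clusterZ V w.
Proof. exact: (recursion_pos w0 Z0 Zrec hyp_a b_bound hyp_e1 hyp_e). Qed.

Lemma cluster_expansion i :
  \sum_(A : {set T} | i \in A) maxabs (fun w => moeb (fun V => ln (clusterZ V w)) A) <=
  expR s - 1.
Proof.
have := moeb_ln_bound w0 Z0 Zrec hyp_a b_bound hyp_e1 hyp_e i.
by rewrite subKr expRN invrK mulrBl mul1r mulVf ?gt_eqF ?expR_gt0.
Qed.

End ClusterExpansion.

Local Open Scope classical_set_scope.

(** * Operators on a finite-dimensional space *)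

Section Kernel.
Variables (R : realType) (I : finType).
Local Notation C := (R[i]).
Implicit Types (M N P : I -> I -> C) (u v : I -> C).
Local Notation Re := complex.Re.
Local Notation Im := complex.Im.
Local Notation kadd := Defs.kadd.

Lemma cReD (x y : C) : Re (x + y) = Re x + Re y. Proof. by case: x y => ? ? [] ? ?. Qed.
Lemma cImD (x y : C) : Im (x + y) = Im x + Im y. Proof. by case: x y => ? ? [] ? ?. Qed.
Lemma cReM (x y : C) : Re (x * y) = Re x * Re y - Im x * Im y.
Proof. by case: x y => ? ? [] ? ?. Qed.
Lemma cImM (x y : C) : Im (x * y) = Re x * Im y + Im x * Re y.
Proof. by case: x y => ? ? [] ? ?. Qed.
Lemma Re_conjc (x : C) : Re (conjc x) = Re x. Proof. by case: x. Qed.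
Lemma Im_conjc (x : C) : Im (conjc x) = - Im x. Proof. by case: x. Qed.
Lemma Re_sum (J : Type) (r : seq J) (Q : pred J) (F : J -> C) :
  Re (\sum_(i <- r | Q i) F i) = \sum_(i <- r | Q i) Re (F i).
Proof. by elim/big_rec2: _ => // i x y _ <-; rewrite cReD. Qed.
Lemma Im_sum (J : Type) (r : seq J) (Q : pred J) (F : J -> C) :
  Im (\sum_(i <- r | Q i) F i) = \sum_(i <- r | Q i) Im (F i).
Proof. by elim/big_rec2: _ => // i x y _ <-; rewrite cImD. Qed.
Lemma conjc_sum (J : Type) (r : seq J) (Q : pred J) (F : J -> C) :
  conjc (\sum_(i <- r | Q i) F i) = \sum_(i <- r | Q i) conjc (F i).
Proof. by rewrite rmorph_sum. Qed.
Lemma complexP (x y : C) : Re x = Re y -> Im x = Im y -> x = y.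
Proof. by case: x y => ? ? [] ? ? /= -> ->. Qed.
Lemma cabs2M (x y : C) : cabs2 (x * y) = cabs2 x * cabs2 y.
Proof. by rewrite /cabs2 cReM cImM; ring. Qed.
Lemma cabs2_ge0 (x : C) : 0 <= cabs2 x. Proof. by rewrite addr_ge0 ?sqr_ge0. Qed.
Lemma cabs2_eq0 (x : C) : cabs2 x = 0 -> x = 0.
Proof.
move=> /eqP; rewrite paddr_eq0 ?sqr_ge0 // !sqrf_eq0 => /andP[/eqP h1 /eqP h2].
exact: complexP.
Qed.

Definition kapp M v : I -> C := fun s => \sum_t M s t * v t.
Definition nrm2 v : R := \sum_s cabs2 (v s).
Definition rdot u v : R := \sum_s (Re (u s) * Re (v s) + Im (u s) * Im (v s)).

Lemma nrm2_ge0 v : 0 <= nrm2 v. Proof. by apply: sumr_ge0 => s _; exact: cabs2_ge0. Qed.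

Lemma nrm2_le0 v s : nrm2 v <= 0 -> v s = 0.
Proof.
move=> h; apply: cabs2_eq0; apply/eqP; rewrite eq_le cabs2_ge0 andbT.
apply: le_trans h; rewrite /nrm2 (bigD1 s) //= lerDl.
by apply: sumr_ge0 => t _; exact: cabs2_ge0.
Qed.

(** Cauchy-Schwarz for the real inner product, read off from the nonnegativity of the squared norm
    of b u - a v, so that no square root occurs. *)
Lemma rdot_le u v (a b x : R) : 0 <= a -> 0 <= b -> nrm2 u <= a ^+ 2 * x ->
  nrm2 v <= b ^+ 2 * x -> rdot u v <= a * b * x.
Proof.
rewrite le_eqVlt => /predU1P[<-|a0]; rewrite le_eqVlt.
  rewrite expr0n /= !mul0r => _ u0 _; rewrite /rdot big1 // => s _.
  by rewrite (nrm2_le0 s u0) /= !mul0r addr0.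
move=> /predU1P[<-|b0].
  rewrite expr0n /= mulr0 !mul0r => _ v0; rewrite /rdot big1 // => s _.
  by rewrite (nrm2_le0 s v0) /= !mulr0 addr0.
move=> hu hv.
have h0 : 0 <= nrm2 (fun s => (Complex b 0) * u s - (Complex a 0) * v s) by exact: nrm2_ge0.
have E : nrm2 (fun s => (Complex b 0) * u s - (Complex a 0) * v s) =
    b ^+ 2 * nrm2 u - 2 * a * b * rdot u v + a ^+ 2 * nrm2 v.
  rewrite /nrm2 /rdot !big_distrr /= -sumrB -big_split /=; apply: eq_bigr => s _.
  rewrite /cabs2; case: (u s) => x1 x2; case: (v s) => y1 y2 /=; ring.
rewrite E in h0.
have h1 : b ^+ 2 * nrm2 u <= b ^+ 2 * (a ^+ 2 * x) by rewrite ler_wpM2l ?sqr_ge0.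
have h2 : a ^+ 2 * nrm2 v <= a ^+ 2 * (b ^+ 2 * x) by rewrite ler_wpM2l ?sqr_ge0.
have ab : 0 < a * b by rewrite mulr_gt0.
have h3 : a * b * rdot u v <= a * b * (a * b * x) by move: h0 h1 h2; lra.
by rewrite ler_pM2l in h3.
Qed.

(** An upper bound on the operator norm, kept as a relation: sums, products and embeddings combine
    such bounds without handling a supremum. *)
Definition kbounded M (c : R) := 0 <= c /\ forall v, nrm2 (kapp M v) <= c ^+ 2 * nrm2 v.

Lemma eq_kbounded M N c : (forall s t, M s t = N s t) -> kbounded M c -> kbounded N c.
Proof.
move=> h [c0 hM]; split=> // v; rewrite (_ : kapp N v = kapp M v) //.
by apply/funext => s; apply: eq_bigr => t _; rewrite h.
Qed.

Lemma kbounded0 : kbounded (fun _ _ => 0) 0.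
Proof.
split=> // v; rewrite expr0n mul0r /nrm2 big1 // => s _.
by rewrite /kapp big1 ?/cabs2 /= ?expr0n ?addr0 // => t _; rewrite mul0r.
Qed.

Lemma kbounded1 : kbounded (@kone R I) 1.
Proof.
split=> // v; rewrite expr1n mul1r le_eqVlt; apply/orP; left; apply/eqP.
apply: eq_bigr => s _; congr cabs2; rewrite /kapp /kone (bigD1 s) //= eqxx mul1r.
by rewrite big1 ?addr0 // => t; rewrite eq_sym => /negbTE ->; rewrite mul0r.
Qed.

Lemma kboundedD M N a b : kbounded M a -> kbounded N b -> kbounded (kadd M N) (a + b).
Proof.
move=> [a0 hM] [b0 hN]; split; first exact: addr_ge0.
move=> v; have := rdot_le a0 b0 (hM v) (hN v) => h.
have E : nrm2 (kapp (kadd M N) v) =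
  nrm2 (kapp M v) + 2 * rdot (kapp M v) (kapp N v) + nrm2 (kapp N v).
  rewrite /nrm2 /rdot big_distrr /= -!big_split /=; apply: eq_bigr => s _.
  have -> : kapp (kadd M N) v s = kapp M v s + kapp N v s.
    by rewrite /kapp -big_split /=; apply: eq_bigr => t _; rewrite /kadd mulrDl.
  by rewrite /cabs2 cReD cImD; ring.
rewrite E sqrrD mulrDl mulrDl; have := hM v; have := hN v; move: h.
rewrite -mulr_natl; lra.
Qed.

Lemma kbounded_sum (J : Type) (r : seq J) (Q : pred J) (F : J -> I -> I -> C) (c : J -> R) :
  (forall j, Q j -> kbounded (F j) (c j)) ->
  kbounded (fun s t => \sum_(j <- r | Q j) F j s t) (\sum_(j <- r | Q j) c j).
Proof.
move=> h; elim: r => [|j r IH].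
  by rewrite big_nil; apply: eq_kbounded kbounded0 => s t; rewrite big_nil.
rewrite big_cons; case: ifP => Qj; last first.
  by apply: eq_kbounded IH => s t; rewrite big_cons Qj.
by apply: eq_kbounded (kboundedD (h j Qj) IH) => s t; rewrite big_cons Qj.
Qed.

Lemma kboundedM M N a b : kbounded M a -> kbounded N b -> kbounded (kmul M N) (a * b).
Proof.
move=> [a0 hM] [b0 hN]; split; first exact: mulr_ge0.
move=> v; have -> : kapp (kmul M N) v = kapp M (kapp N v).
  apply/funext => s; rewrite /kapp /kmul.
  under eq_bigr do rewrite big_distrl /=; rewrite exchange_big /=.
  apply: eq_bigr => t _; rewrite big_distrr /=; apply: eq_bigr => x _; by rewrite mulrA.
apply: le_trans (hM _) _.
have -> : (a * b) ^+ 2 * nrm2 v = a ^+ 2 * (b ^+ 2 * nrm2 v) by ring.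
by apply: ler_wpM2l; [exact: sqr_ge0|exact: hN].
Qed.

Lemma kbounded_exists M : exists c, kbounded M c.
Proof.
pose F (p : I * I) := fun s t => if (s == p.1) && (t == p.2) then M s t else 0.
exists (\sum_(p : I * I) Num.sqrt (cabs2 (M p.1 p.2))).
apply: (@eq_kbounded (fun s t => \sum_p F p s t)).
  move=> s t; rewrite (bigD1 (s, t)) //= /F /= !eqxx big1 ?addr0 // => -[x y] /= nxy.
  by case: ifP => // /andP[/eqP sx /eqP ty]; rewrite sx ty eqxx in nxy.
apply: kbounded_sum => -[x y] _; split; first exact: sqrtr_ge0.
move=> v; rewrite sqr_sqrtr ?cabs2_ge0 //= /nrm2 (bigD1 x) //= [X in _ + X]big1 ?addr0.
  rewrite /kapp (bigD1 y) //= [X in _ + X]big1 ?addr0.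
    rewrite /F /= !eqxx cabs2M ler_wpM2l ?cabs2_ge0 // (bigD1 y) //= lerDl.
    by apply: sumr_ge0 => s _; exact: cabs2_ge0.
  by move=> t /negbTE ty; rewrite /F /= ty andbF mul0r.
move=> s /negbTE sx; rewrite /kapp big1 ?/cabs2 /= ?expr0n ?addr0 // => t _.
by rewrite /F /= sx mul0r.
Qed.

Lemma kbounded_opnorm M : kbounded M (opnorm M).
Proof.
have [c [c0 hc]] := kbounded_exists M.
set S := [set r : R | exists v : I -> C, vnorm v <= 1 /\ r = vnorm (kapp M v)].
have ub : has_ubound S.
  exists c => r [v [v1 ->]]; rewrite /vnorm -/(nrm2 _).
  have v2 : nrm2 v <= 1.
    by rewrite -(expr1n _ 2) -(@sqr_sqrtr _ (nrm2 v)) ?nrm2_ge0 // lerXn2r ?nnegrE ?sqrtr_ge0.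
  rewrite -(ger0_norm c0) -sqrtr_sqr ler_sqrt ?sqr_ge0 //.
  by apply: le_trans (hc v) _; rewrite ler_piMr ?sqr_ge0.
have le_op v : nrm2 v <= 1 -> Num.sqrt (nrm2 (kapp M v)) <= opnorm M.
  move=> v1; apply: ub_le_sup => //; exists v; split=> //.
  by rewrite /vnorm -/(nrm2 v) -sqrtr1 ler_wsqrtr.
have op0 : 0 <= opnorm M.
  apply: le_trans (le_op (fun=> 0) _); first exact: sqrtr_ge0.
  by rewrite /nrm2 big1 // => s _; rewrite /cabs2 /= expr0n addr0.
split=> // v.
have [v0|v0] := leP (nrm2 v) 0.
  have -> : kapp M v = fun=> 0.
    by apply/funext => s; rewrite /kapp big1 // => t _; rewrite (nrm2_le0 t v0) mulr0.
  rewrite [leLHS]/nrm2 big1 ?mulr_ge0 ?sqr_ge0 ?nrm2_ge0 // => s _.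
  by rewrite /cabs2 /= expr0n addr0.
set x := Num.sqrt (nrm2 v); have x0 : 0 < x by rewrite sqrtr_gt0.
pose v' := fun s => Complex x^-1 0 * v s.
have nZ (y : R) (w : I -> C) : nrm2 (fun s => Complex y 0 * w s) = y ^+ 2 * nrm2 w.
  rewrite /nrm2 big_distrr /=; apply: eq_bigr => s _; rewrite cabs2M; congr (_ * _).
  by rewrite /cabs2 /= expr0n addr0.
have xx : x ^+ 2 = nrm2 v by rewrite sqr_sqrtr // ltW.
have h1 : nrm2 v' <= 1 by rewrite nZ exprVn xx mulVf // gt_eqF.
have := le_op v' h1.
have -> : kapp M v' = fun s => Complex x^-1 0 * kapp M v s.
  by apply/funext => s; rewrite /kapp big_distrr /=; apply: eq_bigr => t _; rewrite /v' mulrCA.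
have xi : 0 <= x^-1 by rewrite invr_ge0 ltW.
rewrite nZ sqrtrM ?sqr_ge0 // sqrtr_sqr ger0_norm // => h2.
rewrite -xx -exprMn -(@sqr_sqrtr _ (nrm2 (kapp M v))) ?nrm2_ge0 //.
rewrite lerXn2r ?nnegrE ?sqrtr_ge0 ?mulr_ge0 // ?(ltW x0) //.
by rewrite -ler_pdivrMr // mulrC.
Qed.

Definition ktau P M : R := Re (ktrace (kmul M P)) / Re (ktrace P).

Definition kprojection P := kselfadjoint P /\ (forall s t, kmul P P s t = P s t).

Lemma ktau_sum P (J : Type) (r : seq J) (Q : pred J) (F : J -> I -> I -> C) :
  ktau P (fun s t => \sum_(j <- r | Q j) F j s t) = \sum_(j <- r | Q j) ktau P (F j).
Proof.
rewrite /ktau -big_distrl /=; congr (_ / _); rewrite -Re_sum; congr Re.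
rewrite /ktrace /kmul [RHS]exchange_big /=; apply: eq_bigr => s _.
rewrite [RHS]exchange_big /=; apply: eq_bigr => t _; exact: big_distrl.
Qed.

Lemma ktauZ P (x : R) M : ktau P (kscale (Complex x 0) M) = x * ktau P M.
Proof.
rewrite /ktau mulrA; congr (_ / _).
have -> : ktrace (kmul (kscale (Complex x 0) M) P) = Complex x 0 * ktrace (kmul M P).
  rewrite /ktrace /kmul /kscale big_distrr; apply: eq_bigr => s _ /=.
  by rewrite big_distrr /=; apply: eq_bigr => t _; rewrite mulrA.
by rewrite cReM /= mul0r subr0.
Qed.

Lemma ktrace_kmulC M N : ktrace (kmul M N) = ktrace (kmul N M).
Proof.
rewrite /ktrace /kmul exchange_big /=; apply: eq_bigr => s _; apply: eq_bigr => t _.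
exact: mulrC.
Qed.

Lemma ktrace_real M P : kselfadjoint M -> kselfadjoint P -> Im (ktrace (kmul M P)) = 0.
Proof.
move=> hM hP; have : conjc (ktrace (kmul M P)) = ktrace (kmul M P).
  rewrite [RHS]ktrace_kmulC /ktrace conjc_sum; apply: eq_bigr => s _.
  rewrite /kmul conjc_sum; apply: eq_bigr => t _.
  by rewrite rmorphM /= -hM -hP mulrC.
by move=> /(congr1 (@complex.Im R)); rewrite Im_conjc => h; lra.
Qed.

(** As P is a self-adjoint idempotent, tr(M P) is the sum over basis vectors of the inner products
    of P e_s with M P e_s, while tr P is the sum of the squared norms of P e_s. The bound does not
    depend on P, which makes the expansion uniform in the observable. *)
Lemma ktau_le P M c : kprojection P -> 0 < Re (ktrace P) -> kbounded M c -> `|ktau P M| <= c.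
Proof.
move=> [Psa Pid] trP [c0 hM].
pose p s : I -> C := fun t => P t s.
have E : Re (ktrace (kmul M P)) = \sum_s rdot (p s) (kapp M (p s)).
  have -> : ktrace (kmul M P) = \sum_s \sum_t conjc (p s t) * kapp M (p s) t.
    rewrite /ktrace /kmul /kapp.
    transitivity (\sum_s \sum_t M s t * kmul P P t s).
      by apply: eq_bigr => s _; apply: eq_bigr => t _; rewrite Pid.
    rewrite /kmul /p.
    under eq_bigr do under eq_bigr do rewrite big_distrr /=.
    under [RHS]eq_bigr do under eq_bigr do rewrite big_distrr /=.
    transitivity (\sum_s \sum_t \sum_x M t x * (P x s * P s t)); last first.
      apply: eq_bigr => s _; apply: eq_bigr => t _; apply: eq_bigr => x _.
      by rewrite -Psa mulrA mulrC.
    rewrite [RHS]exchange_big /=; apply: eq_bigr => s _.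
    by rewrite [RHS]exchange_big.
  rewrite Re_sum; apply: eq_bigr => s _; rewrite Re_sum; apply: eq_bigr => t _.
  by rewrite cReM Re_conjc Im_conjc mulNr opprK.
have EP : Re (ktrace P) = \sum_s nrm2 (p s).
  have -> : ktrace P = \sum_s \sum_t P s t * P t s.
    by apply: eq_bigr => s _; rewrite -Pid.
  rewrite Re_sum; apply: eq_bigr => s _; rewrite Re_sum; apply: eq_bigr => t _.
  by rewrite cReM /p [P s t]Psa Re_conjc Im_conjc /cabs2; ring.
have rdotN u v : rdot u (fun s => - v s) = - rdot u v.
  by rewrite /rdot -sumrN; apply: eq_bigr => s _; case: (v s) => y1 y2 /=; ring.
have nrm2N v : nrm2 (fun s => - v s) = nrm2 v.
  by apply: eq_bigr => s _; rewrite /cabs2; case: (v s) => y1 y2 /=; ring.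
rewrite /ktau normrM normfV (gtr0_norm trP) ler_pdivrMr //.
rewrite EP E big_distrr /= ler_norml -sumrN; apply/andP; split; apply: ler_sum => s _.
  rewrite lerNl -rdotN -[X in X * _]mul1r.
  by apply: rdot_le; rewrite ?expr1n ?mul1r ?nrm2N.
rewrite -[X in X * _]mul1r; apply: rdot_le; rewrite ?expr1n ?mul1r //.
Qed.

Lemma kselfadjoint_sum (J : Type) (r : seq J) (Q : pred J) (F : J -> I -> I -> C) :
  (forall j, Q j -> kselfadjoint (F j)) ->
  kselfadjoint (fun s t => \sum_(j <- r | Q j) F j s t).
Proof. by move=> h s t; rewrite conjc_sum; apply: eq_bigr => j /h. Qed.

(** Identification with square matrices, whose ring structure gives associativity and the binomial
    formula for kernels. *)
Definition kmx M : 'M[C]_#|I| := \matrix_(i, j) M (enum_val i) (enum_val j).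

Lemma kmxP M N : kmx M = kmx N -> forall s t, M s t = N s t.
Proof.
move=> /matrixP h s t; have := h (enum_rank s) (enum_rank t).
by rewrite !mxE !enum_rankK.
Qed.

Lemma kmx_mul M N : kmx (kmul M N) = kmx M *m kmx N.
Proof.
apply/matrixP => i j; rewrite !mxE /kmul (reindex (@enum_val I predT)) /=.
  by apply: eq_bigr => x _; rewrite !mxE.
exact: (onW_bij _ (@enum_val_bij I)).
Qed.

Lemma kmx_one : kmx (@kone R I) = 1%:M.
Proof. by apply/matrixP => i j; rewrite !mxE /kone (inj_eq enum_val_inj). Qed.

Lemma kmx_add M N : kmx (kadd M N) = kmx M + kmx N.
Proof. by apply/matrixP => i j; rewrite !mxE. Qed.

Lemma kmx_pow M n : kmx (kpow M n) = kmx M ^+ n.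
Proof. by elim: n => [|n IH] /=; rewrite ?kmx_one ?expr0 // kmx_mul IH exprS. Qed.

Lemma kpow_selfadjoint M n : kselfadjoint M -> kselfadjoint (kpow M n).
Proof.
move=> hM; elim: n => [|n IH] s t; first by rewrite /kpow /= /kone rmorph_nat eq_sym.
have E : kpow M n.+1 = kmul (kpow M n) M.
  apply/funext => x; apply/funext => y; apply: kmxP.
  by rewrite kmx_pow kmx_mul kmx_pow exprSr.
rewrite {2}E /kpow /= /kmul conjc_sum; apply: eq_bigr => x _.
by rewrite rmorphM /= -IH -hM mulrC.
Qed.

Lemma kpow_bounded M c n : kbounded M c -> kbounded (kpow M n) (c ^+ n).
Proof.
move=> h; elim: n => [|n IH]; first exact: kbounded1.
by rewrite exprS; exact: kboundedM.
Qed.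

Lemma kpowD M N n : (forall s t, kmul M N s t = kmul N M s t) -> forall s t,
  kpow (kadd M N) n s t = \sum_(i < n.+1) ('C(n, i))%:R * kmul (kpow M (n - i)) (kpow N i) s t.
Proof.
move=> hc; have cc : kmx M * kmx N = kmx N * kmx M.
  by rewrite -[LHS]kmx_mul -[RHS]kmx_mul; congr kmx; apply/funext => s; apply/funext => t.
move=> s t.
apply: (@kmxP _ (fun s t => \sum_(i < n.+1) ('C(n, i))%:R * kmul (kpow M (n - i)) (kpow N i) s t)).
rewrite kmx_pow kmx_add (exprDn_comm n cc).
apply/matrixP => i j; rewrite summxE mxE; apply: eq_bigr => x _.
by rewrite -!kmx_pow -[_ * _]kmx_mul mulmxnE mxE mulr_natl.
Qed.

End Kernel.

(** * Cauchy products of dominated series *)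

Section Cauchy.
Variable R : realType.
Implicit Types a b : nat -> R.

Definition cauchy_prod a b n : R := \sum_(i < n.+1) a i * b (n - i)%N.

(** Partial sums are truncated polynomials evaluated at 1; what the Cauchy product misses are the
    coefficients of their product from degree N on. *)
Lemma cauchy_prod_rem a b N :
  series a N * series b N - series (cauchy_prod a b) N =
  \sum_(N <= n < N + N) ((\poly_(i < N) a i) * (\poly_(i < N) b i))`_n.
Proof.
have sE (u : nat -> R) : series u N = (\poly_(i < N) u i).[1].
  rewrite horner_poly /series /= big_mkord; apply: eq_bigr => i _.
  by rewrite expr1n mulr1.
rewrite !(sE a, sE b) -hornerM.
set p := \poly_(i < N) a i; set q := \poly_(i < N) b i.
have szpq : (size (p * q)%R <= N + N)%N.
  apply: leq_trans (size_polyMleq _ _) _; apply: leq_trans (leq_pred _) _.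
  by rewrite leq_add // size_poly.
rewrite (horner_coef_wide _ szpq).
under eq_bigr do rewrite expr1n mulr1.
rewrite -(big_mkord xpredT (fun i => (p * q)`_i)) (@big_cat_nat _ _ _ N) //=; last exact: leq_addr.
rewrite addrAC /series /= [X in X - _](_ : _ = \sum_(0 <= k < N) cauchy_prod a b k); last first.
  rewrite !big_mkord; apply: eq_bigr => i _; rewrite coefM; apply: eq_bigr => j _.
  rewrite !coef_poly; have jN : (j < N)%N by rewrite (leq_trans (ltn_ord j)).
  by rewrite jN (leq_ltn_trans (leq_subr _ _)).
by rewrite subrr add0r.
Qed.

Lemma cauchy_prod_exp (x y : R) n : cauchy_prod (exp_coeff x) (exp_coeff y) n = exp_coeff (x + y) n.
Proof.
rewrite /exp_coeff /= addrC exprDn big_distrl /=; apply: eq_bigr => i _.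
have le_in : (i <= n)%N by rewrite -ltnS.
rewrite -mulr_natr -(bin_fact le_in).
have f1 : (i`! : nat)%:R != 0 :> R by rewrite pnatr_eq0 -lt0n fact_gt0.
have f2 : ((n - i)`! : nat)%:R != 0 :> R by rewrite pnatr_eq0 -lt0n fact_gt0.
have f3 : ('C(n, i) : nat)%:R != 0 :> R by rewrite pnatr_eq0 -lt0n bin_gt0.
by rewrite !natrM; field; rewrite f1 f2 f3.
Qed.

(** The remainder is dominated coefficient by coefficient by the one for the exponential series of x
    and y, and that one vanishes in the limit because e^x e^y = e^{x + y}. *)
Lemma cvg_cauchy_prod a b (x y la lb : R) :
  (forall n, `|a n| <= exp_coeff x n) -> (forall n, `|b n| <= exp_coeff y n) ->
  series a @ \oo --> la -> series b @ \oo --> lb ->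
  series (cauchy_prod a b) @ \oo --> la * lb.
Proof.
move=> ha hb cva cvb.
have cvab : (fun N => series a N * series b N) @ \oo --> la * lb by exact: cvgM.
have cvxy : (fun N => series (exp_coeff x) N * series (exp_coeff y) N -
    series (exp_coeff (x + y)) N) @ \oo --> (0 : R).
  have -> : 0 = expR x * expR y - expR (x + y) by rewrite expRD subrr.
  apply: cvgB; last exact: is_cvg_series_exp_coeff.
  by apply: cvgM; exact: is_cvg_series_exp_coeff.
have cv0 : (fun N => series a N * series b N - series (cauchy_prod a b) N) @ \oo --> (0 : R).
  apply/cvgr0Pnorm_le => e e0; near=> N.
  have -> : series a N * series b N - series (cauchy_prod a b) N =
    \sum_(N <= n < N + N) ((\poly_(i < N) a i) * (\poly_(i < N) b i))`_n.
    exact: cauchy_prod_rem.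
  apply: (@le_trans _ _ (series (exp_coeff x) N * series (exp_coeff y) N -
    series (exp_coeff (x + y)) N)).
    have -> : series (exp_coeff (x + y)) N = series (cauchy_prod (exp_coeff x) (exp_coeff y)) N.
      by rewrite /series /=; apply: eq_bigr => i _; rewrite cauchy_prod_exp.
    rewrite cauchy_prod_rem; apply: le_trans (ler_norm_sum _ _ _) _.
    apply: ler_sum => n _; rewrite !coefM; apply: le_trans (ler_norm_sum _ _ _) _.
    apply: ler_sum => i _; rewrite normrM; apply: ler_pM => //; rewrite !coef_poly.
      by case: ifP => _; rewrite ?normr0 ?ha.
    by case: ifP => _; rewrite ?normr0 ?hb.
  apply: le_trans (ler_norm _) _; near: N.
  by move/cvgr0Pnorm_le : cvxy; apply.
have -> : series (cauchy_prod a b) = (fun N => series a N * series b N -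
    (series a N * series b N - series (cauchy_prod a b) N)).
  by apply/funext => N; rewrite subKr.
by rewrite -(subr0 (la * lb)); exact: cvgB.
Unshelve. all: by end_near. Qed.

End Cauchy.

Lemma cvg_rsum (R : realType) (J : Type) (r : seq J) (Q : pred J) (F : J -> nat -> R) (L : J -> R) :
  (forall j, Q j -> F j @ \oo --> L j) ->
  (fun n => \sum_(j <- r | Q j) F j n) @ \oo --> \sum_(j <- r | Q j) L j.
Proof.
move=> h; elim: r => [|j r IH].
  by under eq_fun do rewrite big_nil; rewrite big_nil; exact: cvg_cst.
under eq_fun do rewrite big_cons; rewrite big_cons; case: ifP => Qj //.
by apply: cvgD => //; exact: h.
Qed.

(** * Weights of families of operators *)

Section ExpandState.
Import mathcomp.boot.fintype mathcomp.boot.finset.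
Variables (R : realType) (I : finType) (P : I -> I -> R[i]) (b : R).
Hypothesis Pproj : kprojection P.
Hypothesis trP : 0 < complex.Re (ktrace P).
Local Notation C := (R[i]).
Implicit Types (M N : I -> I -> C).

Definition kZterm M n : R := b ^+ n / n`!%:R * ktau P (kpow M n).
(** The number tau_P(e^{b M}), given by its real power series so that every estimate can be made
    term by term. *)
Definition kZ M : R := limn (series (kZterm M)).

Lemma kZterm_le M c n : kbounded M c -> `|kZterm M n| <= exp_coeff (`|b| * c) n.
Proof.
move=> hM; rewrite /kZterm /exp_coeff /= exprMn normrM mulrAC.
apply: ler_pM => //; last by apply: ktau_le => //; exact: kpow_bounded.
by rewrite normrM normrX normfV normr_nat.
Qed.

Lemma cvg_kZ M : series (kZterm M) @ \oo --> kZ M.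
Proof.
have [c hc] := kbounded_exists M.
apply: normed_cvg; apply: (@series_le_cvg _ _ (exp_coeff (`|b| * c))).
- by move=> n; exact: normr_ge0.
- by move=> n; apply: exp_coeff_ge0; rewrite mulr_ge0 // hc.1.
- by move=> n; exact: kZterm_le.
- exact: is_cvg_series_exp_coeff.
Qed.

Lemma kZ_mul M N :
  (forall s t, kmul M N s t = kmul N M s t) ->
  (forall j k, ktau P (kmul (kpow M j) (kpow N k)) = ktau P (kpow M j) * ktau P (kpow N k)) ->
  kZ (Defs.kadd M N) = kZ M * kZ N.
Proof.
move=> MN tauMN; have [c hM] := kbounded_exists M; have [c' hN] := kbounded_exists N.
have := @cvg_cauchy_prod R (kZterm N) (kZterm M) _ _ (kZ N) (kZ M)
  (fun n => kZterm_le n hN) (fun n => kZterm_le n hM) (@cvg_kZ N) (@cvg_kZ M).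
have -> : cauchy_prod (kZterm N) (kZterm M) = kZterm (Defs.kadd M N).
  apply/funext => n; rewrite /cauchy_prod /kZterm.
  have -> : kpow (Defs.kadd M N) n = fun s t => \sum_(i < n.+1)
      kscale (Complex ('C(n, i))%:R 0) (kmul (kpow M (n - i)) (kpow N i)) s t.
    apply/funext => s; apply/funext => t; rewrite kpowD //; apply: eq_bigr => i _.
    by rewrite /kscale; congr (_ * _); apply: complexP; rewrite ?raddfMn /= ?mul0rn.
  rewrite ktau_sum big_distrr /=; apply: eq_bigr => i _.
  have le_in : (i <= n)%N by rewrite -ltnS.
  have bn : b ^+ n = b ^+ i * b ^+ (n - i) by rewrite -exprD subnKC.
  have fn : n`!%:R = ('C(n, i))%:R * ((i`!)%:R * ((n - i)`!)%:R) :> R.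
    by rewrite -(bin_fact le_in) !natrM.
  rewrite ktauZ tauMN bn fn.
  have f1 : (i`! : nat)%:R != 0 :> R by rewrite pnatr_eq0 -lt0n fact_gt0.
  have f2 : ((n - i)`! : nat)%:R != 0 :> R by rewrite pnatr_eq0 -lt0n fact_gt0.
  have f3 : ('C(n, i) : nat)%:R != 0 :> R by rewrite pnatr_eq0 -lt0n bin_gt0.
  by field; rewrite f1 f2 f3.
by move=> /cvg_lim; rewrite mulrC; apply.
Qed.

Variables (T : finType) (X : T -> I -> I -> C) (c : T -> R).
Hypothesis Xc : forall A, kbounded (X A) (c A).

Definition famH (f : {set T}) : I -> I -> C := fun s t => \sum_(A in f) X A s t.
Definition famZ (f : {set T}) : R := kZ (famH f).

Let D n (f : {set T}) : I -> I -> C := fun s t => moeb (fun g => kpow (famH g) n s t) f.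
Let dd n (f : {set T}) : R := moeb (fun g => (\sum_(A in g) c A) ^+ n) f.

Lemma moeb_cst (K : comPzRingType) (x : K) (f : {set T}) : moeb (fun=> x) f = x * (f == set0)%:R.
Proof.
rewrite -moeb_superset -moebZ; apply: eq_moeb => g _.
by rewrite sub0set mulr1.
Qed.

Let Dbounded n f : kbounded (D n f) (dd n f).
Proof.
elim: n f => [|n IH] f.
  rewrite /dd (_ : moeb _ f = (f == set0)%:R); last first.
    by rewrite -[RHS]mul1r -moeb_cst; apply: eq_moeb => g _; rewrite expr0.
  have E s t : D 0 f s t = @kone R I s t * (f == set0)%:R.
    by rewrite /D -moeb_cst; apply: eq_moeb.
  case: eqP E => [_|_] E.
    by apply: eq_kbounded (@kbounded1 R I) => s t; rewrite E mulr1.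
  by apply: eq_kbounded (@kbounded0 R I) => s t; rewrite E mulr0.
have -> : dd n.+1 f = \sum_(A in f) c A * (dd n f + dd n (f :\ A)).
  by rewrite /dd -moeb_sum_mul; apply: eq_moeb => g _; rewrite exprS.
have E s t : D n.+1 f s t = \sum_(A in f) kmul (X A) (Defs.kadd (D n f) (D n (f :\ A))) s t.
  rewrite /kmul exchange_big /=.
  transitivity (moeb (fun g => \sum_u famH g s u * kpow (famH g) n u t) f) => //.
  rewrite /moeb; under [LHS]eq_bigr do rewrite big_distrr /=.
  rewrite exchange_big /=; apply: eq_bigr => u _.
  exact: (moeb_sum_mul (fun A => X A s u) (fun g => kpow (famH g) n u t) f).
apply: (eq_kbounded (M := fun s t => \sum_(A in f) kmul (X A) (Defs.kadd (D n f) (D n (f :\ A))) s t)) => //.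
apply: kbounded_sum => A _; apply: kboundedM => //; exact: kboundedD.
Qed.

Lemma cvg_moeb (F : nat -> {set T} -> R) (L : {set T} -> R) f :
  (forall g, F^~ g @ \oo --> L g) -> (fun n => moeb (F n) f) @ \oo --> moeb L f.
Proof.
move=> h; rewrite /moeb; apply: cvg_rsum => g _.
by apply: cvgMr; exact: h.
Qed.

(** Summing the domination over all powers, the scalar side becomes the Moebius coefficient of an
    exponential of a sum, which is a product. *)
Lemma famY_le f : `|moeb famZ f| <= \prod_(A in f) (expR (`|b| * c A) - 1).
Proof.
have tauD n : moeb (fun g => ktau P (kpow (famH g) n)) f = ktau P (D n f).
  have -> : D n f = fun s t => \sum_(B : {set T} | B \subset f)
      kscale (Complex ((-1) ^+ (#|f| + #|B|)) 0) (kpow (famH B) n) s t.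
    apply/funext => s; apply/funext => t; apply: eq_bigr => B _; rewrite /kscale; congr (_ * _).
    by rewrite -[RHS]/(real_complex R ((-1) ^+ (#|f| + #|B|))) rmorphXn /= rmorphN1.
  by rewrite ktau_sum; apply: eq_bigr => B _; rewrite ktauZ.
have cv1 : (fun N : nat => \sum_(0 <= n < N) b ^+ n / n`!%:R * ktau P (D n f)) @ \oo --> moeb famZ f.
  have -> : (fun N : nat => \sum_(0 <= n < N) b ^+ n / n`!%:R * ktau P (D n f)) =
     (fun N : nat => moeb (fun g => series (kZterm (famH g)) N) f).
    apply/funext => N; rewrite /series /= /moeb.
    under [RHS]eq_bigr do rewrite big_distrr /=.
    rewrite exchange_big /=; apply: eq_bigr => n _; rewrite -tauD /moeb big_distrr /=.
    by apply: eq_bigr => g _; rewrite /kZterm mulrCA.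
  by apply: cvg_moeb => g; exact: cvg_kZ.
have -> : \prod_(A in f) (expR (`|b| * c A) - 1) =
    moeb (fun g : {set T} => expR (`|b| * \sum_(A in g) c A)) f.
  rewrite -moeb_prod; apply: eq_moeb => g _.
  by rewrite big_distrr /= expR_sum.
have cv2 : (fun N : nat => \sum_(0 <= n < N) `|b| ^+ n / n`!%:R * dd n f) @ \oo -->
    moeb (fun g : {set T} => expR (`|b| * \sum_(A in g) c A)) f.
  have -> : (fun N : nat => \sum_(0 <= n < N) `|b| ^+ n / n`!%:R * dd n f) =
     (fun N : nat => moeb (fun g : {set T} => series (exp_coeff (`|b| * \sum_(A in g) c A)) N) f).
    apply/funext => N; rewrite /series /= /moeb.
    under [RHS]eq_bigr do rewrite big_distrr /=.
    rewrite exchange_big /=; apply: eq_bigr => n _; rewrite /dd /moeb big_distrr /=.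
    by apply: eq_bigr => g _; rewrite /exp_coeff /= exprMn; ring.
  by apply: cvg_moeb => g; exact: is_cvg_series_exp_coeff.
apply: (ler_cvg_to (cvg_norm cv1) cv2); near=> N.
apply: le_trans (ler_norm_sum _ _ _) _; apply: ler_sum => n _.
rewrite normrM normrM normrX normfV normr_nat.
rewrite ler_wpM2l ?mulr_ge0 ?exprn_ge0 ?invr_ge0 //.
by apply: ktau_le.
Unshelve. all: by end_near. Qed.

End ExpandState.

(** * Tensor embeddings and product projections *)

Section Embedding.
Import mathcomp.boot.fintype mathcomp.boot.finset.
Variables (R : realType) (S T T' : finType) (f : T -> T').
Hypothesis finj : injective f.
Local Notation C := (R[i]).
Local Notation cf := {ffun T -> S}.
Local Notation cf' := {ffun T' -> S}.

Definition pull (s : cf') : cf := [ffun x => s (f x)].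
Definition offcodom (s t : cf') := [forall y, (y \notin codom f) ==> (s y == t y)].
Definition upd (s' : cf') (s : cf) : cf' :=
  [ffun y => if [pick x | f x == y] is Some x then s x else s' y].
(** An arbitrary injection in place of an inclusion: the same construction serves the standard
    embeddings and the lattice translations. *)
Definition kembed (M : cf -> cf -> C) : cf' -> cf' -> C :=
  fun s t => if offcodom s t then M (pull s) (pull t) else 0.

Lemma offcodomP (s t : cf') : reflect (forall y, y \notin codom f -> s y = t y) (offcodom s t).
Proof.
apply: (iffP forallP) => h y; first by move=> hy; apply/eqP; move/implyP: (h y); exact.
by apply/implyP => /h ->.
Qed.

Lemma upd_in s' s x : upd s' s (f x) = s x.
Proof.
rewrite ffunE; case: pickP => [x' /eqP/finj -> //|/(_ x)]; by rewrite eqxx.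
Qed.

Lemma upd_out s' s y : y \notin codom f -> upd s' s y = s' y.
Proof.
move=> yf; rewrite ffunE; case: pickP => // x /eqP xy.
by rewrite -xy codom_f in yf.
Qed.

Lemma pull_upd s' s : pull (upd s' s) = s.
Proof. by apply/ffunP => x; rewrite ffunE upd_in. Qed.

Lemma offcodom_upd s' s : offcodom s' (upd s' s).
Proof. by apply/offcodomP => y yf; rewrite upd_out. Qed.

Lemma upd_pull s' t' : offcodom s' t' -> upd s' (pull t') = t'.
Proof.
move=> /offcodomP h; apply/ffunP => y.
have [/codomP[x ->]|yf] := boolP (y \in codom f); first by rewrite upd_in ffunE.
by rewrite upd_out // h.
Qed.

Lemma upd_upd s' s t : upd (upd s' s) t = upd s' t.
Proof.
apply/ffunP => y; have [/codomP[x ->]|yf] := boolP (y \in codom f); first by rewrite !upd_in.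
by rewrite !upd_out.
Qed.

Lemma offcodom_sym s t : offcodom s t = offcodom t s.
Proof. by apply/offcodomP/offcodomP => h y /h. Qed.

Lemma offcodom_trans s t u : offcodom s t -> offcodom s u = offcodom t u.
Proof.
by move=> /offcodomP h; apply/offcodomP/offcodomP => h' y yf; rewrite ?(h y yf) ?h' // -(h y yf) h'.
Qed.

Lemma sum_offcodom (s' : cf') (G : cf' -> C) :
  \sum_(t' | offcodom s' t') G t' = \sum_(t : cf) G (upd s' t).
Proof.
rewrite (reindex_onto (upd s') pull) /=; last by move=> t' h; exact: upd_pull.
by apply: eq_bigl => t; rewrite offcodom_upd pull_upd eqxx.
Qed.

Lemma kembed_upd M s' s t : kembed M (upd s' s) (upd s' t) = M s t.
Proof.
rewrite /kembed !pull_upd (_ : offcodom _ _) //.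
by apply/offcodomP => y yf; rewrite !upd_out.
Qed.

Lemma kembed_mul M N s t : kmul (kembed M) (kembed N) s t = kembed (kmul M N) s t.
Proof.
rewrite /kmul (bigID (offcodom s)) /= [X in _ + X]big1 ?addr0; last first.
  by move=> u /negbTE h; rewrite /kembed h mul0r.
rewrite sum_offcodom {3}/kembed.
case: ifP => [st|nst]; last first.
  by apply: big1 => u _; rewrite {2}/kembed -(offcodom_trans t (offcodom_upd s u)) nst mulr0.
apply: eq_bigr => u _; rewrite /kembed offcodom_upd pull_upd.
by rewrite -(offcodom_trans t (offcodom_upd s u)) st.
Qed.

Lemma kembed_one s t : kembed (@kone R _) s t = @kone R _ s t.
Proof.
rewrite /kembed /kone; have [->|st] := eqVneq s t.
  by rewrite eqxx (_ : offcodom t t) //; apply/offcodomP.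
case: ifP => // h; case: eqP => // e; case/eqP: st.
by rewrite -(upd_pull h) -e; apply/esym; apply: upd_pull; apply/offcodomP.
Qed.

Lemma kembed_pow M n : kpow (kembed M) n = kembed (kpow M n).
Proof.
elim: n => [|n IH]; first by apply/funext => s; apply/funext => t; rewrite kembed_one.
by rewrite /kpow /= -/(kpow _ n) IH; apply/funext => s; apply/funext => t; rewrite kembed_mul.
Qed.

Lemma kembed_sum (J : Type) (r : seq J) (Q : pred J) (F : J -> cf -> cf -> C) s t :
  kembed (fun s t => \sum_(j <- r | Q j) F j s t) s t = \sum_(j <- r | Q j) kembed (F j) s t.
Proof. by rewrite /kembed; case: ifP => // _; rewrite big1. Qed.

Lemma kembed_selfadjoint M : kselfadjoint M -> kselfadjoint (kembed M).
Proof. by move=> h s t; rewrite /kembed offcodom_sym; case: ifP => // _; rewrite rmorph0. Qed.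

(* Averaging over all ways of refreshing the spins in the image of [f]. *)
Lemma sum_upd (F : cf' -> R) :
  \sum_(s' : cf') \sum_(s : cf) F (upd s' s) = #|{: cf}|%:R * \sum_(s' : cf') F s'.
Proof.
rewrite mulr_natl -sumr_const exchange_big /= pair_big /= pair_big /=.
rewrite (reindex (fun p : cf * cf' => (pull p.2, upd p.2 p.1))) /=; last first.
  apply: onW_bij; exists (fun p : cf * cf' => (pull p.2, upd p.2 p.1)) => -[s s'] /=.
    by rewrite pull_upd upd_upd upd_pull //; apply/offcodomP.
  by rewrite pull_upd upd_upd upd_pull //; apply/offcodomP.
apply: eq_bigr => -[s s'] _ /=.
by rewrite upd_upd upd_pull //; apply/offcodomP.
Qed.

(** The embedded operator acts separately on each fibre of fixed outside spins. The fibrewise bounds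
    are added over all configurations, and [sum_upd] shows that each side is then counted equally
    often. *)
Lemma kembed_bounded M c : kbounded M c -> kbounded (kembed M) c.
Proof.
move=> [c0 hM]; split=> // v.
have [e|n0] := posnP #|{: cf}|.
  rewrite /nrm2 !big1 ?mulr0 // => s' _.
    by have := fintype0 (pull s') ; rewrite e; exact.
  by have := fintype0 (pull s') ; rewrite e; exact.
have n0' : 0 < #|{: cf}|%:R :> R by rewrite ltr0n.
rewrite -(ler_pM2l n0') mulrCA -!sum_upd big_distrr /=; apply: ler_sum => s' _.
apply: le_trans (hM (fun s => v (upd s' s))); rewrite le_eqVlt; apply/orP; left; apply/eqP.
apply: eq_bigr => s _; congr cabs2; rewrite /kapp.
rewrite (bigID (offcodom (upd s' s))) /= [X in _ + X]big1 ?addr0; last first.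
  by move=> t /negbTE h; rewrite /kembed h mul0r.
by rewrite sum_offcodom; apply: eq_bigr => t _; rewrite !upd_upd kembed_upd.
Qed.

Definition kprod (U : finType) (p : U -> S -> S -> C) : {ffun U -> S} -> {ffun U -> S} -> C :=
  fun s t => \prod_y p y (s y) (t y).

Lemma ktrace_kembed (p : T' -> S -> S -> C) M :
  ktrace (kmul (kembed M) (kprod p)) =
  ktrace (kmul M (kprod (p \o f))) * \prod_(y | y \notin codom f) ktrace (p y).
Proof.
have prodE (F : T' -> C) : \prod_y F y = \prod_x F (f x) * \prod_(y | y \notin codom f) F y.
  rewrite (bigID (fun y => y \in codom f)) /=; congr (_ * _).
  rewrite (eq_bigl (fun y => y \in f @: setT)).
    rewrite big_imset /=; last by move=> x y _ _ /finj.
    by apply: eq_bigl => x; rewrite in_setT.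
  by move=> y; apply/codomP/imsetP => [[x ->]|[x _ ->]]; exists x; rewrite ?in_setT.
transitivity (\sum_(s' : cf') kmul M (kprod (p \o f)) (pull s') (pull s') *
   \prod_(y | y \notin codom f) p y (s' y) (s' y)).
  apply: eq_bigr => s' _; rewrite {1}/kmul (bigID (offcodom s')) /=.
  rewrite [X in _ + X]big1 ?addr0; last by move=> t /negbTE h; rewrite /kembed h mul0r.
  rewrite sum_offcodom /kmul big_distrl /=; apply: eq_bigr => t _.
  rewrite {1}/kembed offcodom_upd pull_upd -mulrA; congr (_ * _).
  rewrite /kprod prodE; congr (_ * _).
    by apply: eq_bigr => x _; rewrite upd_in ffunE.
  by apply: eq_bigr => y yf; rewrite upd_out.
rewrite (partition_big pull predT) //= /ktrace big_distrl /=; apply: eq_bigr => s _.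
transitivity (kmul M (kprod (p \o f)) s s *
   \sum_(s' | pull s' == s) \prod_(y | y \notin codom f) p y (s' y) (s' y)).
  by rewrite big_distrr /=; apply: eq_bigr => s' /eqP ->.
congr (_ * _).
(* Extensions of [s] as a product of per-site constraints: one value at image points, no restriction
   elsewhere. The sum of products then distributes. *)
pose Qs y := [pred j | [forall x, (f x == y) ==> (j == s x)]].
pose F y j := if y \in codom f then 1 else p y j j.
transitivity (\sum_(s' in family Qs) \prod_y F y (s' y)).
  apply: eq_big => [s'|s' _].
    apply/eqP/familyP => [e y|h].
      by rewrite inE; apply/forallP => x; apply/implyP => /eqP <-; rewrite -e ffunE.
    apply/ffunP => x; rewrite ffunE; have := h (f x); rewrite inE => /forallP/(_ x).
    by rewrite eqxx => /eqP.
  rewrite big_mkcond /=; apply: eq_bigr => y _; rewrite /F.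
  by case: (y \in codom f).
rewrite -(bigA_distr_big_dep Qs F) prodE [X in X * _]big1 ?mul1r; last first.
  move=> x _; rewrite (big_pred1 (s x)) /F ?codom_f // => j /=.
  apply/forallP/eqP => [/(_ x)|-> x']; first by rewrite eqxx => /eqP.
  by apply/implyP => /eqP/finj ->.
apply: eq_bigr => y yf; rewrite /F (negbTE yf); apply: eq_bigl => j /=.
apply/forallP => x; apply/implyP => /eqP xy.
by rewrite -xy codom_f in yf.
Qed.

Lemma ktrace_real1 (U : finType) (M : U -> U -> C) : kselfadjoint M -> complex.Im (ktrace M) = 0.
Proof.
move=> h; rewrite /ktrace Im_sum big1 // => s _.
by have := congr1 (@complex.Im R) (h s s); rewrite Im_conjc => e; lra.
Qed.

(** The sites outside the image contribute the same positive factor to numerator and denominator.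
    Hence partition functions of subregions can be computed in any larger volume. *)
Lemma ktau_kembed (p : T' -> S -> S -> C) M :
  (forall y, kselfadjoint (p y)) -> (forall y, 0 < complex.Re (ktrace (p y))) ->
  ktau (kprod p) (kembed M) = ktau (kprod (p \o f)) M.
Proof.
move=> psa ppos; rewrite /ktau ktrace_kembed.
have -> : ktrace (kprod p) = ktrace (kmul (kembed (@kone R _)) (kprod p)).
  apply: eq_bigr => s _; rewrite /kmul (bigD1 s) //= kembed_one /kone eqxx mul1r.
  rewrite big1 ?addr0 // => t; rewrite kembed_one /kone eq_sym => /negbTE ->.
  by rewrite mul0r.
rewrite ktrace_kembed; set K := \prod_(y | _) _.
have [K1 K2] : 0 < complex.Re K /\ complex.Im K = 0.
  rewrite /K; elim/big_ind: _ => //=.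
  - by move=> x y [x1 x2] [y1 y2]; rewrite cReM cImM x2 y2 !(mulr0,mul0r) subr0 addr0 mulr_gt0.
  - by move=> y _; split; [exact: ppos|exact: ktrace_real1].
have -> : ktrace (kmul (@kone R _) (kprod (p \o f))) = ktrace (kprod (p \o f)).
  apply: eq_bigr => s _; rewrite /kmul (bigD1 s) //= /kone eqxx mul1r.
  by rewrite big1 ?addr0 // => t; rewrite eq_sym => /negbTE ->; rewrite mul0r.
rewrite !cReM K2 !mulr0 !subr0 invfM mulrACA mulfV ?mulr1 //.
by rewrite gt_eqF.
Qed.

End Embedding.

(** * Operators supported on a set of sites *)

Section Support.
Import mathcomp.boot.fintype mathcomp.boot.finset.
Variables (R : realType) (S T : finType).
Local Notation C := (R[i]).
Local Notation cf := {ffun T -> S}.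
Implicit Types (M N : cf -> cf -> C) (B : {set T}) (s t u : cf).

Definition mrg B s t : cf := [ffun y => if y \in B then s y else t y].

(** Matrix form of an operator on [B] tensored with the identity: diagonal off [B], with entries
    that ignore the common spins there. *)
Definition supported B M :=
  (forall s t, M s t != 0 -> forall y, y \notin B -> s y = t y) /\
  (forall s t s' t', (forall y, y \in B -> s y = s' y /\ t y = t' y) ->
     (forall y, y \notin B -> s y = t y /\ s' y = t' y) -> M s t = M s' t').

Lemma supportedW (A B : {set T}) M : A \subset B -> supported A M -> supported B M.
Proof.
move=> /subsetP AB [h1 h2]; split.
  by move=> s t /h1 h y yB; apply: h; apply: contra yB; exact: AB.
move=> s t s' t' e1 e2.
have [/forallP h|/forallPn[y]] := boolP [forall y, (y \notin A) ==> (s y == t y)].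
  have {}h y : y \notin A -> s y = t y by move=> yA; apply/eqP; move/implyP: (h y); exact.
  apply: h2 => y yA; first by apply: e1; exact: AB.
  split; first exact: h.
  have [yB|yB] := boolP (y \in B); last by have [] := e2 y yB.
  by have [<- <-] := e1 y yB; exact: h.
rewrite negb_imply => /andP[yA /eqP ne].
have yB : y \in B by apply/negPn/negP => yB; apply: ne; have [] := e2 y yB.
have -> : M s t = 0 by apply/eqP/negPn/negP => /h1 /(_ y yA).
apply/esym/eqP/negPn/negP => /h1 /(_ y yA).
by have [<- <-] := e1 y yB.
Qed.

Lemma supported_sum B (J : Type) (r : seq J) (Q : pred J) (F : J -> cf -> cf -> C) :
  (forall j, Q j -> supported B (F j)) -> supported B (fun s t => \sum_(j <- r | Q j) F j s t).
Proof.
move=> h; split.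
  move=> s t ne y yB; apply/eqP/negPn/negP => nst; case/negP: ne; apply/eqP.
  apply: big1 => j Qj; apply/eqP/negPn/negP => hj.
  by case/negP: nst; apply/eqP; exact: (h j Qj).1 hj y yB.
by move=> s t s' t' e1 e2; apply: eq_bigr => j Qj; exact: (h j Qj).2.
Qed.

Lemma supported_one B : supported B (@kone R cf).
Proof.
split.
  by move=> s t; rewrite /kone; case: (eqVneq s t) => [->//|_]; rewrite eqxx.
move=> s t s' t' e1 e2; rewrite /kone; congr (_%:R); congr nat_of_bool.
apply/eqP/eqP => e; apply/ffunP => y; have [yB|yB] := boolP (y \in B).
- by have [<- <-] := e1 y yB; rewrite e.
- by have [] := e2 y yB.
- by have [-> ->] := e1 y yB; rewrite e.
- by have [] := e2 y yB.
Qed.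

Lemma supported_mul B M N : supported B M -> supported B N -> supported B (kmul M N).
Proof.
move=> [M1 M2] [N1 N2]; split.
  move=> s t ne y yB; apply/eqP/negPn/negP => nst; case/negP: ne; apply/eqP.
  apply: big1 => u _; have [->|Mn] := eqVneq (M s u) 0; first by rewrite mul0r.
  have [->|Nn] := eqVneq (N u t) 0; first by rewrite mulr0.
  by case/negP: nst; rewrite (M1 s u Mn y yB) (N1 u t Nn y yB).
move=> s t s' t' e1 e2.
have zero (x x' z : cf) (K L : cf -> cf -> C) : (forall s t, K s t != 0 -> forall y, y \notin B -> s y = t y) ->
  \sum_u K x u * L u z = \sum_(u | mrg B u x == u) K x u * L u z.
  move=> hK; rewrite (bigID (fun u => mrg B u x == u)) /= [X in _ + X]big1 ?addr0 // => u.
  move=> ne; have [->|Kn] := eqVneq (K x u) 0; first by rewrite mul0r.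
  case/eqP: ne; apply/ffunP => y; rewrite ffunE; case: ifP => // /negbT yB.
  exact: hK Kn y yB.
rewrite /kmul zero // [RHS]zero //.
rewrite (reindex_onto (fun u => mrg B u s) (fun u => mrg B u s')) /=; last first.
  move=> u /eqP <-; apply/ffunP => y; rewrite !ffunE; by case: (y \in B).
apply: eq_big => [u|u].
  apply/andP/eqP => [[_ /eqP <-]|<-]; first by apply/ffunP => y; rewrite !ffunE; case: (y \in B).
  by split; apply/eqP; apply/ffunP => y; rewrite !ffunE; case: (y \in B).
move=> /andP[_ /eqP <-]; congr (_ * _).
  apply: M2 => y yB; rewrite !ffunE ?yB ?(negbTE yB) //.
  by have [-> _] := e1 y yB.
apply: N2 => y yB; rewrite !ffunE ?yB ?(negbTE yB).
  by have [_ ->] := e1 y yB.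
by have [-> ->] := e2 y yB.
Qed.

Lemma supported_pow B M n : supported B M -> supported B (kpow M n).
Proof.
move=> h; elim: n => [|n IH]; first exact: supported_one.
exact: supported_mul.
Qed.

Lemma kmul_disjoint B M N s u : supported B M -> supported (~: B) N ->
  kmul M N s u = M s (mrg B u s) * N (mrg B u s) u.
Proof.
move=> [M1 _] [N1 _]; rewrite /kmul (bigD1 (mrg B u s)) //= big1 ?addr0 // => t.
move=> ne; have [->|Mn] := eqVneq (M s t) 0; first by rewrite mul0r.
have [->|Nn] := eqVneq (N t u) 0; first by rewrite mulr0.
case/eqP: ne; apply/ffunP => y; rewrite ffunE; case: ifP => yB.
  by apply: (N1 _ _ Nn); rewrite inE yB.
by apply/esym; apply: (M1 _ _ Mn); rewrite yB.
Qed.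

Lemma mrgC B s t : mrg (~: B) s t = mrg B t s.
Proof. by apply/ffunP => y; rewrite !ffunE inE; case: (y \in B). Qed.

Lemma kmulC_disjoint B M N s u : supported B M -> supported (~: B) N ->
  kmul M N s u = kmul N M s u.
Proof.
move=> hM hN; rewrite (kmul_disjoint _ _ hM hN).
have hM' : supported (~: ~: B) M by rewrite setCK.
rewrite (kmul_disjoint _ _ hN hM') !mrgC mulrC; congr (_ * _).
  apply: hN.2 => y; rewrite inE ?negbK => yB; rewrite !ffunE ?yB ?(negbTE yB) //.
apply: hM.2 => y yB; rewrite !ffunE ?yB ?(negbTE yB) //.
Qed.

Lemma sum_swap B (F : cf -> cf -> C) :
  \sum_s \sum_t F s t = \sum_s \sum_t F (mrg B s t) (mrg B t s).
Proof.
rewrite !pair_big /= (reindex (fun p : cf * cf => (mrg B p.1 p.2, mrg B p.2 p.1))) //=.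
apply: onW_bij; exists (fun p : cf * cf => (mrg B p.1 p.2, mrg B p.2 p.1)) => -[s t] /=;
by congr (_, _); apply/ffunP => y; rewrite !ffunE; case: (y \in B).
Qed.

(** Both sides are sums over two independent copies of the system. Exchanging the spins of [B]
    between the copies is a bijection that preserves the product kernel and matches the two sides
    term by term; where the Kronecker factor vanishes, so does an entry of [M] or [N]. *)
Lemma ktrace_disjoint B M N (p : T -> S -> S -> C) : supported B M -> supported (~: B) N ->
  ktrace (kmul (kmul M N) (kprod p)) * ktrace (kprod p) =
  ktrace (kmul M (kprod p)) * ktrace (kmul N (kprod p)).
Proof.
move=> hM hN.
have -> : ktrace (kprod p) = \sum_s \sum_u @kone R cf s u * kprod p u s.
  apply: eq_bigr => s _; rewrite (bigD1 s) //= /kone eqxx mul1r.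
  by rewrite big1 ?addr0 // => t; rewrite eq_sym => /negbTE ->; rewrite mul0r.
have sq (F G : cf -> cf -> C) : (\sum_s \sum_u F s u) * (\sum_s \sum_u G s u) =
   \sum_s \sum_s' \sum_u \sum_u' F s u * G s' u'.
  rewrite big_distrl /=; apply: eq_bigr => s _; rewrite big_distrr /=; apply: eq_bigr => s' _.
  by rewrite big_distrl /=; apply: eq_bigr => u _; rewrite big_distrr.
have tr (L : cf -> cf -> C) : ktrace (kmul L (kprod p)) = \sum_s \sum_u L s u * kprod p u s by [].
rewrite !tr !sq.
rewrite (sum_swap B); apply: eq_bigr => s _; apply: eq_bigr => s' _.
rewrite (sum_swap B); apply: eq_bigr => u _; apply: eq_bigr => u' _.
rewrite mulrACA [RHS]mulrACA; congr (_ * _); last first.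
  rewrite /kprod -!big_split; apply: eq_bigr => y _ /=; rewrite !ffunE.
  by case: (y \in B) => //; rewrite mulrC.
rewrite (kmul_disjoint _ _ hM hN).
rewrite /kone; have [/eqP e|ne] := boolP (mrg B s' s == mrg B u' u).
  rewrite mulr1.
  have e1 y : y \in B -> s' y = u' y by move=> yB; have := congr1 (fun g : cf => g y) e; rewrite !ffunE yB.
  have e2 y : y \notin B -> s y = u y by move=> yB; have := congr1 (fun g : cf => g y) e; rewrite !ffunE (negbTE yB).
  congr (_ * _).
    by apply: hM.2 => y yB; rewrite !ffunE ?yB ?(negbTE yB) //; split=> //; exact: e2.
  apply: hN.2 => y; rewrite inE ?negbK => yB; rewrite !ffunE ?yB ?(negbTE yB) //.
  by split=> //; exact: e1.
rewrite mulr0; apply/esym/eqP; rewrite mulf_eq0.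
apply/negPn; rewrite negb_or; apply/negP => /andP[/hM.1 h1 /hN.1 h2].
case/eqP: ne; apply/ffunP => y; rewrite !ffunE; case: ifP => yB.
  by apply: h2; rewrite inE yB.
by apply: h1; rewrite yB.
Qed.

Lemma ktau_disjoint B M N (p : T -> S -> S -> C) : supported B M -> supported (~: B) N ->
  kselfadjoint M -> kselfadjoint N -> kselfadjoint (kprod p) ->
  0 < complex.Re (ktrace (kprod p)) ->
  ktau (kprod p) (kmul M N) = ktau (kprod p) M * ktau (kprod p) N.
Proof.
move=> hM hN sM sN sp tp.
have := congr1 (@complex.Re R) (ktrace_disjoint p hM hN).
rewrite !cReM (ktrace_real1 sp) (ktrace_real sM sp) (ktrace_real sN sp) !(mulr0,subr0) => E.
rewrite /ktau; set z := complex.Re (ktrace (kprod p)) in E tp *.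
have z0 : z != 0 by rewrite gt_eqF.
by rewrite mulf_div -E -mulf_div mulfV ?mulr1.
Qed.

End Support.

Section ProductProjection.
Import mathcomp.boot.fintype mathcomp.boot.finset.
Variables (R : realType) (S : finType).
Local Notation C := (R[i]).

Lemma kembed_comp (T T' T'' : finType) (f : T -> T') (g : T' -> T'') (M : {ffun T -> S} -> {ffun T -> S} -> C) :
  injective g -> kembed g (kembed f M) = kembed (g \o f) M.
Proof.
move=> ginj; apply/funext => s; apply/funext => t; rewrite /kembed.
have pp (u : {ffun T'' -> S}) : pull f (pull g u) = pull (g \o f) u.
  by apply/ffunP => x; rewrite !ffunE.
rewrite !pp; have -> : offcodom (g \o f) s t = offcodom g s t && offcodom f (pull g s) (pull g t).
  apply/offcodomP/andP => [h|[/offcodomP h1 /offcodomP h2] y yf].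
    split; apply/offcodomP => y yf.
      by apply: h; apply: contra yf => /codomP[x ->]; exact: codom_f.
    rewrite !ffunE; apply: h; apply: contra yf => /codomP[x /ginj ->]; exact: codom_f.
  have [/codomP[x xy]|yg] := boolP (y \in codom g); last exact: h1.
  have := h2 x; rewrite !ffunE xy; apply; apply: contra yf => /codomP[z xz].
  by rewrite xy xz; exact: (codom_f (g \o f)).
by case: (offcodom g s t).
Qed.

Variables (T : finType) (p : T -> S -> S -> C).
Hypothesis psa : forall y, kselfadjoint (p y).
Hypothesis pid : forall y s t, kmul (p y) (p y) s t = p y s t.
Hypothesis ppos : forall y, 0 < complex.Re (ktrace (p y)).

Lemma kprod_projection : kprojection (kprod p).
Proof.
split=> s t; first by rewrite /kprod rmorph_prod; apply: eq_bigr => y _; exact: psa.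
rewrite /kmul /kprod; under [LHS]eq_bigr do rewrite -big_split /=.
rewrite -(bigA_distr_bigA (fun y j => p y (s y) j * p y j (t y))).
by apply: eq_bigr => y _; rewrite -(pid y (s y)).
Qed.

Lemma ktrace_kprod : ktrace (kprod p) = \prod_y ktrace (p y).
Proof. by rewrite /ktrace bigA_distr_bigA. Qed.

Lemma ktrace_kprod_gt0 : 0 < complex.Re (ktrace (kprod p)).
Proof.
rewrite ktrace_kprod.
suff : 0 < complex.Re (\prod_y ktrace (p y)) /\ complex.Im (\prod_y ktrace (p y)) = 0 by case.
elim/big_ind: _ => //=.
- by move=> x y [x1 x2] [y1 y2]; rewrite cReM cImM x2 y2 !(mulr0,mul0r) subr0 addr0 mulr_gt0.
- by move=> y _; split; [exact: ppos|exact: ktrace_real1].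
Qed.

Lemma kembed_supported (U : finType) (f : U -> T) (B : {set T}) (M : {ffun U -> S} -> {ffun U -> S} -> C) :
  (forall y, (y \in codom f) = (y \in B)) -> supported B (kembed f M).
Proof.
move=> fB; split.
  by move=> s t; rewrite /kembed; case: offcodomP => [h _ y yB|_]; [apply: h; rewrite fB|rewrite eqxx].
move=> s t s' t' e1 e2; rewrite /kembed.
have -> : offcodom f s t by apply/offcodomP => y; rewrite fB => /e2[].
have -> : offcodom f s' t' by apply/offcodomP => y; rewrite fB => /e2[].
congr (M _ _); apply/ffunP => x; rewrite !ffunE.
  by have [] := e1 (f x); rewrite -?fB ?codom_f.
by have [] := e1 (f x); rewrite -?fB ?codom_f.
Qed.

End ProductProjection.

(** * Subsets of a finite region as sets over a finite type *)

Section SubsetTransport.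
Import mathcomp.boot.fintype mathcomp.boot.finset.
Variables (K : choiceType) (V : {fset K}).

Definition fs (A : {set V}) : {fset K} := [fset val x | x in A]%fset.

Lemma mem_fs (A : {set V}) (x : V) : (val x \in fs A) = (x \in A).
Proof.
apply/imfsetP/idP => [[y /= yA /val_inj -> //]|xA]; by exists x.
Qed.

Lemma fsP (A : {set V}) y : reflect (exists2 x : V, x \in A & y = val x) (y \in fs A).
Proof. by apply: (iffP (imfsetP _ _ _ _)) => -[x /= ? ?]; exists x. Qed.

Lemma fs_sub (A : {set V}) : (fs A `<=` V)%fset.
Proof. by apply/fsubsetP => y /fsP[x _ ->]; exact: valP. Qed.

Lemma fs_inj : injective fs.
Proof. by move=> A B e; apply/setP => x; rewrite -!mem_fs e. Qed.

Lemma fs_subset (A B : {set V}) : (fs A `<=` fs B)%fset = (A \subset B).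
Proof.
apply/fsubsetP/subsetP => h x; first by rewrite -!mem_fs; exact: h.
by move=> /fsP[y /h yB ->]; rewrite mem_fs.
Qed.

Lemma fs_surj (B : {fset K}) : (B `<=` V)%fset -> exists A : {set V}, B = fs A.
Proof.
move=> /fsubsetP BV; exists [set x : V | val x \in B]; apply/fsetP => y.
apply/idP/fsP => [yB|[x xB ->]]; last by rewrite inE in xB.
by exists [` BV y yB]%fset; rewrite ?inE.
Qed.

Lemma fsT : fs setT = V.
Proof.
apply/fsetP => y; apply/fsP/idP => [[x _ ->]|yV]; first exact: valP.
by exists [` yV]%fset; rewrite ?inE.
Qed.

Lemma card_fs (A : {set V}) : #|` fs A| = #|A|.
Proof. by rewrite card_imfset //=; [rewrite -cardE|exact: val_inj]. Qed.

Lemma sum_fpowerset (R : nmodType) (A : {set V}) (G : {fset K} -> R) :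
  \sum_(B <- fpowerset (fs A)) G B = \sum_(B : {set V} | B \subset A) G (fs B).
Proof.
rewrite -[RHS]big_filter -[RHS](big_map fs predT G) /=.
apply: perm_big; apply: uniq_perm.
- exact: fset_uniq.
- by rewrite (map_inj_uniq fs_inj) filter_uniq // index_enum_uniq.
move=> B; rewrite fpowersetE; apply/idP/mapP => [BA|[C]].
  have [C BC] := fs_surj (fsubset_trans BA (fs_sub A)).
  by exists C; rewrite // mem_filter mem_index_enum andbT -fs_subset -BC.
by rewrite mem_filter => /andP[CA _] ->; rewrite fs_subset.
Qed.

Lemma sum_fpowersetT (R : nmodType) (G : {fset K} -> R) :
  \sum_(B <- fpowerset V) G B = \sum_(B : {set V}) G (fs B).
Proof.
have := sum_fpowerset setT G; rewrite fsT => ->.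
by apply: eq_bigl => B; rewrite subsetT.
Qed.

End SubsetTransport.

(** * Expansion on the lattice *)

Section LatticeExpansion.
Import mathcomp.boot.fintype mathcomp.boot.finset.
Variables (R : realType) (d m : nat) (Phi : interaction R d m).
Arguments Phi : clear implicits.
Variables (K : finType) (p : K -> 'I_m -> 'I_m -> R[i]) (b : R).
Hypothesis hPhi : is_quantum_interaction Phi.
Hypothesis psa : forall k, kselfadjoint (p k).
Hypothesis pid : forall k s t, kmul (p k) (p k) s t = p k s t.
Hypothesis ppos : forall k, 0 < complex.Re (ktrace (p k)).
Local Notation C := (R[i]).
Local Notation site := (site d).
Implicit Types (L V : {fset site}) (w : site -> K).

Definition lmap L L' (h : site -> site) (H : forall x : L, h (val x) \in L') : L -> L' :=
  fun x => [` H x]%fset.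

Lemma lmap_inj L L' h (H : forall x : L, h (val x) \in L') : injective h -> injective (lmap H).
Proof. by move=> hinj x y /(congr1 val) /= /hinj /val_inj. Qed.

Definition pw L w (y : L) := p (w (val y)).
Definition ZL L w : R := kZ (kprod (pw (L := L) w)) b (hamiltonian Phi L).

Lemma kZ_lmap L L' h (H : forall x : L, h (val x) \in L') w (M : op R m L) : injective h ->
  kZ (kprod (pw (L := L') w)) b (kembed (lmap H) M) = kZ (kprod (pw (L := L) (w \o h))) b M.
Proof.
move=> hinj; rewrite /kZ; congr (limn (series _)); apply/funext => n.
rewrite /kZterm; congr (_ * _); rewrite kembed_pow; last exact: lmap_inj.
rewrite ktau_kembed //; first exact: lmap_inj.
- by move=> y; exact: psa.
- by move=> y; exact: ppos.
Qed.

Lemma embedE L L' (H : forall x : L, id (val x) \in L') (A : op R m L) :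
  embed L' A = kembed (lmap H) A.
Proof.
apply/funext => s; apply/funext => t; rewrite /embed /kembed.
have -> : offcodom (lmap H) s t = offeq L s t.
  apply/offcodomP/forallP => h y.
    apply/implyP => yL; apply/eqP; apply: h; apply: contra yL => /codomP[x ->]; exact: (valP x).
  move=> yf; apply/eqP; move/implyP: (h y); apply; apply: contra yf => yL.
  apply/codomP; exists [` yL]%fset; exact: val_inj.
have agreeE (s' : conf m L) (u : conf m L') : agree s' u = (s' == pull (lmap H) u).
  apply/forallP/eqP => [h|->].
    apply/ffunP => x; rewrite ffunE; move/forallP: (h x) => /(_ (lmap H x)).
    by rewrite eqxx => /eqP.
  move=> x; apply/forallP => y; apply/implyP => /eqP xy; rewrite ffunE; apply/eqP; congr (u _).
  exact: val_inj.
case: ifP => // _; rewrite (big_pred1 (pull (lmap H) s)); last by move=> s'; rewrite agreeE.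
by rewrite (big_pred1 (pull (lmap H) t)) // => s'; rewrite agreeE.
Qed.

Lemma Phi0 A : A = fset0 -> forall s t, Phi A s t = 0.
Proof. by move=> ->; exact: hPhi.2.1. Qed.

Lemma fs_incl V (A : {set V}) (x : fs A) : id (val x) \in V.
Proof. exact: (fsubsetP (fs_sub A)) (valP x). Qed.

Definition locX V (A : {set V}) : op R m V := embed V (Phi (fs A)).

Lemma locXE V (A : {set V}) : locX A = kembed (lmap (@fs_incl V A)) (Phi (fs A)).
Proof. exact: embedE. Qed.

Lemma famH_hamiltonian V (U : {set V}) :
  famH (@locX V) (psubsets U) = kembed (lmap (@fs_incl V U)) (hamiltonian Phi (fs U)).
Proof.
apply/funext => s; apply/funext => t.
rewrite /hamiltonian kembed_sum sum_fpowerset /famH.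
rewrite [RHS](bigID (fun A : {set V} => A != set0)) /= [X in _ = _ + X]big1 ?addr0; last first.
  move=> A /andP[_]; rewrite negbK => /eqP A0.
  have f0 : fs A = fset0.
    by apply/fsetP => y; rewrite in_fset0; apply/negbTE/negP => /fsP[x]; rewrite A0 inE.
  rewrite /kembed; case: ifP => // _; rewrite /embed; case: ifP => // _.
  by rewrite big1 // => s' _; rewrite big1 // => t' _; exact: Phi0.
apply: eq_big => [A|A]; first by rewrite inE.
rewrite inE => /andP[AU _].
have H (x : fs A) : id (val x) \in fs U.
  by have := valP x; rewrite -fs_subset in AU; exact: (fsubsetP AU).
rewrite locXE (embedE H) kembed_comp; last by apply: lmap_inj.
by congr (kembed _ _ s t); apply/funext => x; exact: val_inj.
Qed.

Lemma locX_supported V (A : {set V}) : supported A (locX A).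
Proof.
rewrite locXE; apply: kembed_supported => y; apply/codomP/idP => [[x ->]|yA].
  by rewrite -mem_fs; exact: (valP x).
have yf : val y \in fs A by rewrite mem_fs.
by exists [` yf]%fset; exact: val_inj.
Qed.

Lemma locX_bounded V (A : {set V}) : kbounded (locX A) (opnorm (Phi (fs A))).
Proof. by rewrite locXE; apply: kembed_bounded; [exact: lmap_inj|exact: kbounded_opnorm]. Qed.

Lemma locX_selfadjoint V (A : {set V}) : kselfadjoint (locX A).
Proof. by rewrite locXE; apply: kembed_selfadjoint; exact: hPhi.1. Qed.

Definition locY V w (g : {set {set V}}) : R := moeb (famZ (kprod (pw (L := V) w)) b (@locX V)) g.

Lemma locP V w : kprojection (kprod (pw (L := V) w)) /\ 0 < complex.Re (ktrace (kprod (pw (L := V) w))).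
Proof.
split; first by apply: kprod_projection => y; [exact: psa|exact: pid].
by apply: ktrace_kprod_gt0 => y; [exact: psa|exact: ppos].
Qed.

(** Families inside [U] rebuild the Hamiltonian of [U], and the normalised trace ignores the other
    sites: the abstract partition function is the genuine one of the smaller region. *)
Lemma clusterZ_loc V w (U : {set V}) :
  \sum_(g : {set {set V}} | g \subset psubsets U) locY w g = ZL (fs U) w.
Proof.
rewrite /locY sum_moeb /famZ famH_hamiltonian /ZL.
exact: (@kZ_lmap _ _ id (@fs_incl V U)).
Qed.

Lemma kZ_zero (I : finType) (P M : I -> I -> C) : 0 < complex.Re (ktrace P) ->
  (forall s t, M s t = 0) -> kZ P b M = 1.
Proof.
move=> trP M0.
have t0 : kZterm P b M 0 = 1.
  rewrite /kZterm expr0 fact0 divr1 mul1r /ktau.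
  have -> : ktrace (kmul (kpow M 0) P) = ktrace P.
    apply: eq_bigr => s _; rewrite /kmul (bigD1 s) //= /kone eqxx mul1r.
    by rewrite big1 ?addr0 // => t; rewrite eq_sym => /negbTE ->; rewrite mul0r.
  by rewrite mulfV // gt_eqF.
have tS n : kZterm P b M n.+1 = 0.
  rewrite /kZterm /ktau (_ : ktrace _ = 0) ?mul0r ?mulr0 // /ktrace big1 // => s _.
  rewrite /kmul big1 // => t _; rewrite /kpow /= /kmul big1 ?mul0r // => u _.
  by rewrite M0 mul0r.
apply: cvg_lim => //; rewrite -(cvg_shiftS (series (kZterm P b M))).
have -> : (fun n => series (kZterm P b M) n.+1) = cst 1; last exact: cvg_cst.
apply/funext => n; rewrite /series /= big_nat_recl // t0 big1 ?addr0 // => i _; exact: tS.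
Qed.

Lemma locY0 V w : @locY V w set0 = 1.
Proof.
rewrite /locY /moeb (big_pred1 set0); last by move=> g; rewrite subset0.
rewrite signDn mul1r; apply: kZ_zero; first exact: (locP _ w).2.
by move=> s t; rewrite /famH big_set0.
Qed.

(** Hamiltonians of families with disjoint supports commute and are independent under the product
    state, so the exponentials factor; Moebius inversion keeps the factorisation. *)
Lemma locYM V w (B : {set V}) (g h : {set {set V}}) : g \subset psubsets B ->
  h \subset psubsets (~: B) -> locY w (g :|: h) = locY w g * locY w h.
Proof.
move=> gB hB.
have dis : forall A, A \in g -> A \in h -> False.
  move=> A /(subsetP gB)/psubsetsP[/subsetP AB [x xA]] /(subsetP hB)/psubsetsP[/subsetP AB' _].
  by have := AB' x xA; rewrite inE AB.
apply: moeb_setU; first by rewrite -setI_eq0; apply/eqP/setP => A; rewrite !inE; apply/negbTE/negP => /andP[]; exact: dis.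
move=> g' h' /subsetP gg /subsetP hh.
have sg : supported B (famH (@locX V) g').
  apply: supported_sum => A /gg /(subsetP gB)/psubsetsP[AB _].
  exact: supportedW AB (locX_supported A).
have sh : supported (~: B) (famH (@locX V) h').
  apply: supported_sum => A /hh /(subsetP hB)/psubsetsP[AB _].
  exact: supportedW AB (locX_supported A).
have ag : kselfadjoint (famH (@locX V) g') by apply: kselfadjoint_sum => A _; exact: locX_selfadjoint.
have ah : kselfadjoint (famH (@locX V) h') by apply: kselfadjoint_sum => A _; exact: locX_selfadjoint.
have [pp tp] := locP V w.
rewrite /famZ -kZ_mul //.
- congr (kZ _ _); apply/funext => s; apply/funext => t; rewrite /famH /Defs.kadd -bigU /=.
    by apply: eq_bigl => A; rewrite in_setU.
  by rewrite -setI_eq0; apply/eqP/setP => A; rewrite !inE; apply/negbTE/negP => /andP[/gg + /hh]; exact: dis.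
- by move=> s t; exact: (kmulC_disjoint _ _ sg sh).
- move=> j k; apply: (@ktau_disjoint _ _ _ B) => //; try exact: supported_pow;
    try exact: kpow_selfadjoint.
  exact: pp.1.
Qed.

Lemma locY_le V w (g : {set {set V}}) :
  `|locY w g| <= \prod_(A in g) (expR (`|b| * opnorm (Phi (fs A))) - 1).
Proof.
have [pp tp] := locP V w.
by apply: famY_le => // A; exact: locX_bounded.
Qed.

(** Moebius inverse of ln Z over subregions of [A]. It refers to no ambient volume, so the same
    function serves all volumes and the limit. *)
Definition phi A w : R :=
  \sum_(B <- fpowerset A) (-1) ^+ (#|` A| + #|` B|) * ln (ZL B w).

Lemma ZL_local L w w' : (forall y, y \in L -> w y = w' y) -> ZL L w = ZL L w'.
Proof.
move=> h; rewrite /ZL (_ : pw w = pw w') //.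
by apply/funext => y; rewrite /pw h //; exact: valP.
Qed.

Lemma phi_local A w w' : (forall y, y \in A -> w y = w' y) -> phi A w = phi A w'.
Proof.
move=> h; rewrite /phi big_seq [RHS]big_seq; apply: eq_bigr => B.
rewrite fpowersetE => /fsubsetP BA; congr (_ * ln _); apply: ZL_local => y /BA; exact: h.
Qed.

Lemma moeb_phi V (A : {set V}) w : moeb (fun U : {set V} => ln (ZL (fs U) w)) A = phi (fs A) w.
Proof.
rewrite /phi sum_fpowerset /moeb; apply: eq_bigr => B _.
by rewrite !card_fs.
Qed.

Lemma sum_phi V w : \sum_(A <- fpowerset V) phi A w = ln (ZL V w).
Proof.
rewrite sum_fpowersetT; under eq_bigr do rewrite -moeb_phi.
transitivity (\sum_(A : {set V} | A \subset setT) moeb (fun U : {set V} => ln (ZL (fs U) w)) A).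
  by apply: eq_bigl => A; rewrite subsetT.
by rewrite sum_moeb fsT.
Qed.

Variable k0 : K.
Definition extk V (w : {ffun V -> K}) : site -> K :=
  fun y => if insub y is Some y' then w y' else k0.

Lemma extkE V (w : site -> K) y : y \in V -> extk [ffun x : V => w (val x)] y = w y.
Proof. by move=> yV; rewrite /extk insubT /= ffunE. Qed.

(** A maximum over the finitely many patterns on [A], padded by [k0]; it bounds all patterns because
    [phi A] only sees [A]. *)
Definition cphi (A : {fset site}) : R := maxabs (fun w : {ffun A -> K} => phi A (extk w)).

Lemma phi_le A w : `|phi A w| <= cphi A.
Proof.
rewrite (@phi_local A w (extk [ffun x : A => w (val x)])); last by move=> y yA; rewrite extkE.
exact: (le_maxabs (fun w : {ffun A -> K} => phi A (extk w))).
Qed.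

Variables (k s : R).
Hypothesis s0 : 0 <= s.
Hypothesis sk : s + s <= k.
Hypothesis small : forall V i, \sum_(A <- fpowerset V | i \in A)
  (expR (`|b| * opnorm (Phi A)) - 1) * expR k ^+ #|` A| <= s.

Let cl V (A : {set V}) := expR (`|b| * opnorm (Phi (fs A))) - 1.

Let cl0 V (A : {set V}) : 0 <= cl A.
Proof. by rewrite subr_ge0 -expR0 ler_expR mulr_ge0 // (locX_bounded A).1. Qed.

Let cls V (i : V) : \sum_(A : {set V} | i \in A) cl A * expR k ^+ #|A| <= s.
Proof.
apply: le_trans (small V (val i)); rewrite [X in _ <= X]big_mkcond /= sum_fpowersetT big_mkcond /=.
by apply: ler_sum => A _; rewrite mem_fs card_fs.
Qed.

Let w0 V : {ffun V -> K} := [ffun=> k0].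

Let cZE V (w : {ffun V -> K}) (U : {set V}) :
  clusterZ (fun g (w : {ffun V -> K}) => locY (extk w) g) U w = ZL (fs U) (extk w).
Proof. exact: clusterZ_loc. Qed.

Lemma ZL_gt0 L w : 0 < ZL L w.
Proof.
have := @clusterZ_gt0 R L {ffun L -> K} (w0 L) (fun g (w : {ffun L -> K}) => locY (extk w) g) (@cl L) k s
  (fun w : {ffun L -> K} => locY0 _ _) (fun w : {ffun L -> K} => @locYM L (extk w)) (@cl0 L)
  (fun g (w : {ffun L -> K}) => locY_le _ _) (@cls L) s0 sk setT
  [ffun x : L => w (val x)].
rewrite cZE fsT (@ZL_local L _ w) // => y yL; exact: extkE.
Qed.

Lemma sum_cphi V i : \sum_(A <- fpowerset V | i \in A) cphi A <= expR s - 1.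
Proof.
have [iV|iV] := boolP (i \in V); last first.
  rewrite big_seq_cond big1 ?subr_ge0 -?expR0 ?ler_expR // => A.
  by rewrite fpowersetE => /andP[/fsubsetP AV /AV iV']; rewrite iV' in iV.
pose x : V := [` iV]%fset.
have := @cluster_expansion R V {ffun V -> K} (w0 V) (fun g (w : {ffun V -> K}) => locY (extk w) g) (@cl V) k s
  (fun w : {ffun V -> K} => locY0 _ _) (fun w : {ffun V -> K} => @locYM V (extk w)) (@cl0 V)
  (fun g (w : {ffun V -> K}) => locY_le _ _) (@cls V) s0 sk x.
apply: le_trans.
rewrite [X in X <= _]big_mkcond /= sum_fpowersetT [X in _ <= X]big_mkcond /=.
apply: ler_sum => A _; rewrite -(mem_fs A x) /=.
case: ifP => // _; apply: maxabs_le; first exact: maxabs_ge0.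
(* A pattern on [A] is padded by [k0] to one on [V]; the coefficient at [A] does not see the
   padding. *)
move=> w; pose w' : {ffun V -> K} := [ffun y : V => extk w (val y)].
rewrite (@phi_local _ _ (extk w')); last first.
  by move=> y yA; rewrite extkE //; exact: (fsubsetP (fs_sub A)).
rewrite -moeb_phi.
apply: le_trans (le_maxabs (fun w : {ffun V -> K} => moeb (fun U => ln (clusterZ
  (fun g (w : {ffun V -> K}) => locY (extk w) g) U w)) A) w').
by rewrite le_eqVlt; apply/orP; left; apply/eqP; congr (`| _ |); apply: eq_moeb => U _; rewrite cZE.
Qed.

End LatticeExpansion.

(** * Translation covariance *)

Section Translation.
Local Notation shift := Defs.shift.
Variables (R : realType) (d m : nat) (Phi : interaction R d m).
Arguments Phi : clear implicits.
Variables (K : finType) (p : K -> 'I_m -> 'I_m -> R[i]) (b : R).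
Hypothesis hPhi : is_quantum_interaction Phi.
Hypothesis psa : forall k, kselfadjoint (p k).
Hypothesis ppos : forall k, 0 < complex.Re (ktrace (p k)).
Local Notation site := (site d).

Lemma mem_shift (A : {fset site}) i y : (y \in shift A i) = (y - i \in A).
Proof.
apply/imfsetP/idP => [[x /= xA ->]|yA]; first by rewrite addrK.
by exists (y - i); rewrite //= subrK.
Qed.

Lemma shift_inj i : injective (fun A : {fset site} => shift A i).
Proof.
by move=> A B /fsetP e; apply/fsetP => y; have := e (y + i); rewrite !mem_shift addrK.
Qed.

Lemma sum_fpowerset_shift (M : nmodType) (L : {fset site}) i (G : {fset site} -> M) :
  \sum_(A <- fpowerset (shift L i)) G A = \sum_(A <- fpowerset L) G (shift A i).
Proof.
rewrite -(big_map (fun A => shift A i) predT G) /=; apply: perm_big; apply: uniq_perm.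
- exact: fset_uniq.
- by rewrite (map_inj_uniq (@shift_inj i)) fset_uniq.
move=> A; rewrite fpowersetE; apply/idP/mapP => [AL|[B]].
  exists (shift A (- i)).
    rewrite fpowersetE; apply/fsubsetP => y; rewrite mem_shift opprK => /(fsubsetP AL).
    by rewrite mem_shift addrK.
  by apply/fsetP => y; rewrite !mem_shift opprK subrK.
rewrite fpowersetE => /fsubsetP BL ->; apply/fsubsetP => y; rewrite !mem_shift; exact: BL.
Qed.

Lemma shift_lmapP (L : {fset site}) i (x : L) : (fun z => z + i) (val x) \in shift L i.
Proof. by rewrite mem_shift addrK; exact: valP. Qed.

Lemma addi_inj (i : site) : injective (fun z : site => z + i).
Proof. exact: addIr. Qed.

(** A translation is an embedding along the bijection x -> x + i, and it composes with the
    inclusions of the interaction sets. *)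
Lemma hamiltonian_shift (L : {fset site}) i :
  hamiltonian Phi (shift L i) = kembed (lmap (@shift_lmapP L i)) (hamiltonian Phi L).
Proof.
apply/funext => s; apply/funext => t.
rewrite /hamiltonian kembed_sum sum_fpowerset_shift big_seq [RHS]big_seq.
apply: eq_bigr => A; rewrite fpowersetE => /fsubsetP AL.
have PhiE : Phi (shift A i) = kembed (lmap (@shift_lmapP A i)) (Phi A).
  apply/funext => s2; apply/funext => t2; rewrite /kembed.
  have -> : offcodom (lmap (@shift_lmapP A i)) s2 t2.
    apply/offcodomP => y /negP[]; apply/codomP.
    have yA : val y - i \in A by rewrite -mem_shift; exact: valP.
    by exists [` yA]%fset; apply: val_inj; rewrite /= subrK.
  apply: hPhi.2.2.1 => x y xy; rewrite !ffunE.
  by have -> : y = lmap (@shift_lmapP A i) x by exact: val_inj.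
have H1 (x : A) : id (val x) \in L by exact: AL _ (valP x).
have H2 (x : shift A i) : id (val x) \in shift L i.
  by have := valP x; rewrite !mem_shift; exact: AL.
rewrite (embedE H1) (embedE H2) PhiE !kembed_comp; last 2 first.
- by apply: lmap_inj; exact: addi_inj.
- exact: lmap_inj.
by congr (kembed _ _ s t); apply/funext => x; exact: val_inj.
Qed.

Lemma ZL_shift (L : {fset site}) i w :
  ZL Phi p b (shift L i) w = ZL Phi p b L (fun y => w (y + i)).
Proof.
rewrite /ZL hamiltonian_shift; apply: kZ_lmap => //; exact: addi_inj.
Qed.

Lemma card_shift (A : {fset site}) i : #|` shift A i| = #|` A|.
Proof. by rewrite card_imfset //=; exact: addi_inj. Qed.

Lemma phi_shift (A : {fset site}) i w :
  phi Phi p b (shift A i) w = phi Phi p b A (fun y => w (y + i)).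
Proof.
rewrite /phi sum_fpowerset_shift; apply: eq_bigr => B _.
by rewrite !card_shift ZL_shift.
Qed.

End Translation.

(** * Exhaustion of the lattice by boxes *)

Section Boxes.
Variable d : nat.
Local Notation site := (site d).
Local Notation box := (box d).

Lemma mem_box n (x : site) : (x \in box n) = [forall k, `|x k| <= n%:Z].
Proof.
rewrite /Defs.box seq_fsetE; apply/mapP/forallP => [[f _ ->] k|h].
  rewrite ffunE ler_norml; apply/andP; split; first by rewrite lerBrDr addNr.
  by rewrite lerBlDr -PoszD lez_nat addnn -ltnS.
have hk k : (absz (x k + n%:Z)%R < n.*2.+1)%N.
  by have := h k; lia.
exists [ffun k => Ordinal (hk k)]; rewrite ?mem_enum //; apply/ffunP => k; rewrite !ffunE /=.
by have := h k; lia.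
Qed.

Lemma box_mono n n' : (n <= n')%N -> (box n `<=` box n')%fset.
Proof.
move=> nn; apply/fsubsetP => x; rewrite !mem_box => /forallP h; apply/forallP => k.
by apply: le_trans (h k) _; rewrite lez_nat.
Qed.

Lemma mem_box_exists (x : site) : exists n, x \in box n.
Proof.
exists (\max_(k < d) absz (x k))%N; rewrite mem_box; apply/forallP => k.
by rewrite -abszE lez_nat (leq_bigmax k).
Qed.

Lemma fsub_box (L : {fset site}) : exists n0, forall n, (n0 <= n)%N -> (L `<=` box n)%fset.
Proof.
have /choice[f hf] : forall x : L, exists n, val x \in box n by move=> x; exact: mem_box_exists.
exists (\max_(x : L) f x)%N => n hn; apply/fsubsetP => x xL.
apply: (fsubsetP (box_mono hn)); apply: (fsubsetP (@box_mono (f [` xL]%fset) _ _)).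
  exact: (leq_bigmax [` xL]%fset).
exact: (hf [` xL]%fset).
Qed.

Lemma near_fsub_box (L : {fset site}) : \forall n \near \oo, (L `<=` box n)%fset.
Proof. by have [n0 h] := fsub_box L; exists n0. Qed.

End Boxes.

(** * Absolutely convergent sums over sets meeting a region *)

Section BoxSums.
Variables (R : realType) (d : nat).
Local Notation site := (site d).
Local Notation box := (box d).
Implicit Types (a f : {fset site} -> R) (L : {fset site}).

Definition touches L (A : {fset site}) := (A `&` L)%fset != fset0.

Definition bsum a L n : R := \sum_(A <- fpowerset (box n) | touches L A) a A.

Lemma touchesP L A : reflect (exists2 i, i \in A & i \in L) (touches L A).
Proof.
apply: (iffP (fset0Pn _)); first by move=> [j]; rewrite inE => /andP[]; exists j.
by move=> [i iA iL]; exists i; rewrite inE iA iL.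
Qed.

Lemma sum_sub_fsets f (r r' : {fset {fset site}}) (P : pred {fset site}) :
  (forall A, 0 <= f A) -> (r `<=` r')%fset ->
  \sum_(A <- r | P A) f A <= \sum_(A <- r' | P A) f A.
Proof.
move=> f0 rr; rewrite [X in _ <= X](bigID (fun A => A \in r)) /=.
have -> : \sum_(A <- r' | P A && (A \in r)) f A = \sum_(A <- r | P A) f A.
  rewrite -[LHS]big_filter -[RHS]big_filter; apply: perm_big; apply: uniq_perm; rewrite ?filter_uniq ?fset_uniq //.
  move=> A; rewrite !mem_filter; apply/andP/andP => [[/andP[-> ->]]//|[-> Ar]].
  by rewrite Ar (fsubsetP rr).
by rewrite lerDl sumr_ge0.
Qed.

Lemma bsum_tail f L n n' : (n <= n')%N ->
  bsum f L n' - bsum f L n =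
  \sum_(A <- fpowerset (box n') | touches L A && ~~ (A `<=` box n)%fset) f A.
Proof.
move=> nn; rewrite /bsum (bigID (fun A => (A `<=` box n)%fset)) /=.
have -> : \sum_(A <- fpowerset (box n') | touches L A && (A `<=` box n)%fset) f A =
    \sum_(A <- fpowerset (box n) | touches L A) f A.
  rewrite -[LHS]big_filter -[RHS]big_filter; apply: perm_big; apply: uniq_perm; rewrite ?filter_uniq ?fset_uniq //.
  move=> A; rewrite !mem_filter !fpowersetE; apply/andP/andP => [[/andP[-> ->]]//|[-> Ar]].
  by rewrite Ar (fsubset_trans Ar (box_mono d nn)).
by rewrite addrAC subrr add0r.
Qed.

Lemma bsum_mono f L : (forall A, 0 <= f A) -> nondecreasing_seq (bsum f L).
Proof.
move=> f0 n n' nn; apply: sum_sub_fsets => //.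
by rewrite fpowersetS box_mono.
Qed.

Lemma bsumB a a' L n : bsum (fun A => a A - a' A) L n = bsum a L n - bsum a' L n.
Proof. by rewrite /bsum sumrB. Qed.

(** Written with positive and negative parts so as to coincide with [energy] by computation. *)
Definition tsum a L : R :=
  fine (\esum_(A in [set A | touches L A]) (Num.max (a A) 0)%:E) -
  fine (\esum_(A in [set A | touches L A]) (Num.max (- a A) 0)%:E).

(** Every finite collection of finite sets fits in a box, so for nonnegative terms the unordered sum
    is the limit along boxes. *)
Lemma esum_bsum f L (M : R) : (forall A, 0 <= f A) -> (forall n, bsum f L n <= M) ->
  bsum f L @ \oo --> fine (\esum_(A in [set A | touches L A]) (f A)%:E).
Proof.
move=> f0 fM; have mono := bsum_mono L f0.
have ub : has_ubound (range (bsum f L)) by exists M => _ [n _ <-]; exact: fM.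
have cv : cvgn (bsum f L) by apply: nondecreasing_is_cvgn.
have le_lim n : bsum f L n <= limn (bsum f L) by exact: nondecreasing_cvgn_le.
suff -> : \esum_(A in [set A | touches L A]) (f A)%:E = (limn (bsum f L))%:E by [].
apply/eqP; rewrite eq_le; apply/andP; split.
  apply: ub_ereal_sup => _ [X [finX XS] <-].
  rewrite fsbig_finite //= sumEFin lee_fin.
  have [n hn] := fsub_box (\bigcup_(A <- fset_set X) A)%fset.
  apply: le_trans (le_lim n); rewrite /bsum.
  have -> : \sum_(A <- fset_set X) f A = \sum_(A <- fset_set X | touches L A) f A.
    rewrite big_seq [RHS]big_seq_cond; apply: eq_bigl => A.
    case: (boolP (A \in fset_set X)) => //= AX; apply/esym.
    by apply: XS; rewrite in_fset_set // inE in AX.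
  apply: sum_sub_fsets => //; apply/fsubsetP => A AX; rewrite fpowersetE.
  apply: fsubset_trans (hn n (leqnn n)); exact: bigfcup_sup.
rewrite -EFin_lim //; apply: lime_le; first by apply: (cvgP (limn (bsum f L))%:E); apply: cvg_EFin; [exact: nearW|exact: cv].
apply: nearW => n; apply: esum_ge.
exists [set` [seq A <- fpowerset (box n) | touches L A]].
  split; first exact: finite_seq.
  by move=> A /=; rewrite mem_filter => /andP[].
by rewrite -fsbig_seq ?filter_uniq ?fset_uniq // sumEFin lee_fin big_filter.
Qed.

Variables (c : {fset site} -> R) (M : R).
Hypothesis c0 : forall A, 0 <= c A.
Hypothesis cM : forall V i, \sum_(A <- fpowerset V | i \in A) c A <= M.

Lemma bsum_bound L n : bsum c L n <= #|` L|%:R * M.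
Proof.
apply: (@le_trans _ _ (\sum_(i <- L) \sum_(A <- fpowerset (box n) | i \in A) c A)).
  rewrite (exchange_big_dep predT) //= /bsum big_mkcond /=; apply: ler_sum => A _.
  case: ifP => [/touchesP[i iA iL]|_]; last by apply: sumr_ge0.
  rewrite -big_filter (big_rem i) /=; last by rewrite mem_filter iA.
  by rewrite lerDl sumr_ge0.
apply: le_trans (ler_sum (G := fun=> M) _ _) _; first by move=> i _; exact: cM.
by rewrite big_const_seq count_predT iter_addr_0 mulr_natl.
Qed.

Lemma cvg_bsum a L : (forall A, `|a A| <= c A) -> bsum a L @ \oo --> tsum a L.
Proof.
move=> ac.
have aE : bsum a L = (fun n => bsum (fun A => Num.max (a A) 0) L n - bsum (fun A => Num.max (- a A) 0) L n).
  apply/funext => n; rewrite -bsumB; apply: eq_bigr => A _.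
  by case: (leP (a A) 0) => h; case: (leP (- a A) 0) => h'; lra.
rewrite aE; apply: cvgB; apply: (@esum_bsum _ _ (#|` L|%:R * M)).
- by move=> A; rewrite le_max lexx orbT.
- move=> n; apply: le_trans (bsum_bound L n); apply: ler_sum => A _.
  by rewrite ge_max c0 andbT (le_trans (ler_norm _)).
- by move=> A; rewrite le_max lexx orbT.
- move=> n; apply: le_trans (bsum_bound L n); apply: ler_sum => A _.
  by rewrite ge_max c0 andbT (le_trans (ler_norm _)) // normrN.
Qed.

Definition btail L n : R := tsum c L - bsum c L n.

Lemma btail_cvg0 L : btail L @ \oo --> (0 : R).
Proof.
rewrite -(subrr (tsum c L)); apply: cvgB; first exact: cvg_cst.
by apply: cvg_bsum => A; rewrite ger0_norm.
Qed.

(** The two sums agree on the sets inside the box; each of the two remainders is at most the tail of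
    [c]. *)
Lemma tsum_close a a' L n : (forall A, `|a A| <= c A) -> (forall A, `|a' A| <= c A) ->
  (forall A, (A `<=` box n)%fset -> touches L A -> a A = a' A) ->
  `|tsum a L - tsum a' L| <= btail L n *+ 2.
Proof.
move=> ac ac' e.
have cv : (fun N => `|bsum a L N - bsum a' L N|) @ \oo --> `|tsum a L - tsum a' L|.
  by apply: cvg_norm; apply: cvgB; exact: cvg_bsum.
have cvt : (fun N => (bsum c L N - bsum c L n) *+ 2) @ \oo --> btail L n *+ 2.
  apply: cvgMn; apply: cvgB; last exact: cvg_cst.
  by apply: cvg_bsum => A; rewrite ger0_norm.
apply: (ler_cvg_to cv cvt); near=> N.
have nN : (n <= N)%N by near: N; exact: nbhs_infty_ge.
have -> : bsum a L N - bsum a' L N = (bsum a L N - bsum a L n) - (bsum a' L N - bsum a' L n).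
  have -> : bsum a L n = bsum a' L n; last by ring.
  rewrite /bsum big_seq_cond [RHS]big_seq_cond; apply: eq_bigr => A.
  by rewrite fpowersetE => /andP[AB mA]; exact: e.
rewrite !bsum_tail // mulr2n; apply: le_trans (ler_normB _ _) _; apply: lerD;
by apply: le_trans (ler_norm_sum _ _ _) _; apply: ler_sum.
Unshelve. all: by end_near. Qed.

End BoxSums.

(** * The matrix exponential under the trace *)

Section KernelExponential.
Variables (R : realType) (I : finType) (b : R).
Local Notation C := (R[i]).
Implicit Types (H M P : I -> I -> C).

Lemma kbounded_entry M c s t : kbounded M c ->
  `|complex.Re (M s t)| <= c /\ `|complex.Im (M s t)| <= c.
Proof.
move=> [c0 hM]; pose v : I -> C := fun u => (u == t)%:R.
have kv : kapp M v s = M s t.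
  rewrite /kapp (bigD1 t) //= /v eqxx mulr1 big1 ?addr0 // => u /negbTE ->.
  by rewrite mulr0.
have nv : nrm2 v = 1.
  rewrite /nrm2 (bigD1 t) //= /v eqxx big1 ?addr0 => [|u /negbTE ->];
  by rewrite /cabs2 /= ?expr1n ?expr0n ?addr0.
have h : cabs2 (M s t) <= c ^+ 2.
  rewrite -kv; have := hM v; rewrite nv mulr1; apply: le_trans.
  by rewrite /nrm2 (bigD1 s) //= lerDl sumr_ge0 // => u _; exact: cabs2_ge0.
have aux (x : R) : x ^+ 2 <= c ^+ 2 -> `|x| <= c.
  by rewrite -(real_normK (num_real x)) ler_pXn2r ?nnegrE.
split; apply: aux; apply: le_trans h; rewrite /cabs2.
  by rewrite lerDl sqr_ge0.
by rewrite lerDr sqr_ge0.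
Qed.

Lemma invc_nat n : (n%:R : C)^-1 = Complex (n%:R^-1) 0.
Proof. by rewrite -[RHS]/(real_complex R n%:R^-1) fmorphV rmorph_nat. Qed.

Lemma kexp_partialE H N s t :
  kexp_partial H N s t = \sum_(0 <= k < N) Complex (k`!%:R^-1) 0 * kpow H k s t.
Proof. by rewrite big_mkord; apply: eq_bigr => k _; rewrite invc_nat. Qed.

Lemma cvg_kexp H s t :
  (fun N => complex.Re (kexp_partial H N s t)) @ \oo --> complex.Re (kexp H s t) /\
  (fun N => complex.Im (kexp_partial H N s t)) @ \oo --> complex.Im (kexp H s t).
Proof.
have [c hc] := kbounded_exists H.
have dom (u : nat -> R) : (forall n, `|u n| <= c ^+ n) ->
    cvgn (series (fun n => n`!%:R^-1 * u n)).
  move=> hu; apply: normed_cvg; apply: (@series_le_cvg _ _ (exp_coeff c)).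
  - by move=> n; exact: normr_ge0.
  - by move=> n; apply: exp_coeff_ge0; exact: hc.1.
  - move=> n; rewrite /exp_coeff /= normrM normfV normr_nat mulrC.
    by rewrite ler_wpM2r // invr_ge0.
  - exact: is_cvg_series_exp_coeff.
split.
  have -> : (fun N => complex.Re (kexp_partial H N s t)) =
    series (fun n => n`!%:R^-1 * complex.Re (kpow H n s t)).
    apply/funext => N; rewrite kexp_partialE Re_sum; apply: eq_bigr => k _.
    by rewrite cReM /= mul0r subr0.
  rewrite /kexp /= (_ : (fun N => complex.Re (kexp_partial H N s t)) =
    series (fun n => n`!%:R^-1 * complex.Re (kpow H n s t))).
    by apply: dom => n; exact: (kbounded_entry s t (kpow_bounded n hc)).1.
  apply/funext => N; rewrite kexp_partialE Re_sum; apply: eq_bigr => k _.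
  by rewrite cReM /= mul0r subr0.
have -> : (fun N => complex.Im (kexp_partial H N s t)) =
    series (fun n => n`!%:R^-1 * complex.Im (kpow H n s t)).
  apply/funext => N; rewrite kexp_partialE Im_sum; apply: eq_bigr => k _.
  by rewrite cImM /= mul0r addr0.
rewrite /kexp /= (_ : (fun N => complex.Im (kexp_partial H N s t)) =
  series (fun n => n`!%:R^-1 * complex.Im (kpow H n s t))).
  by apply: dom => n; exact: (kbounded_entry s t (kpow_bounded n hc)).2.
apply/funext => N; rewrite kexp_partialE Im_sum; apply: eq_bigr => k _.
by rewrite cImM /= mul0r addr0.
Qed.

Lemma kpow_scale H n s t :
  kpow (kscale (Complex b 0) H) n s t = Complex (b ^+ n) 0 * kpow H n s t.
Proof.
elim: n s t => [|n IH] s t; first by rewrite expr0 mul1r.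
rewrite /kpow /= -!/(kpow _ _) /kmul big_distrr /=; apply: eq_bigr => u _.
rewrite IH /kscale exprS.
have -> : Complex (b * b ^+ n) 0 = Complex b 0 * Complex (b ^+ n) 0 :> C.
  by apply: complexP; rewrite /= ?mul0r ?mulr0 ?subr0 ?addr0.
by rewrite mulrACA.
Qed.

(** Links the entrywise limit [kexp] to the series [kZ]: the real parts have the same partial sums
    up to the factor tr P, and the imaginary parts vanish since the trace of a product of two
    self-adjoint kernels is real. *)
Lemma ktrace_kexp H P : kselfadjoint H -> kprojection P -> 0 < complex.Re (ktrace P) ->
  ktrace (kmul (kexp (kscale (Complex b 0) H)) P) = Complex (complex.Re (ktrace P) * kZ P b H) 0.
Proof.
move=> Hsa Pproj trP; set A := kscale _ H.
have partE N : kexp_partial A N = fun s t => \sum_(0 <= k < N)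
    kscale (Complex (b ^+ k / k`!%:R) 0) (kpow H k) s t.
  apply/funext => s; apply/funext => t; rewrite kexp_partialE; apply: eq_bigr => k _.
  rewrite kpow_scale mulrA /kscale; congr (_ * _).
  by apply: complexP; rewrite /= ?mul0r ?mulr0 ?subr0 ?addr0 // mulrC.
have cvR : (fun N => complex.Re (ktrace (kmul (kexp_partial A N) P))) @ \oo -->
    complex.Re (ktrace (kmul (kexp A) P)).
  have E M : complex.Re (ktrace (kmul M P)) = \sum_s \sum_t
      (complex.Re (M s t) * complex.Re (P t s) - complex.Im (M s t) * complex.Im (P t s)).
    by rewrite Re_sum; apply: eq_bigr => s _; rewrite Re_sum; apply: eq_bigr => t _; rewrite cReM.
  under eq_fun do rewrite E; rewrite E; apply: cvg_rsum => s _; apply: cvg_rsum => t _.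
  have [h1 h2] := cvg_kexp A s t.
  by apply: cvgB; apply: cvgMl.
have cvI : (fun N => complex.Im (ktrace (kmul (kexp_partial A N) P))) @ \oo -->
    complex.Im (ktrace (kmul (kexp A) P)).
  have E M : complex.Im (ktrace (kmul M P)) = \sum_s \sum_t
      (complex.Re (M s t) * complex.Im (P t s) + complex.Im (M s t) * complex.Re (P t s)).
    by rewrite Im_sum; apply: eq_bigr => s _; rewrite Im_sum; apply: eq_bigr => t _; rewrite cImM.
  under eq_fun do rewrite E; rewrite E; apply: cvg_rsum => s _; apply: cvg_rsum => t _.
  have [h1 h2] := cvg_kexp A s t.
  by apply: cvgD; apply: cvgMl.
apply: complexP => /=.
  have cvZ : (fun N => complex.Re (ktrace P) * series (kZterm P b H) N) @ \oo -->
      complex.Re (ktrace P) * kZ P b H by apply: cvgMr; exact: cvg_kZ.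
  have eqN : (fun N => complex.Re (ktrace (kmul (kexp_partial A N) P))) =
      (fun N => complex.Re (ktrace P) * series (kZterm P b H) N).
    apply/funext => N; rewrite -[RHS]mulrC.
    have -> : series (kZterm P b H) N = ktau P (kexp_partial A N).
      rewrite partE ktau_sum; apply: eq_bigr => k _; by rewrite ktauZ.
    by rewrite /ktau divfK // gt_eqF.
  rewrite eqN in cvR; exact: (cvg_unique _ cvR cvZ).
have : (fun N => complex.Im (ktrace (kmul (kexp_partial A N) P))) = cst 0.
  apply/funext => N; apply: ktrace_real; last exact: Pproj.1.
  rewrite partE; apply: kselfadjoint_sum => k _ s t.
  rewrite /kscale rmorphM /= -(kpow_selfadjoint k Hsa s t); congr (_ * _).
  by apply: complexP; rewrite /= ?oppr0.
move=> e; rewrite e in cvI; exact: (cvg_unique _ cvI (@cvg_cst _ _ _ _ _)).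
Qed.

End KernelExponential.

(** * Probabilities of patterns *)

Section Patterns.
Variables (I : choiceType) (S : Type).
Implicit Types w : I -> option S.

Definition emptyk : I -> option S := fun=> None.
Definition updk w (y : I) k : I -> option S := fun z => if z == y then k else w z.
Definition fsupp (L : {fset I}) w := forall y, y \notin L -> w y = None.

End Patterns.
Arguments emptyk {I S}.

(** * Finite-volume probabilities and their limits *)

Section FiniteVolume.
Variables (R : realType) (d m : nat) (Phi : interaction R d m) (beta : R).
Arguments Phi : clear implicits.
Variables (X : 'I_m -> 'I_m -> R[i]) (x0 : R) (sp' : seq R) (Q : R -> 'I_m -> 'I_m -> R[i]).
Hypothesis hPhi : is_quantum_interaction Phi.
Hypothesis m0 : (0 < m)%N.
Hypothesis dec : spectral_decomposition X (x0 :: sp') Q.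
Local Notation C := (R[i]).
Local Notation site := (site d).
Local Notation S := (spT x0 sp').
Local Notation box := (box d).
Implicit Types (V L : {fset site}) (w : site -> option S).

(* In a pattern, [None] marks an unspecified spin. *)
Definition spproj (k : option S) : 'I_m -> 'I_m -> C :=
  if k is Some x then Q (val x) else @kone R _.

Lemma kone_selfadjoint (I : finType) : kselfadjoint (@kone R I).
Proof. by move=> s t; rewrite /kone rmorph_nat eq_sym. Qed.

Lemma kmul1k (I : finType) (M : I -> I -> C) s t : kmul (@kone R I) M s t = M s t.
Proof.
rewrite /kmul (bigD1 s) //= /kone eqxx mul1r big1 ?addr0 // => u.
by rewrite eq_sym => /negbTE ->; rewrite mul0r.
Qed.

Lemma kmulk1 (I : finType) (M : I -> I -> C) s t : kmul M (@kone R I) s t = M s t.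
Proof.
rewrite /kmul (bigD1 t) //= /kone eqxx mulr1 big1 ?addr0 // => u.
by move=> /negbTE ->; rewrite mulr0.
Qed.

Lemma proj_sa k : kselfadjoint (spproj k).
Proof.
case: k => [x|]; last exact: kone_selfadjoint.
by have [_ h _ _ _] := dec; have [] := h (val x) (ssvalP x).
Qed.

Lemma proj_id k s t : kmul (spproj k) (spproj k) s t = spproj k s t.
Proof.
case: k => [x|] /=; last exact: kmul1k.
by have [_ h _ _ _] := dec; have [_ [-> _]] := h (val x) (ssvalP x).
Qed.

Lemma ktrace_one (I : finType) : ktrace (@kone R I) = #|I|%:R.
Proof. by rewrite /ktrace /kone; under eq_bigr do rewrite eqxx; rewrite sumr_const. Qed.

Lemma Re_nat n : complex.Re (n%:R : C) = n%:R.
Proof. by rewrite raddfMn. Qed.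

Lemma proj_pos k : 0 < complex.Re (ktrace (spproj k)).
Proof.
case: k => [x|]; last by rewrite ktrace_one card_ord Re_nat ltr0n.
rewrite lt_neqAle; have [_ h _ _ _] := dec; have [sa [idq nz]] := h (val x) (ssvalP x).
have E : complex.Re (ktrace (Q (val x))) = \sum_s \sum_t cabs2 (Q (val x) t s).
  rewrite -[in LHS]idq Re_sum; apply: eq_bigr => s _; rewrite Re_sum; apply: eq_bigr => t _.
  by rewrite cReM [Q _ s t]sa Re_conjc Im_conjc /cabs2; ring.
rewrite /= E; apply/andP; split; last first.
  by apply: sumr_ge0 => s _; apply: sumr_ge0 => t _; exact: cabs2_ge0.
rewrite eq_sym psumr_eq0; last by move=> s _; apply: sumr_ge0 => t _; exact: cabs2_ge0.
apply/negP => /allP h0; apply: nz; apply/funext => t; apply/funext => s.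
have := h0 s (mem_index_enum s); rewrite /= psumr_eq0; last by move=> u _; exact: cabs2_ge0.
by move=> /allP/(_ t (mem_index_enum t)) /= /eqP; exact: cabs2_eq0.
Qed.

(** The a priori weight of a spin. Dividing by [m] gives an unspecified spin weight 1, so products
    over a volume only see the specified spins. *)
Definition qw k : R := complex.Re (ktrace (spproj k)) / m%:R.

Lemma qw_gt0 k : 0 < qw k.
Proof. by rewrite divr_gt0 ?proj_pos ?ltr0n. Qed.

Lemma qw_None : qw None = 1.
Proof. by rewrite /qw /= ktrace_one card_ord Re_nat divff // pnatr_eq0 -lt0n. Qed.

Lemma hamiltonian_selfadjoint V : kselfadjoint (hamiltonian Phi V).
Proof.
move=> s t; rewrite /hamiltonian conjc_sum big_seq [RHS]big_seq; apply: eq_bigr => A.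
rewrite fpowersetE => /fsubsetP AV.
have H (x : A) : id (val x) \in V by exact: AV _ (valP x).
by rewrite (embedE H); apply: kembed_selfadjoint; exact: hPhi.1.
Qed.

Local Notation ZV := (ZL Phi spproj (- beta)).

Definition rho V := kexp (kscale (Complex (- beta) 0) (hamiltonian Phi V)).
Definition gtr V w : C := ktrace (kmul (@rho V) (kprod (pw spproj (L := V) w))).

Lemma Re_prod (J : Type) (r : seq J) (z : J -> C) : (forall j, complex.Im (z j) = 0) ->
  complex.Re (\prod_(j <- r) z j) = \prod_(j <- r) complex.Re (z j).
Proof.
move=> h; suff : complex.Re (\prod_(j <- r) z j) = \prod_(j <- r) complex.Re (z j) /\
  complex.Im (\prod_(j <- r) z j) = 0 by case.
elim: r => [|j r [IH1 IH2]]; first by rewrite !big_nil.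
by rewrite !big_cons cReM cImM h IH1 IH2 !(mulr0,mul0r) subr0 addr0.
Qed.

Lemma gtrE V w : gtr V w = Complex ((m%:R ^+ #|` V| * \prod_(y <- V) qw (w y)) * ZV V w) 0.
Proof.
rewrite /gtr ktrace_kexp; last 3 first.
- exact: hamiltonian_selfadjoint.
- by apply: kprod_projection => y; [exact: proj_sa|exact: proj_id].
- by apply: ktrace_kprod_gt0 => y; [exact: proj_sa|exact: proj_pos].
congr (Complex (_ * _) 0).
rewrite ktrace_kprod Re_prod; last by move=> y; apply: ktrace_real1; exact: proj_sa.
rewrite /pw -(big_seq_fsetE _ V predT (fun y => complex.Re (ktrace (spproj (w y))))) /=.
have -> : m%:R ^+ #|` V| = \prod_(y <- V) m%:R :> R.
  by rewrite big_const_seq count_predT iter_mulr_1.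
rewrite -big_split; apply: eq_bigr => y _ /=.
by rewrite /qw mulrC divfK // pnatr_eq0 -lt0n.
Qed.

Lemma kprod_emptyk V : kprod (pw spproj (L := V) emptyk) = @kone R _.
Proof.
apply/funext => s; apply/funext => t; rewrite /kprod /pw /= /kone.
have [->|st] := eqVneq s t; first by rewrite big1 // => y _; rewrite eqxx.
have [y ny] : exists y, s y != t y.
  by apply/existsP; rewrite -negb_forall; apply: contra st => /forallP h; apply/eqP/ffunP => y; exact/eqP.
by rewrite (bigD1 y) //= (negbTE ny) mul0r.
Qed.

Definition pn V w : R := complex.Re (gtr V w) / complex.Re (gtr V emptyk).

Lemma sum_spT (F : R -> C) : \sum_(x : S) F (val x) = \sum_(x <- x0 :: sp') F x.
Proof.
have [us _ _ _ _] := dec.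
rewrite -(big_map val predT F) /=; apply: perm_big; apply: uniq_perm => //.
  by rewrite (map_inj_uniq val_inj) index_enum_uniq.
move=> z; apply/mapP/idP => [[x _ ->]|zs]; first exact: ssvalP.
by exists (SeqSub zs); rewrite // mem_index_enum.
Qed.

Lemma gtr_split V w y : y \in V -> w y = None ->
  gtr V w = \sum_(x : S) gtr V (updk w y (Some x)).
Proof.
move=> yV wy.
have E s t : kprod (pw spproj (L := V) w) s t =
    \sum_(x : S) kprod (pw spproj (L := V) (updk w y (Some x))) s t.
  pose y' : V := [` yV]%fset.
  rewrite /kprod (bigD1 y') //= /pw /= wy.
  have [_ _ _ dk _] := dec.
  have -> : spproj None (s y') (t y') = \sum_(x : S) Q (val x) (s y') (t y').
    by rewrite (sum_spT (fun x => Q x (s y') (t y'))) /= -dk.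
  rewrite big_distrl /=; apply: eq_bigr => x _; rewrite [RHS](bigD1 y') //=.
  rewrite /updk /= eqxx; congr (_ * _); apply: eq_bigr => z zy.
  by rewrite (_ : (val z == y) = false) //; apply/negbTE; apply: contra zy => /eqP e; apply/eqP/val_inj.
rewrite /gtr /ktrace [RHS]exchange_big /=; apply: eq_bigr => s _.
rewrite /kmul [RHS]exchange_big /=; apply: eq_bigr => t _.
by rewrite E big_distrr.
Qed.

Lemma pn_split V w y : y \in V -> w y = None ->
  pn V w = \sum_(x : S) pn V (updk w y (Some x)).
Proof. by move=> yV wy; rewrite /pn (gtr_split yV wy) Re_sum big_distrl. Qed.

Definition cfg L (xi : lconf x0 sp' L) : site -> option S :=
  fun y => if insub y is Some y' then Some (xi y') else None.

(** Unspecified sites of the pattern carry the identity, exactly as in the embedding of the product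
    of projections. *)
Lemma gibbs_stateE L (xi : lconf x0 sp' L) V : (L `<=` V)%fset ->
  gibbs_state Phi beta (embed V (Qprod Q xi)) = Complex (pn V (cfg xi)) 0.
Proof.
move=> /fsubsetP LV; have H (x : L) : id (val x) \in V by exact: LV _ (valP x).
have E : embed V (Qprod Q xi) = kprod (pw spproj (L := V) (cfg xi)).
  rewrite (embedE H); apply/funext => s; apply/funext => t; rewrite /kembed /kprod.
  pose iota : L -> V := @lmap d L V id H; rewrite -/iota.
  have cin (x : L) : cfg xi (val x) = Some (xi x) by rewrite /cfg valK.
  have cout : forall y : V, (y \notin codom iota) -> (cfg xi (val y) = None).
    move=> y yf; rewrite /cfg insubN //; apply: contra yf => yL.
    by apply/codomP; exists [` yL]%fset; exact: val_inj.
  case: ifP => [/offcodomP off|/negbT/forallPn[y]]; last first.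
    rewrite negb_imply => /andP[yf ny]; rewrite (bigD1 y) //= /pw cout //= /kone (negbTE ny).
    by rewrite mul0r.
  rewrite (bigID (fun y => y \in codom iota)) /= [X in _ * X]big1 ?mulr1; last first.
    by move=> y yf; rewrite /pw cout //= /kone off ?eqxx.
  rewrite (eq_bigl (fun y => y \in (iota @: [set: L])%SET)).
    rewrite big_imset /=; last by move=> x y _ _ /(lmap_inj (fun _ _ e => e)).
    rewrite (eq_bigl predT) => [|x]; last by rewrite finset.in_setT.
    by apply: eq_bigr => x _; rewrite /pw /= cin !ffunE.
  by move=> y; apply/codomP/imsetP => [[x ->]|[x _ ->]]; exists x; rewrite ?finset.in_setT.
have E1 : ktrace (@rho V) = gtr V emptyk.
  by rewrite /gtr kprod_emptyk; apply: eq_bigr => s _; rewrite kmulk1.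
rewrite /gibbs_state /= -/(@rho V) E -/(gtr V (cfg xi)) E1 /pn !gtrE /=.
have cdiv (a a' : R) : Complex a 0 / Complex a' 0 = Complex (a / a') 0 :> C.
  rewrite -[Complex a 0]/(real_complex R a) -[Complex a' 0]/(real_complex R a').
  by rewrite -fmorphV -rmorphM.
by rewrite cdiv.
Qed.

Variables (k s : R).
Hypothesis s0 : 0 <= s.
Hypothesis sk : s + s <= k.
Hypothesis small : forall V i, \sum_(A <- fpowerset V | i \in A)
  (expR (`|- beta| * opnorm (Phi A)) - 1) * expR k ^+ #|` A| <= s.

Local Notation phiV := (phi Phi spproj (- beta)).

Lemma ZV_gt0 V w : 0 < ZV V w.
Proof. exact: (ZL_gt0 hPhi proj_sa proj_id proj_pos None s0 sk small). Qed.

Lemma pnE V w : pn V w = (\prod_(y <- V) qw (w y)) * (ZV V w / ZV V emptyk).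
Proof.
rewrite /pn !gtrE /=; have mV : m%:R ^+ #|` V| != 0 :> R by rewrite expf_neq0 // pnatr_eq0 -lt0n.
rewrite [\prod_(y <- V) qw (emptyk y)]big1 => [|y _]; last exact: qw_None.
by field; rewrite mV gt_eqF ?ZV_gt0.
Qed.

Lemma pn_emptyk V : pn V emptyk = 1.
Proof.
rewrite pnE divff ?gt_eqF ?ZV_gt0 // mulr1 big1 // => y _; exact: qw_None.
Qed.

(** In ln Z(w) - ln Z(w') only the sets meeting [L] survive. The diverging bulk terms cancel, and
    what remains converges as the volume grows. *)
Lemma pn_ratio V L w w' : (L `<=` V)%fset -> (forall y, y \notin L -> w y = w' y) ->
  pn V w = pn V w' * (\prod_(y <- L) (qw (w y) / qw (w' y))) *
    expR (\sum_(A <- fpowerset V | touches L A) (phiV A w - phiV A w')).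
Proof.
move=> LV ww.
have -> : \sum_(A <- fpowerset V | touches L A) (phiV A w - phiV A w') = ln (ZV V w) - ln (ZV V w').
  rewrite -!sum_phi -sumrB [RHS](bigID (touches L)) /= [X in _ = _ + X]big1 ?addr0 // => A mA.
  apply/eqP; rewrite subr_eq0; apply/eqP; apply: phi_local => y yA; apply: ww.
  by apply: contra mA => yL; apply/touchesP; exists y.
have -> : \prod_(y <- L) (qw (w y) / qw (w' y)) = \prod_(y <- V) (qw (w y) / qw (w' y)).
  rewrite [RHS](bigID (fun y => y \in L)) /= [X in _ = _ * X]big1 ?mulr1; last first.
    by move=> y yL; rewrite ww // divff // gt_eqF ?qw_gt0.
  rewrite -[RHS]big_filter; apply: perm_big; apply: uniq_perm; rewrite ?filter_uniq ?fset_uniq //.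
  move=> y; rewrite mem_filter; apply/idP/andP => [yL|[]//]; split=> //; exact: (fsubsetP LV).
rewrite -ln_div ?posrE ?ZV_gt0 // lnK ?posrE ?divr_gt0 ?ZV_gt0 // !pnE.
rewrite -mulrA mulrACA -big_split /=; congr (_ * _).
  by apply: eq_bigr => y _; rewrite mulrC divfK // gt_eqF ?qw_gt0.
by field; rewrite !gt_eqF ?ZV_gt0.
Qed.

Definition cp A : R := cphi Phi spproj (- beta) None A *+ 2.

Lemma cp_ge0 A : 0 <= cp A.
Proof. by rewrite mulrn_wge0 // maxabs_ge0. Qed.

Lemma sum_cp V i : \sum_(A <- fpowerset V | i \in A) cp A <= (expR s - 1) *+ 2.
Proof.
rewrite /cp sumrMnl lerMn2r /=.
exact: (sum_cphi hPhi proj_sa proj_id proj_pos None s0 sk small).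
Qed.

Lemma phi_diff_le A w w' : `|phiV A w - phiV A w'| <= cp A.
Proof.
apply: le_trans (ler_normB _ _) _; rewrite /cp mulr2n.
by apply: lerD; exact: phi_le.
Qed.

Definition pr w : R := limn (fun n => pn (box n) w).

Lemma cvg_pn_ratio L w w' (l : R) : (forall y, y \notin L -> w y = w' y) ->
  (fun n => pn (box n) w') @ \oo --> l ->
  (fun n => pn (box n) w) @ \oo --> l * (\prod_(y <- L) (qw (w y) / qw (w' y))) *
    expR (tsum (fun A => phiV A w - phiV A w') L).
Proof.
move=> ww cv.
have : (fun n => pn (box n) w' * (\prod_(y <- L) (qw (w y) / qw (w' y))) *
    expR (bsum (fun A => phiV A w - phiV A w') L n)) @ \oo -->
    l * (\prod_(y <- L) (qw (w y) / qw (w' y))) * expR (tsum (fun A => phiV A w - phiV A w') L).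
  apply: cvgM; first by apply: cvgMl.
  apply: continuous_cvg; first exact: continuous_expR.
  apply: (cvg_bsum cp_ge0 sum_cp) => A; exact: phi_diff_le.
apply: cvg_trans; apply: near_eq_cvg; near=> n.
rewrite /bsum -pn_ratio //; near: n; exact: near_fsub_box.
Unshelve. all: by end_near. Qed.

(** Compare with the empty pattern, of probability 1 in every volume: convergence of ratios becomes
    convergence of probabilities. *)
Lemma cvg_pn L w : fsupp L w -> (fun n => pn (box n) w) @ \oo --> pr w.
Proof.
move=> wL; apply: cvgP; apply: (@cvg_pn_ratio L w emptyk 1) => //.
under eq_fun do rewrite pn_emptyk; exact: cvg_cst.
Qed.

Lemma pr_ratio V L w w' : fsupp V w' -> (forall y, y \notin L -> w y = w' y) ->
  pr w = pr w' * (\prod_(y <- L) (qw (w y) / qw (w' y))) *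
    expR (tsum (fun A => phiV A w - phiV A w') L).
Proof. by move=> wV ww; apply: cvg_lim => //; apply: cvg_pn_ratio => //; exact: cvg_pn wV. Qed.

Lemma pr_emptyk : pr emptyk = 1.
Proof. by rewrite /pr; under eq_fun do rewrite pn_emptyk; exact: lim_cst. Qed.

Lemma pr_gt0 L w : fsupp L w -> 0 < pr w.
Proof.
move=> wL; rewrite (@pr_ratio fset0 L w emptyk) // pr_emptyk mul1r mulr_gt0 ?expR_gt0 //.
by apply: prodr_gt0 => y _; rewrite divr_gt0 ?qw_gt0.
Qed.

(** The spectral projections add up to the identity; in the limit this is the consistency condition
    of Kolmogorov's theorem. *)
Lemma pr_split L w y : fsupp L w -> w y = None ->
  pr w = \sum_(x : S) pr (updk w y (Some x)).
Proof.
move=> wL wy; apply: cvg_lim => //.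
have : (fun n => \sum_(x : S) pn (box n) (updk w y (Some x))) @ \oo -->
    \sum_(x : S) pr (updk w y (Some x)).
  apply: cvg_rsum => x _; apply: (@cvg_pn (y |` L)%fset) => z.
  by rewrite !inE negb_or /updk => /andP[/negbTE -> /wL].
apply: cvg_trans; apply: near_eq_cvg; near=> n; rewrite -pn_split //.
near: n; have := near_fsub_box [fset y]%fset; apply: filterS => n.
by rewrite fsub1set.
Unshelve. all: by end_near. Qed.

End FiniteVolume.

(** * Kolmogorov extension *)

Section PatternSums.
Variables (R : realType) (I : choiceType) (S : finType).
Implicit Types (w : I -> option S) (f g : (I -> option S) -> R) (s t : seq I).

Fixpoint psum s w f : R :=
  if s is y :: s' then \sum_(x : S) psum s' (updk w y (Some x)) f else f w.

Definition filled s w w' :=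
  (forall y, y \notin s -> w' y = w y) /\ (forall y, y \in s -> w' y <> None).

Lemma eq_psum s w f g : (forall w', filled s w w' -> f w' = g w') -> psum s w f = psum s w g.
Proof.
elim: s w => [|y s IH] w h /=; first by apply: h.
apply: eq_bigr => x _; apply: IH => w' [h1 h2]; apply: h; split => z; rewrite inE.
  by rewrite negb_or => /andP[zy /h1 ->]; rewrite /updk (negbTE zy).
move=> /orP[/eqP ->|/h2//]; have [ys|/h1 ->] := boolP (y \in s); first exact: h2.
by rewrite /updk eqxx.
Qed.

Lemma psumD s w f g : psum s w (fun w => f w + g w) = psum s w f + psum s w g.
Proof. by elim: s w => //= y s IH w; rewrite -big_split; apply: eq_bigr => x _. Qed.

Lemma psumZ s w (c : R) f : psum s w (fun w => c * f w) = c * psum s w f.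
Proof. by elim: s w => //= y s IH w; rewrite big_distrr; apply: eq_bigr => x _. Qed.

Lemma psum_cat s t w f : psum (s ++ t) w f = psum s w (fun w' => psum t w' f).
Proof. by elim: s w => //= y s IH w; apply: eq_bigr => x _. Qed.

Lemma psum_ge0 s w f : (forall w', filled s w w' -> 0 <= f w') -> 0 <= psum s w f.
Proof.
elim: s w => [|y s IH] w h /=; first by apply: h.
apply: sumr_ge0 => x _; apply: IH => w' [h1 h2]; apply: h; split => z; rewrite inE.
  by rewrite negb_or => /andP[zy /h1 ->]; rewrite /updk (negbTE zy).
move=> /orP[/eqP ->|/h2//]; have [ys|/h1 ->] := boolP (y \in s); first exact: h2.
by rewrite /updk eqxx.
Qed.

Lemma le_psum s w f g : (forall w', filled s w w' -> f w' <= g w') -> psum s w f <= psum s w g.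
Proof.
move=> h; rewrite -subr_ge0 -mulN1r -psumZ -psumD; apply: psum_ge0 => w' /h.
by rewrite mulN1r subr_ge0.
Qed.

Variable pr : (I -> option S) -> R.
Hypothesis pr_split : forall (L : {fset I}) w y, fsupp L w -> w y = None ->
  pr w = \sum_(x : S) pr (updk w y (Some x)).

Lemma fsupp_updk (L : {fset I}) w y k : fsupp L w -> fsupp (y |` L)%fset (updk w y k).
Proof. by move=> h z; rewrite !inE negb_or /updk => /andP[/negbTE -> /h]. Qed.

Lemma psum_pr s (L : {fset I}) w : uniq s -> fsupp L w -> (forall y, y \in s -> w y = None) ->
  psum s w pr = pr w.
Proof.
elim: s L w => //= y s IH L w /andP[ys us] wL wN.
rewrite (pr_split wL (wN y (mem_head _ _))); apply: eq_bigr => x _.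
apply: (IH (y |` L)%fset) => //; first exact: fsupp_updk.
move=> z zs; rewrite /updk; case: eqP => [zy|_]; first by rewrite -zy zs in ys.
by apply: wN; rewrite inE zs orbT.
Qed.

(** Summing over the fillings compatible with [v]: a site left open by [v] is summed out by
    [pr_split], a site fixed by [v] keeps one term. *)
Lemma psum_compat s (L : {fset I}) w0 v : uniq s -> fsupp L w0 -> (forall y, y \in s -> w0 y = None) ->
  psum s w0 (fun w => (all (fun y => (v y == None) || (v y == w y)) s)%:R * pr w) =
  pr (fun z => if z \in s then v z else w0 z).
Proof.
elim: s L w0 => [|y s IH] L w0.
  by move=> _ _ _; rewrite /= mul1r.
move=> /andP[ys us] wL wN /=.
transitivity (\sum_(x : S) ((v y == None) || (v y == Some x))%:R *
   pr (fun z => if z \in s then v z else updk w0 y (Some x) z)).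
  apply: eq_bigr => x _; rewrite -(IH (y |` L)%fset) //; last 2 first.
  - exact: fsupp_updk.
  - move=> z zs; rewrite /updk; case: eqP => [zy|_]; first by rewrite -zy zs in ys.
    by apply: wN; rewrite inE zs orbT.
  rewrite -psumZ; apply: eq_psum => w [h _]; rewrite h // /updk eqxx.
  by rewrite mulrA -natrM mulnb.
set u := (fun z => if z \in y :: s then v z else w0 z).
have uE x z : (v y == None) || (v y == Some x) ->
    (if z \in s then v z else updk w0 y (Some x) z) = updk u y (Some x) z.
  move=> _; rewrite /updk /u inE; case: (eqVneq z y) => [->|zy] /=; first by rewrite (negbTE ys).
  by [].
case: (eqVneq (v y) None) => [vy|vy] /=.
  have uL : fsupp (L `|` [fset z in s])%fset u.
    by move=> z; rewrite !inE negb_or /u inE => /andP[zL /negbTE ->]; rewrite orbF; case: eqP => [->//|_]; exact: wL.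
  have uy : u y = None by rewrite /u mem_head.
  rewrite (pr_split uL uy); apply: eq_bigr => x _; rewrite mul1r; congr pr.
  by apply/funext => z; apply: uE; rewrite vy.
case vyE : (v y) vy => [a|//] _.
rewrite (bigD1 a) //= eqxx mul1r big1 ?addr0; last first.
  move=> x xa; rewrite (_ : (Some a == Some x) = false) ?mul0r //.
  by apply/negbTE; apply: contra xa => /eqP[->].
congr pr; apply/funext => z; rewrite uE ?vyE ?eqxx ?orbT // /updk /u inE.
by case: (eqVneq z y) => [->|//]; rewrite vyE.
Qed.

End PatternSums.

(** A second name for the configuration space, to carry the algebra of local sets beside the
    sigma-algebra generated by cylinders. *)
Definition locspace (R : realType) (d : nat) (x0 : R) (sp' : seq R) := @Omega R d x0 sp'.

Section LocalSets.
Variables (R : realType) (d : nat) (x0 : R) (sp' : seq R).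
Local Notation S := (spT x0 sp').
Local Notation site := (site d).
Local Notation box := (box d).
Local Notation T := (@locspace R d x0 sp').
Implicit Types (E F : set T) (w : site -> option S).

HB.instance Definition _ := Pointed.copy T (site -> S).

Definition locf n E := forall o o' : T, (forall y, y \in box n -> o y = o' y) -> E o -> E o'.
Definition localset E := exists n, locf n E.

Lemma locf_mono n n' E : (n <= n')%N -> locf n E -> locf n' E.
Proof. by move=> nn h o o' e; apply: h => y yn; apply: e; exact: (fsubsetP (box_mono d nn)). Qed.

Lemma locfU n E F : locf n E -> locf n F -> locf n (E `|` F).
Proof. by move=> hE hF o o' e [/(hE _ _ e)|/(hF _ _ e)]; [left|right]. Qed.

Lemma locfC n E : locf n E -> locf n (~` E).
Proof. by move=> hE o o' e nE /(hE o' o (fun y yn => esym (e y yn))). Qed.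

Lemma localset0 : localset set0. Proof. by exists 0%N. Qed.

Lemma localsetU : setU_closed localset.
Proof.
move=> E F [n hE] [n' hF]; exists (maxn n n'); apply: locfU.
  exact: locf_mono (leq_maxl _ _) hE.
exact: locf_mono (leq_maxr _ _) hF.
Qed.

Lemma localsetC : setC_closed localset.
Proof. by move=> E [n hE]; exists n; exact: locfC. Qed.

HB.instance Definition _ := @isAlgebraOfSets.Build default_measure_display T localset
  localset0 localsetU localsetC.

(* Compactness of the configuration space, through an ultrafilter limit. *)
Lemma local_compact (F : nat -> set T) : (forall n, localset (F n)) ->
  (forall n n', (n <= n')%N -> F n' `<=` F n) -> (forall n, F n !=set0) ->
  (\bigcap_n F n) !=set0.
Proof.
move=> lF decF /choice[om oF].
have [G [GU GF]] := @ultraFilterLemma nat (nbhs \oo) _.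
have GP : ProperFilter G by exact: (@ultra_proper _ _ GU).
have GFl : Filter G by exact: filter_filter.
(* The alphabet is finite: if no value of the spin at [y] were taken along the ultrafilter, all
   values would be excluded at once. *)
have ex y : exists x : S, G [set n | om n y = x].
  apply: contrapT => nex.
  have h (x : S) : \forall n \near G, om n y <> x.
    have [h|//] := @in_ultra_setVsetC nat G [set n | om n y = x] GU.
    by case: nex; exists x.
  have h' := filter_forall GFl h.
  by have [n /(_ (om n y))] := filter_ex h'.
have /choice[l lG] := ex.
exists l => n _; have [N hN] := lF n.
have hbox : \forall k \near G, forall y : box N, om k (val y) = l (val y).
  by apply: filter_forall => y; exact: lG.
have hge : \forall k \near G, (n <= k)%N by apply: GF; exact: nbhs_infty_ge.
have [k [kn kb]] := filter_ex (filterI hge hbox).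
apply: (hN (om k)); last exact: decF kn _ (oF k).
by move=> y yN; exact: (kb [` yN]%fset).
Qed.

(* Enumerates [box n] so that [sq n] is a prefix of [sq n.+1]. *)
Fixpoint sq n : seq site :=
  if n is n'.+1 then sq n' ++ [seq y <- box n'.+1 | y \notin sq n'] else box 0.

Lemma mem_sq n y : (y \in sq n) = (y \in box n).
Proof.
elim: n => //= n IH; rewrite mem_cat mem_filter IH.
have [yn|//] := boolP (y \in box n); apply/esym.
exact: (fsubsetP (box_mono d (leqnSn n))).
Qed.

Lemma sq_uniq n : uniq (sq n).
Proof.
elim: n => [|n IH]; first exact: fset_uniq.
have -> : sq n.+1 = sq n ++ [seq y <- box n.+1 | y \notin sq n] by [].
rewrite cat_uniq IH (filter_uniq _ (fset_uniq _)) andbT /=.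
by apply/hasPn => y; rewrite mem_filter => /andP[].
Qed.

Lemma sq_prefix n n' : (n <= n')%N -> exists t, sq n' = sq n ++ t.
Proof.
elim: n' => [|n' IH]; first by rewrite leqn0 => /eqP ->; exists [::]; rewrite cats0.
rewrite leq_eqVlt => /predU1P[->|]; first by exists [::]; rewrite cats0.
by rewrite ltnS => /IH[t /= ->]; eexists; rewrite -catA.
Qed.

Variable pr : (site -> option S) -> R.
Hypothesis pr_ge0 : forall L w, fsupp L w -> 0 <= pr w.
Hypothesis pr_split : forall (L : {fset site}) w y, fsupp L w -> w y = None ->
  pr w = \sum_(x : S) pr (updk w y (Some x)).
Hypothesis pr1 : pr emptyk = 1.

Definition totk w : T := fun y => odflt point (w y).

Definition nu n E : R := psum (sq n) emptyk (fun w => (`[< E (totk w) >])%:R * pr w).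

Lemma filled_sq n w : filled (sq n) emptyk w -> fsupp (box n) w.
Proof. by move=> [h _] y yn; rewrite h // mem_sq. Qed.

(** The extra sites come last in the enumeration, the event ignores them, and summing them out
    returns the smaller pattern. *)
Lemma nu_stable n n' E : (n <= n')%N -> locf n E -> nu n' E = nu n E.
Proof.
move=> nn hE; have [t st] := sq_prefix nn; rewrite /nu st psum_cat.
have ut : uniq t by have := sq_uniq n'; rewrite st cat_uniq => /and3P[].
have dt y : y \in t -> y \notin sq n.
  move=> yt; have := sq_uniq n'; rewrite st cat_uniq => /and3P[_ /hasPn h _].
  exact: h.
apply: eq_psum => w hw.
rewrite -[in RHS](psum_pr pr_split ut (filled_sq hw)); last first.
  by move=> y /dt; exact: hw.1.
rewrite -psumZ; apply: eq_psum => w' hw'; congr (_%:R * _); congr nat_of_bool.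
have e y : y \in box n -> totk w' y = totk w y.
  move=> yn; rewrite /totk hw'.1 //; apply/negP => /dt; by rewrite mem_sq yn.
by apply: asbool_equiv_eq; split; apply: hE => y /e.
Qed.

Lemma nu_ge0 n E : 0 <= nu n E.
Proof. by apply: psum_ge0 => w hw; rewrite mulr_ge0 // (pr_ge0 (filled_sq hw)). Qed.

Lemma nu0 n : nu n set0 = 0.
Proof.
rewrite /nu (@eq_psum _ _ _ _ _ _ (fun w => 0 * pr w)); first by rewrite psumZ mul0r.
by move=> w _; rewrite asboolF.
Qed.

Lemma nuT n : nu n setT = 1.
Proof.
rewrite /nu (@eq_psum _ _ _ _ _ _ pr) => [|w _]; last by rewrite asboolT ?mul1r.
by rewrite (@psum_pr _ _ _ _ pr_split _ fset0) // sq_uniq.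
Qed.

Lemma nuU n E F : E `&` F = set0 -> nu n (E `|` F) = nu n E + nu n F.
Proof.
move=> EF; rewrite /nu -psumD; apply: eq_psum => w _; rewrite -mulrDl; congr (_ * _).
have [h1|h1] := asboolP (E (totk w)); have [h2|h2] := asboolP (F (totk w)).
- by have : (E `&` F) (totk w) by []; rewrite EF.
- by rewrite asboolT ?addr0 //; left.
- by rewrite asboolT ?add0r //; right.
- by rewrite asboolF ?addr0 // => -[].
Qed.

Lemma nu_pattern n w : fsupp (box n) w ->
  nu n [set o | forall y x, w y = Some x -> o y = x] = pr w.
Proof.
move=> wn; transitivity (pr (fun z => if z \in sq n then w z else emptyk z)); last first.
  by congr pr; apply/funext => z; case: ifP => // /negbT; rewrite mem_sq => /wn ->.
rewrite -(@psum_compat _ _ _ _ pr_split _ fset0) ?sq_uniq //.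
apply: eq_psum => w' hw'; congr (_%:R * _); congr nat_of_bool.
apply/asboolP/allP => [h y ys|h y x wyx].
  case wy : (w y) => [x|//] /=; have := h y x wy; rewrite /totk.
  by have := hw'.2 y ys; case: (w' y) => [x' _ /= ->|//].
have ys : y \in sq n.
  by rewrite mem_sq; apply/negPn/negP => /wn; rewrite wyx.
by have := h y ys; rewrite wyx /= => /eqP e; rewrite /totk -e.
Qed.

(* Junk value 0 when [E] is not local. *)
Definition lvl E : nat := xget 0%N [set n | locf n E].

Lemma lvlP E : localset E -> locf (lvl E) E.
Proof. by move=> [n hn]; exact: (@xgetPex _ 0%N [set n | locf n E] (ex_intro _ n hn)). Qed.

Definition premu E : \bar R := (nu (lvl E) E)%:E.

Lemma premuE n E : locf n E -> premu E = (nu n E)%:E.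
Proof.
move=> hn; have hl := lvlP (ex_intro _ n hn).
rewrite /premu -(nu_stable (leq_maxl (lvl E) n) hl).
by rewrite (nu_stable (leq_maxr (lvl E) n) hn).
Qed.

Lemma premu0 : premu set0 = 0%E.
Proof. by rewrite (@premuE 0%N) // nu0. Qed.

Lemma premu_ge0 E : (0 <= premu E)%E.
Proof. by rewrite lee_fin nu_ge0. Qed.

Lemma premuU E F : localset E -> localset F -> E `&` F = set0 ->
  premu (E `|` F) = (premu E + premu F)%E.
Proof.
move=> [n hE] [n' hF] EF.
have h1 := locf_mono (leq_maxl n n') hE; have h2 := locf_mono (leq_maxr n n') hF.
by rewrite (premuE (locfU h1 h2)) (premuE h1) (premuE h2) nuU.
Qed.

(** By compactness a countable disjoint union of local sets that is itself local has only finitely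
    many nonempty terms: the sets left after removing the first N terms are local and decreasing
    with empty intersection. *)
Lemma premu_sigma_additive : semi_sigma_additive premu.
Proof.
move=> F mF tF mUF.
have loc_bigU N : localset (\big[setU/set0]_(i < N) F i).
  by elim/big_ind: _ => [|E E'|j _]; [exact: localset0|exact: localsetU|exact: mF].
have [N hN] : exists N, \bigcup_n F n = \big[setU/set0]_(i < N) F i.
  apply: contrapT => nex.
  pose D N := (\bigcup_n F n) `\` \big[setU/set0]_(i < N) F i.
  have [||N|o oD] := @local_compact D.
  - move=> N; rewrite /D setDE -[X in localset X]setCK setCI; apply: localsetC.
    by apply: localsetU; apply: localsetC => //; exact: localsetC.
  - move=> n n' nn o [h1 h2]; split=> // h3; apply: h2.
    by move: h3; rewrite -!bigcup_mkord => -[k /= kn Fk]; exists k => //=; exact: leq_trans kn nn.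
  - apply/set0P/negP => /eqP D0; apply: nex; exists N; apply/seteqP; split; last first.
      by move=> o; rewrite -bigcup_mkord => -[k _ Fk]; exists k.
    by move=> o ho; apply: contrapT => h; have : D N o by []; rewrite D0.
  have [[k _ Fk] _] := oD 0%N I.
  by have [_ []] := oD k.+1 I; rewrite -bigcup_mkord; exists k => //=.
have F0 n : (N <= n)%N -> F n = set0.
  move=> nN; rewrite -subset0 => o Fo.
  have : (\bigcup_n F n) o by exists n.
  rewrite hN -bigcup_mkord => -[k /= kN Fk].
  have e : k = n by apply: tF => //; exists o.
  by rewrite e ltnNge nN in kN.
have part M : (\sum_(0 <= i < M) premu (F i))%E = premu (\big[setU/set0]_(i < M) F i).
  elim: M => [|M IH]; first by rewrite big_nil big_ord0 premu0.
  rewrite big_nat_recr //= big_ord_recr /= premuU ?IH //; [exact: loc_bigU|exact: mF|].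
  rewrite -subset0 => o []; rewrite -bigcup_mkord => -[k /= kM Fk] FM.
  have e : k = M by apply: tF => //; exists o.
  by rewrite e ltnn in kM.
apply: cvg_near_cst; near=> n.
have nN : (N <= n)%N by near: n; exact: nbhs_infty_ge.
rewrite part hN; congr premu; rewrite -!bigcup_mkord; apply/seteqP; split => o [k /= kn Fk].
  exists k => //=; rewrite ltnNge; apply/negP => /F0 F0k; by rewrite F0k in Fk.
by exists k => //=; exact: leq_trans kn nN.
Unshelve. all: by end_near. Qed.

HB.instance Definition _ := isMeasure.Build _ _ _ premu
  premu0 premu_ge0 premu_sigma_additive.

Definition premeasure : {measure set T -> \bar R} := premu.

Lemma cyl_local (L : {fset site}) (xi : lconf x0 sp' L) : localset (cyl xi).
Proof.
have [n hn] := fsub_box L; exists n => o o' e h y.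
by rewrite -e ?h //; exact: (fsubsetP (hn n (leqnn n)) _ (valP y)).
Qed.

Local Notation OM := (OmegaM R d x0 sp').

Lemma sub_cylinders : <<s @cylinders R d x0 sp' >> `<=` <<s @measurable _ T >>.
Proof. by apply: sub_sigma_algebra2 => _ [L [xi ->]]; exact: cyl_local. Qed.

Definition kmu : set OM -> \bar R := measure_extension premeasure.

Lemma kmu0 : kmu set0 = 0%E. Proof. exact: measure0. Qed.

Lemma kmu_ge0 A : (0 <= kmu A)%E.
Proof. by rewrite /kmu; apply: measure_ge0. Qed.

(** The extension is a measure on the sigma-algebra generated by local sets, which contains the one
    generated by cylinders. *)
Lemma kmu_sigma_additive : semi_sigma_additive kmu.
Proof.
move=> F mF tF mUF.
apply: (@measure_semi_sigma_additive _ _ _ (measure_extension premeasure) F) => //.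
  by move=> i; apply: sub_cylinders; exact: mF.
by apply: sub_cylinders; exact: mUF.
Qed.

HB.instance Definition _ := isMeasure.Build _ _ _ kmu kmu0 kmu_ge0 kmu_sigma_additive.

Lemma kmu_local n E : locf n E -> kmu E = (nu n E)%:E.
Proof.
move=> hn; rewrite /kmu /measure_extension measurable_mu_extE; last by exists n.
exact: premuE.
Qed.

Lemma kmuT : kmu setT = 1%E.
Proof. by rewrite (@kmu_local 0%N) // nuT. Qed.

HB.instance Definition _ := Measure_isProbability.Build _ _ _ kmu kmuT.

Lemma kolmogorov_extension : exists mu : probability OM R,
  forall L w, fsupp L w -> mu [set o | forall y x, w y = Some x -> o y = x] = (pr w)%:E.
Proof.
exists (kmu : probability OM R) => L w wL; have [n hn] := fsub_box L.
have wn : fsupp (box n) w.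
  by move=> y yn; apply: wL; apply: contra yn; exact: (fsubsetP (hn n (leqnn n))).
rewrite -(nu_pattern wn); apply: kmu_local => o o' e h y x wyx.
rewrite -e ?(h _ _ wyx) //; apply/negPn/negP => /wn; by rewrite wyx.
Qed.

End LocalSets.

(** * DLR equations *)

Lemma sum_expR_gt0 (R : realType) (J : finType) (a : J -> R) (j : J) : 0 < \sum_i expR (a i).
Proof. by rewrite (bigD1 j) //= ltr_pwDl ?expR_gt0 // sumr_ge0 // => i _; exact: expR_ge0. Qed.

(** One factor e^t comes from the numerator and one from the partition function. *)
Lemma boltzmann_close (R : realType) (J : finType) (a b : J -> R) (t : R) (j : J) :
  (forall i, `|a i - b i| <= t) ->
  expR (- a j) / (\sum_i expR (- a i)) <=
  expR (t *+ 2) * (expR (- b j) / (\sum_i expR (- b i))).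
Proof.
move=> h.
have pos (c : J -> R) : 0 < \sum_i expR (- c i) := sum_expR_gt0 _ j.
rewrite ler_pdivrMr ?pos // mulrAC mulrA.
have h1 : expR (- a j) <= expR t * expR (- b j).
  by rewrite -expRD ler_expR; have := h j; rewrite ler_norml => /andP[]; lra.
have h2 : \sum_i expR (- b i) <= expR t * \sum_i expR (- a i).
  rewrite big_distrr /=; apply: ler_sum => i _; rewrite -expRD ler_expR.
  by have := h i; rewrite ler_norml => /andP[]; lra.
rewrite ler_pdivlMr ?pos // mulr2n expRD.
apply: le_trans (ler_pM _ _ h1 h2) _; rewrite ?expR_ge0 //; first exact: ltW.
by rewrite le_eqVlt; apply/orP; left; apply/eqP; ring.
Qed.

Section DLR.
Variables (R : realType) (d : nat) (x0 : R) (sp' : seq R).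
Local Notation S := (spT x0 sp').
Local Notation site := (site d).
Local Notation box := (box d).
Local Notation OM := (OmegaM R d x0 sp').
Implicit Types (w : site -> option S) (L V : {fset site}) (o : @Omega R d x0 sp').

Definition pset w : set OM := [set o | forall y x, w y = Some x -> o y = x].

Definition merge L (xi : lconf x0 sp' L) w : site -> option S :=
  fun y => if insub y is Some y' then Some (xi y') else w y.

Lemma merge_in L (xi : lconf x0 sp' L) w (y : L) : merge xi w (val y) = Some (xi y).
Proof. by rewrite /merge valK. Qed.

Lemma merge_out L (xi : lconf x0 sp' L) w y : y \notin L -> merge xi w y = w y.
Proof. by move=> yL; rewrite /merge insubN. Qed.

Lemma glueE L (xi : lconf x0 sp' L) o : Some \o Defs.glue xi o = merge xi (Some \o o).
Proof. by apply/funext => y; rewrite /= /Defs.glue /merge; case: insub. Qed.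

Lemma fsupp_merge L V (xi : lconf x0 sp' L) w : fsupp V w -> fsupp (L `|` V)%fset (merge xi w).
Proof. by move=> h y; rewrite inE negb_or => /andP[yL yV]; rewrite merge_out // h. Qed.

Lemma cylE L (xi : lconf x0 sp' L) : cyl xi = pset (merge xi emptyk).
Proof.
apply/seteqP; split => o h.
  move=> y x; have [yL|yL] := boolP (y \in L); last by rewrite merge_out.
  by rewrite -[y]/(val [` yL]%fset) merge_in => -[<-]; exact: h.
by move=> y; apply: h; rewrite merge_in.
Qed.

Lemma measurable_local n (E : set OM) : locf n E -> measurable E.
Proof.
move=> hE; pose F (xi : lconf x0 sp' (box n)) : set OM :=
  if `[< E (Defs.glue xi (fun=> point)) >] then cyl xi else set0.
have -> : E = \bigcup_(xi in [set: lconf x0 sp' (box n)]) F xi.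
  apply/seteqP; split => o.
    move=> Eo; exists [ffun y : box n => o (val y)] => //; rewrite /F asboolT.
      by move=> y; rewrite ffunE.
    by apply: hE Eo => y yn; rewrite /Defs.glue insubT /= ffunE.
  move=> [xi _]; rewrite /F; case: asboolP => // Ex ox.
  by apply: hE Ex => y yn; rewrite /Defs.glue insubT /= -ox.
apply: fin_bigcup_measurable; first exact: finite_finset.
move=> xi _; rewrite /F; case: ifP => _ //.
by apply: sub_sigma_algebra; exists (box n), xi.
Qed.

Lemma pset_local n w : fsupp (box n) w -> locf n (pset w).
Proof.
move=> wn o o' e h y x wyx; rewrite -e ?(h _ _ wyx) //.
by apply/negPn/negP => /wn; rewrite wyx.
Qed.

Lemma fsupp_mono L V w : (L `<=` V)%fset -> fsupp L w -> fsupp V w.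
Proof. by move=> /fsubsetP LV h y yV; apply: h; apply: contra yV; exact: LV. Qed.

Lemma measurable_pset L w : fsupp L w -> measurable (pset w).
Proof.
move=> wL; have [n hn] := fsub_box L; apply: (@measurable_local n); apply: pset_local.
exact: fsupp_mono (hn n (leqnn n)) wL.
Qed.

Variable mu : probability OM R.

Lemma integral_partition (J : finType) (F : J -> set OM) (D : set OM) (f : OM -> \bar R) :
  (forall j, measurable (F j)) -> trivIset setT F -> D = \bigcup_j F j ->
  measurable_fun [set: OM] f -> (forall o, 0 <= f o)%E ->
  (\int[mu]_(o in D) f o = \sum_(j : J) \int[mu]_(o in F j) f o)%E.
Proof.
move=> mF tF DE mf f0.
have -> : D = \big[setU/set0]_(j <- index_enum J) F j.
  rewrite DE -bigcup_seq; apply: eq_bigcupl; split => j //= _.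
  exact: mem_index_enum.
apply: ge0_integral_bigsetU => //; first exact: index_enum_uniq.
- exact: sub_trivIset tF.
- exact: measurable_funTS.
Qed.

Definition pint (f : OM -> R) w : R := fine (\int[mu]_(o in pset w) (f o)%:E).

Section PatternIntegrals.
Variable f : OM -> R.
Hypothesis mf : measurable_fun [set: OM] f.
Hypothesis f01 : forall o, 0 <= f o <= 1.

Lemma measurable_integrand : measurable_fun [set: OM] (fun o : OM => (f o)%:E).
Proof. exact/measurable_EFinP. Qed.

Lemma integrand_ge0 o : (0 <= (f o)%:E)%E.
Proof. by rewrite lee_fin; case/andP: (f01 o). Qed.

Lemma integral01_fin D : measurable D -> (\int[mu]_(o in D) (f o)%:E \is a fin_num)%E.
Proof.
move=> mD; rewrite ge0_fin_numE; last by apply: integral_ge0 => o _; exact: integrand_ge0.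
apply: (@le_lt_trans _ _ (\int[mu]_(o in D) cst 1%E o)%E).
  apply: ge0_le_integral => //.
  - by move=> o _; exact: integrand_ge0.
  - by apply: measurable_funTS; exact: measurable_integrand.
  - by move=> o _ /=; rewrite lee_fin; case/andP: (f01 o).
rewrite integral_cst // mul1e; apply: le_lt_trans (probability_le1 mu mD) _.
exact: ltry.
Qed.

Lemma pintE L w : fsupp L w -> (\int[mu]_(o in pset w) (f o)%:E = (pint f w)%:E)%E.
Proof. by move=> wL; rewrite /pint fineK // integral01_fin //; exact: measurable_pset wL. Qed.

(** The same consistency as for [pr], so that [psum_pr] can also refine an integral over a pattern
    event into fuller patterns. *)
Lemma pint_split L w y : fsupp L w -> w y = None ->
  pint f w = \sum_(x : S) pint f (updk w y (Some x)).
Proof.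
move=> wL wy; have wLx x : fsupp (y |` L)%fset (updk w y (Some x)) by exact: fsupp_updk.
apply: EFin_inj; rewrite -sumEFin -(pintE wL).
rewrite (@integral_partition _ (fun x : S => pset (updk w y (Some x)))).
- by apply: eq_bigr => x _; rewrite (pintE (wLx x)).
- by move=> x; exact: measurable_pset (wLx x).
- move=> x x' _ _ [u [/(_ y x) h /(_ y x') h']].
  by rewrite -h ?h' // /updk eqxx.
- apply/seteqP; split => o h.
    exists (o y) => // z x; rewrite /updk; case: eqP => [->[]//|_]; exact: h.
  have [x _ hx] := h => z x' wz; apply: hx; rewrite /updk; case: eqP => [zy|//].
  by rewrite -zy wz in wy.
- exact: measurable_integrand.
- exact: integrand_ge0.
Qed.

End PatternIntegrals.

Lemma measurable_cyl L (xi : lconf x0 sp' L) : measurable (cyl xi : set OM).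
Proof. by apply: sub_sigma_algebra; exists L, xi. Qed.

Variables (pr : (site -> option S) -> R) (PsiK : {fset site} -> (site -> option S) -> R).
Variables (cK : {fset site} -> R) (M : R).
Hypothesis muE : forall L w, fsupp L w -> mu (pset w) = (pr w)%:E.
Hypothesis PsiK_local : forall A w w', (forall y, y \in A -> w y = w' y) -> PsiK A w = PsiK A w'.
Hypothesis PsiK_le : forall A w, `|PsiK A w| <= cK A.
Hypothesis cK0 : forall A, 0 <= cK A.
Hypothesis cKM : forall V i, \sum_(A <- fpowerset V | i \in A) cK A <= M.
Hypothesis pr_gibbs : forall V L w w', fsupp V w' -> (forall y, y \notin L -> w y = w' y) ->
  pr w = pr w' * expR (tsum (PsiK^~ w') L - tsum (PsiK^~ w) L).

Local Notation en L w := (tsum (PsiK^~ w) L).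

Definition Psi A o : R := PsiK A (Some \o o).

Lemma energyE L o : energy Psi L o = en L (Some \o o).
Proof. by []. Qed.

Definition pker L (xi : lconf x0 sp' L) w : R :=
  expR (- en L (merge xi w)) / \sum_(zeta : lconf x0 sp' L) expR (- en L (merge zeta w)).

Lemma gibbs_kernelE L (xi : lconf x0 sp' L) o : gibbs_kernel Psi xi o = pker xi (Some \o o).
Proof.
rewrite /gibbs_kernel /pker energyE glueE; congr (_ / _).
by apply: eq_bigr => zeta _; rewrite energyE glueE.
Qed.

Lemma pker01 L (xi : lconf x0 sp' L) w : 0 <= pker xi w <= 1.
Proof.
have h0 : 0 < \sum_(zeta : lconf x0 sp' L) expR (- en L (merge zeta w)) by exact: sum_expR_gt0 xi.
rewrite divr_ge0 ?expR_ge0 ?(ltW h0) //= ler_pdivrMr // mul1r (bigD1 xi) //= lerDl.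
by apply: sumr_ge0 => z _; exact: expR_ge0.
Qed.

Lemma pr_merge_sum L V w : fsupp V w -> (forall y, y \in L -> w y = None) ->
  pr w = \sum_(zeta : lconf x0 sp' L) pr (merge zeta w).
Proof.
move=> wV wL; apply: EFin_inj; rewrite -sumEFin -(muE wV).
have mT (A : set OM) : measurable A -> (\int[mu]_(o in A) cst 1%E o = mu A)%E.
  by move=> mA; rewrite integral_cst // mul1e.
have mw := measurable_pset wV.
have mz zeta : measurable (pset (@merge L zeta w)).
  by apply: measurable_pset (fsupp_merge zeta wV).
rewrite -mT // (@integral_partition _ (fun zeta : lconf x0 sp' L => pset (merge zeta w))) //.
- by apply: eq_bigr => zeta _; rewrite mT // (muE (fsupp_merge zeta wV)).
- move=> z z' _ _ [u [h h']]; apply/ffunP => y.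
  by rewrite -(h (val y) (z y)) ?merge_in // -(h' (val y) (z' y)) ?merge_in.
- apply/seteqP; split => o h.
    exists [ffun y : L => o (val y)] => // y x; have [yL|yL] := boolP (y \in L).
      by rewrite -[y]/(val [` yL]%fset) merge_in ffunE => -[].
    rewrite merge_out //; exact: h.
  have [z _ hz] := h => y x wy; apply: hz; rewrite merge_out //.
  by apply/negP => /wL; rewrite wy.
Qed.

(** An exact identity at finite level: [pr_gibbs] compares all fillings of [L] with the same
    partially specified outside, and normalisation over the fillings gives the Boltzmann ratio. *)
Lemma pr_pker L V (xi : lconf x0 sp' L) w : fsupp V w -> (forall y, y \in L -> w y = None) ->
  pr (merge xi w) = pr w * pker xi w.
Proof.
move=> wV wL; rewrite /pker.
have E zeta : pr (@merge L zeta w) = pr (merge xi w) * expR (en L (merge xi w)) * expR (- en L (merge zeta w)).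
  rewrite -mulrA -expRD; apply: (pr_gibbs (fsupp_merge xi wV)) => y yL.
  by rewrite !merge_out.
have Z0 : 0 < \sum_(zeta : lconf x0 sp' L) expR (- en L (merge zeta w)).
  exact: sum_expR_gt0 xi.
rewrite [in RHS](pr_merge_sum wV wL); under [in RHS]eq_bigr do rewrite E.
rewrite -big_distrr /= -[pr _ * expR _ * _]mulrA [X in X = _]/= .
set Z := (\sum_i _) in Z0 *.
have e1 : expR (en L (merge xi w)) * expR (- en L (merge xi w)) = 1 by rewrite -expRD subrr expR0.
rewrite -!mulrA [Z * _]mulrC divfK ?gt_eqF // e1 mulr1 //.
Qed.

(** Sets inside the box have equal terms, so the energies differ by at most twice the tail;
    [boltzmann_close] doubles this once more. *)
Lemma pker_close n L (xi : lconf x0 sp' L) w w' :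
  (forall y, y \in box n -> y \notin L -> w y = w' y) ->
  pker xi w <= expR (btail cK L n *+ 2 *+ 2) * pker xi w'.
Proof.
move=> ww; apply: (@boltzmann_close _ _ (fun z => en L (merge z w)) (fun z => en L (merge z w'))) => z.
apply: (tsum_close cK0 cKM) => // A /fsubsetP An _; apply: PsiK_local => y yA.
have [yL|yL] := boolP (y \in L); last by rewrite !merge_out // ww // An.
by rewrite -[y]/(val [` yL]%fset) !merge_in.
Qed.

Lemma pker_cvg L (xi : lconf x0 sp' L) (w_ : nat -> site -> option S) w :
  (forall n y, y \in box n -> w_ n y = w y) -> (fun n => pker xi (w_ n)) @ \oo --> pker xi w.
Proof.
move=> h.
have cv z : (fun n => en L (@merge L z (w_ n))) @ \oo --> en L (merge z w).
  apply/cvgrPdist_lt => e e0; near=> n; rewrite distrC.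
  apply: (@le_lt_trans _ _ (btail cK L n *+ 2)).
    apply: (tsum_close cK0 cKM) => // A /fsubsetP An _; apply: PsiK_local => y yA.
    have [yL|yL] := boolP (y \in L); last by rewrite !merge_out // h // An.
    by rewrite -[y]/(val [` yL]%fset) !merge_in.
  near: n; have c2 : (fun n => btail cK L n *+ 2) @ \oo --> (0 : R).
    by rewrite -(mul0rn _ 2); apply: cvgMn; exact: (btail_cvg0 cK0 cKM).
  exact: (cvgr_lt 0 c2 e e0).
have cve z : (fun n => expR (- en L (@merge L z (w_ n)))) @ \oo --> expR (- en L (merge z w)).
  by apply: continuous_cvg; [exact: continuous_expR|exact: cvgN].
apply: cvgM => //; apply: cvgV; last by apply: cvg_rsum => z _.
by rewrite gt_eqF //; exact: sum_expR_gt0 xi.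
Unshelve. all: by end_near. Qed.

(** The kernel is the pointwise limit of its values at configurations reset to [point] off a box,
    each of which depends on finitely many spins. *)
Lemma measurable_gibbs_kernel L (xi : lconf x0 sp' L) :
  measurable_fun [set: OM] (gibbs_kernel Psi xi : OM -> R).
Proof.
pose trunc n o : @Omega R d x0 sp' := fun y => if y \in box n then o y else point.
apply: (@measurable_fun_cvg _ OM R setT (fun n o => gibbs_kernel Psi xi (trunc n o))).
  move=> n _ A mA; rewrite setTI; apply: (@measurable_local n) => o o' e /=.
  suff -> : trunc n o = trunc n o' by [].
  by apply/funext => y; rewrite /trunc; case: ifP => // /e.
move=> o _; rewrite gibbs_kernelE; under eq_fun do rewrite gibbs_kernelE.
by apply: pker_cvg => n y yn; rewrite /= /trunc yn.
Qed.

Lemma gibbs_kernel01 L (xi : lconf x0 sp' L) o : 0 <= gibbs_kernel Psi xi o <= 1.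
Proof. by rewrite gibbs_kernelE pker01. Qed.

Local Notation ind xi := (\1_(cyl xi) : OM -> R).

Lemma ind01 L (xi : lconf x0 sp' L) o : 0 <= ind xi o <= 1.
Proof. by rewrite indicE; case: (_ \in _); rewrite ?lexx ?ler01. Qed.

Lemma measurable_ind L (xi : lconf x0 sp' L) : measurable_fun [set: OM] (ind xi).
Proof. by apply: measurable_indic; exact: measurable_cyl. Qed.

Lemma pint_ind L V (xi : lconf x0 sp' L) w : fsupp V w -> (forall y, y \in L -> w y = None) ->
  pint (ind xi) w = pr (merge xi w).
Proof.
move=> wV wL; rewrite /pint integral_indic; last 2 first.
- exact: measurable_pset wV.
- exact: measurable_cyl.
rewrite (_ : _ `&` _ = pset (merge xi w)); first by rewrite [X in fine X](muE (fsupp_merge xi wV)).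
apply/seteqP; split => o.
  move=> [h1 h2] y x; have [yL|yL] := boolP (y \in L); last by rewrite merge_out //; exact: h2.
  by rewrite -[y]/(val [` yL]%fset) merge_in => -[<-].
move=> h; split; first by move=> y; apply: h; rewrite merge_in.
by move=> y x wy; apply: h; rewrite merge_out //; apply/negP => /wL; rewrite wy.
Qed.

(** On the event of [w] the box is fixed outside [L], so the kernel is close to the constant
    [pker xi w]; by [pr_pker] this constant is exactly the conditional probability of [xi]. *)
Lemma pint_close n L V (xi : lconf x0 sp' L) w : fsupp V w ->
  (forall y, y \in L -> w y = None) -> (forall y, y \in box n -> y \notin L -> w y <> None) ->
  pint (gibbs_kernel Psi xi) w <= expR (btail cK L n *+ 2 *+ 2) * pint (ind xi) w /\
  pint (ind xi) w <= expR (btail cK L n *+ 2 *+ 2) * pint (gibbs_kernel Psi xi) w.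
Proof.
move=> wV wL wn; rewrite (pint_ind xi wV wL) (pr_pker xi wV wL).
set t := expR _; have mw := measurable_pset wV.
have agr o : pset w o -> forall y, y \in box n -> y \notin L -> (Some \o o) y = w y.
  move=> ow y yn yL; have := wn y yn yL; case wy : (w y) => [x|//] _ /=.
  by rewrite (ow _ _ wy).
have mg := measurable_gibbs_kernel xi; have g01 := gibbs_kernel01 xi.
have cst_int (c : R) : 0 <= c -> (\int[mu]_(o in pset w) cst c%:E o = (c * pr w)%:E)%E.
  by move=> c0; rewrite integral_cst // EFinM; congr (_ * _)%E; exact: (muE wV).
have p01 := pker01 xi w; have p0 : 0 <= pker xi w by case/andP: p01.
have t0 : 0 <= t by exact: expR_ge0.
have mtg : measurable_fun [set: OM] (fun o : OM => (t * gibbs_kernel Psi xi o)%:E).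
  by apply/measurable_EFinP; exact: measurable_funM.
split; rewrite -lee_fin; last first.
  rewrite [(t * _)%:E]EFinM -(pintE mg g01 wV) -ge0_integralZl_EFin //; last 2 first.
  - by move=> o _; rewrite lee_fin; case/andP: (g01 o).
  - by apply/measurable_funTS/measurable_EFinP.
  rewrite mulrC -cst_int //; apply: ge0_le_integral => //.
  - exact: measurable_funTS mtg.
  - by move=> o ow; rewrite lee_fin gibbs_kernelE; apply: pker_close => y yn yL; rewrite agr.
rewrite -(pintE mg g01 wV) [pr w * _]mulrC mulrA -(cst_int _ (mulr_ge0 t0 p0)).
apply: ge0_le_integral => //.
- by move=> o _; rewrite lee_fin; case/andP: (g01 o).
- by apply/measurable_funTS/measurable_EFinP.
- by move=> o ow; rewrite lee_fin gibbs_kernelE; apply: pker_close => y yn yL; rewrite agr.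
Qed.

Lemma pint_eq L V (xi : lconf x0 sp' L) w : fsupp V w -> (forall y, y \in L -> w y = None) ->
  pint (ind xi) w = pint (gibbs_kernel Psi xi) w.
Proof.
move=> wV wL.
have mg := measurable_gibbs_kernel xi; have g01 := gibbs_kernel01 xi.
have mi := measurable_ind xi; have i01 := ind01 xi.
have cl n : pint (gibbs_kernel Psi xi) w <= expR (btail cK L n *+ 2 *+ 2) * pint (ind xi) w /\
  pint (ind xi) w <= expR (btail cK L n *+ 2 *+ 2) * pint (gibbs_kernel Psi xi) w.
  (* Sites of the box outside [L] still open in [w]: both integrals are split over their fillings,
     each filling is compared, and then n grows. *)
  pose s := [seq y <- box n | (y \notin L) && (w y == None)].
  have us : uniq s by rewrite filter_uniq ?fset_uniq.
  have wN y : y \in s -> w y = None by rewrite mem_filter => /andP[/andP[_ /eqP]].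
  have fil w' : filled s w w' -> [/\ fsupp (V `|` box n)%fset w', (forall y, y \in L -> w' y = None)
      & (forall y, y \in box n -> y \notin L -> w' y <> None)].
    move=> [h1 h2]; split.
    - move=> y; rewrite inE negb_or => /andP[yV yn].
      by rewrite h1 ?wV // mem_filter (negbTE yn) andbF.
    - by move=> y yL; rewrite h1 ?wL // mem_filter yL.
    - move=> y yn yL; have [ys|ys] := boolP (y \in s); first exact: h2.
      by rewrite h1 //; move: ys; rewrite mem_filter yn yL andbT /= => /eqP.
  rewrite -(psum_pr (pint_split mg g01) us wV wN) -(psum_pr (pint_split mi i01) us wV wN).
  rewrite -!psumZ; split; apply: le_psum => w' /fil[h1 h2 h3].
    by have [] := pint_close xi h1 h2 h3.
  by have [] := pint_close xi h1 h2 h3.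
have cv (a : R) : (fun n => expR (btail cK L n *+ 2 *+ 2) * a) @ \oo --> a.
  rewrite -[X in _ --> X]mul1r -expR0; apply: cvgMl; apply: continuous_cvg; first exact: continuous_expR.
  rewrite -(mul0rn _ 2); apply: cvgMn; rewrite -(mul0rn _ 2); apply: cvgMn.
  exact: (btail_cvg0 cK0 cKM).
apply/eqP; rewrite eq_le; apply/andP; split.
  apply: (ler_cvg_to (cvg_cst _) (cv _)); apply: nearW => n; exact: (cl n).2.
by apply: (ler_cvg_to (cvg_cst _) (cv _)); apply: nearW => n; exact: (cl n).1.
Qed.

(** The empty set is included because incompatible patterns have disjoint events; this makes the
    class stable under intersection. *)
Definition outgen L : set (set OM) :=
  [set E | E = set0 \/ exists V w, [/\ fsupp V w, (forall y, y \in L -> w y = None) & E = pset w]].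

Lemma outgen_setI L : setI_closed (outgen L).
Proof.
move=> E F [->|[V [w [wV wL ->]]]]; first by rewrite set0I; left.
move=> [->|[V' [w' [wV' wL' ->]]]]; first by rewrite setI0; left.
have [[y ny]|h] := pselect (exists y, (if (w y, w' y) is (Some x, Some x') then x != x' else false)).
  left; rewrite -subset0 => o [/(_ y) h1 /(_ y) h2]; move: ny.
  case wy : (w y) => [x|//]; case wy' : (w' y) => [x'|//].
  by rewrite -(h1 _ wy) -(h2 _ wy') eqxx.
right; exists (V `|` V')%fset, (fun y => if w y is Some x then Some x else w' y); split.
- by move=> y; rewrite inE negb_or => /andP[yV yV']; rewrite wV // wV'.
- by move=> y yL; rewrite wL // wL'.
apply/seteqP; split => o.
  move=> [h1 h2] y x; case wy : (w y) => [x'|]; last exact: h2.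
  by move=> -[<-]; exact: h1.
move=> h3; split => y x wy; first by apply: h3; rewrite wy.
have := h3 y; case wy' : (w y) => [x'|]; last by apply.
move=> /(_ _ erefl) ->; have [//|xx] := eqVneq x' x.
by case: h; exists y; rewrite wy wy'.
Qed.

Lemma outgen_measurable L E : outgen L E -> measurable E.
Proof. by move=> [->//|[V [w [wV _ ->]]]]; exact: measurable_pset wV. Qed.

Lemma dlr L (xi : lconf x0 sp' L) (E : set OM) : outside_sigma L E ->
  (mu (cyl xi `&` E) = \int[mu]_(o in E) (gibbs_kernel Psi xi o)%:E)%E.
Proof.
have mg := measurable_gibbs_kernel xi; have g01 := gibbs_kernel01 xi.
have mgE := measurable_integrand mg; have g0E := integrand_ge0 g01.
have mc := measurable_cyl xi.
pose P : set (set OM) := [set F : set OM | measurable F /\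
  (mu (cyl xi `&` F) = \int[mu]_(o in F) (gibbs_kernel Psi xi o)%:E)%E].
suff sub : outside_sigma L `<=` P by move=> /sub[].
have gP : outgen L `<=` P.
  move=> F gF; split; first exact: outgen_measurable gF.
  case: gF => [->|[V [w [wV wL ->]]]]; first by rewrite setI0 measure0 integral_set0.
  rewrite (pintE mg g01 wV) -(pint_eq xi wV wL) -(pintE (measurable_ind xi) (ind01 xi) wV).
  by rewrite integral_indic //; exact: measurable_pset wV.
have PT : P setT.
  apply: gP; right; exists fset0, emptyk; split => //.
  by apply/seteqP; split.
have dP : dynkin P.
  split => //.
  (* Complements: the identity for [F] is subtracted from the one for the whole space, which is
     legitimate because its mass is finite. *)
  - move=> F [mF eF]; split; first exact: measurableC.
    have h : (\int[mu]_(o in F) (gibbs_kernel Psi xi o)%:E +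
              \int[mu]_(o in ~` F) (gibbs_kernel Psi xi o)%:E =
              mu (cyl xi `&` F) + mu (cyl xi `&` ~` F))%E.
      rewrite -ge0_integral_setU //; last 3 first.
      - exact: measurableC.
      - exact: measurable_funTS.
      - by apply/disj_setPS => o [].
      - rewrite setUv -PT.2 setIT -measureU //; last 3 first.
        + exact: measurableI.
        + by apply: measurableI => //; exact: measurableC.
        + by rewrite setIACA setICr setI0.
        by rewrite -setIUr setUv setIT.
    have fF : mu (cyl xi `&` F) \is a fin_num by rewrite fin_num_measure //; exact: measurableI.
    move: h; rewrite -eF ![(mu (cyl xi `&` F) + _)%E]addeC => /(congr1 (fun z => z - mu (cyl xi `&` F))%E).
    by rewrite !addeK.
  - move=> F tF PF; split; first by apply: bigcup_measurable => k _; case: (PF k).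
    rewrite ge0_integral_bigcup //; last 2 first.
    + by move=> k; case: (PF k).
    + exact: measurable_funTS.
    rewrite setI_bigcupr measure_bigcup //; last 2 first.
    + by move=> k _; apply: measurableI => //; case: (PF k).
    + exact: trivIset_setIl.
    transitivity (\sum_(0 <= k <oo) mu (cyl xi `&` F k))%E; first by apply: eq_eseriesl => k; exact: mem_set.
    by apply: eq_eseriesr => k _; case: (PF k).
(* Cylinders away from [L] are pattern events open on [L], so it suffices to treat the sigma-algebra
   generated by [outgen L], which is also its Dynkin class. *)
rewrite /outside_sigma.
apply: (@subset_trans _ <<s outgen L >>).
  apply: sub_sigma_algebra2 => _ [L' [z [LL ->]]]; right.
  exists L', (merge z emptyk); split; last exact: cylE.
    by move=> y yL; rewrite merge_out.
  move=> y yL; rewrite merge_out //; apply/negP => yL'.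
  by have := in_fset0 y; rewrite -LL inE yL yL'.
rewrite -(setI_closed_g_dynkin_g_sigma_algebra (@outgen_setI L)).
exact: smallest_sub.
Qed.

End DLR.

(** * One-body terms and sums over sets through a site *)

Section Sums.
Variables (R : realType) (d : nat).
Local Notation site := (site d).

(** Allows single-site weights to be stored in the potential as terms on singletons. *)
Lemma single_site_sum (g : site -> R) (L V : {fset site}) : (L `<=` V)%fset ->
  \sum_(A <- fpowerset V | touches L A) (if #|` A| == 1%N then \sum_(y <- A) g y else 0) =
  \sum_(y <- L) g y.
Proof.
move=> /fsubsetP LV; rewrite -big_mkcondr /= -[LHS]big_filter.
transitivity (\sum_(A <- [seq [fset y]%fset | y <- enum_fset L]) \sum_(y <- A) g y); last first.
  by rewrite big_map; apply: eq_bigr => y _; rewrite big_seq_fset1.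
apply: perm_big; apply: uniq_perm.
- by rewrite filter_uniq ?fset_uniq.
- by rewrite map_inj_uniq ?fset_uniq // => x y /fset1_inj.
move=> A; rewrite mem_filter fpowersetE; apply/idP/mapP => [/andP[/andP[/touchesP[y yA yL]]]|[y yL ->]].
  move=> /cardfs1P[z zA] _; exists y => //; move: yA; rewrite zA inE => /eqP ->.
  by [].
rewrite cardfs1 eqxx fsub1set LV // !andbT; apply/touchesP; exists y => //.
by rewrite inE.
Qed.

Lemma sum_single_site_le (V : {fset site}) i (c : R) : 0 <= c ->
  \sum_(A <- fpowerset V | i \in A) (#|` A| == 1%N)%:R * c <= c.
Proof.
move=> c0.
apply: (@le_trans _ _ (\sum_(A <- fpowerset V | A == [fset i]%fset) c)); last first.
  rewrite big_const_seq iter_addr_0 (count_uniq_mem _ (fset_uniq _)).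
  by case: (_ \in _).
rewrite big_mkcond [X in _ <= X]big_mkcond /=; apply: ler_sum => A _.
case: ifP => [iA|_]; last by case: ifP.
have [/cardfs1P[z zA]|_] := boolP (#|` A| == 1%N); last by rewrite mul0r; case: ifP.
by move: iA; rewrite zA inE mul1r => /eqP ->; rewrite eqxx.
Qed.

Lemma esum_at_le (c : {fset site} -> R) (i : site) (M : R) : (forall A, 0 <= c A) ->
  (forall V, \sum_(A <- fpowerset V | i \in A) c A <= M) ->
  (\esum_(A in [set A : {fset site} | i \in A]) (c A)%:E <= M%:E)%E.
Proof.
move=> c0 cM; apply: ub_ereal_sup => _ [F [finF FS] <-].
rewrite fsbig_finite //= sumEFin lee_fin.
apply: le_trans (cM (\bigcup_(A <- fset_set F) A)%fset).
have -> : \sum_(A <- fset_set F) c A = \sum_(A <- fset_set F | i \in A) c A.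
  rewrite big_seq [RHS]big_seq_cond; apply: eq_bigl => A.
  case: (boolP (A \in fset_set F)) => //= AF; apply/esym.
  by apply: FS; rewrite in_fset_set // inE in AF.
apply: sum_sub_fsets => //; apply/fsubsetP => A AF; rewrite fpowersetE.
exact: bigfcup_sup.
Qed.

Lemma sum_at_le_esum (c : {fset site} -> R) (i : site) (V : {fset site}) : (forall A, 0 <= c A) ->
  ((\sum_(A <- fpowerset V | i \in A) c A)%:E <= \esum_(A in [set A : {fset site} | i \in A]) (c A)%:E)%E.
Proof.
move=> c0; apply: esum_ge.
exists [set` [seq A : {fset site} <- fpowerset V | i \in A]].
  split; first exact: finite_seq.
  by move=> A /=; rewrite mem_filter => /andP[].
by rewrite -fsbig_seq ?filter_uniq ?fset_uniq // sumEFin lee_fin big_filter.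
Qed.

End Sums.

Lemma opnorm_reindex (R : realType) (I J : finType) (g : I -> J) (M : I -> I -> R[i]) (N : J -> J -> R[i]) :
  bijective g -> (forall s t, N (g s) (g t) = M s t) -> opnorm M = opnorm N.
Proof.
move=> [g' gK g'K] e.
have bg : bijective g by exists g'.
have vE (v : J -> R[i]) : vnorm (v \o g) = vnorm v.
  by rewrite /vnorm [in RHS](reindex g) //; exact: onW_bij.
have aE (v : J -> R[i]) : vnorm (fun s => \sum_t M s t * v (g t)) = vnorm (fun s => \sum_t N s t * v t).
  rewrite -[RHS]vE; congr vnorm; apply/funext => s /=.
  by rewrite [RHS](reindex g) /=; [apply: eq_bigr => t _; rewrite e|exact: onW_bij].
rewrite /opnorm; congr sup; apply/seteqP; split => r [v [v1 ->]].
  exists (v \o g'); rewrite -[vnorm (v \o g')]vE -aE.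
  have -> : (v \o g') \o g = v by apply/funext => s /=; rewrite gK.
  by split => //; congr vnorm; apply/funext => s; apply: eq_bigr => t _ /=; rewrite gK.
by exists (v \o g); rewrite vE -aE.
Qed.

(** From e^{-x} >= 1 - x one gets e^x - 1 <= x / (1 - x), and 1 - x is at least one half. *)
Lemma expR_sub1_le (R : realType) (x : R) : 0 <= x -> x <= 2^-1 -> expR x - 1 <= 2 * x.
Proof.
move=> x0 x1; have h := expR_ge1Dx (- x); rewrite expRN in h.
have e0 := expR_gt0 x.
have : (1 - x) * expR x <= 1 by rewrite -ler_pdivlMr // div1r.
by nra.
Qed.

(** * The potential and the choice of temperature *)

Section Gibbsian.
Variables (R : realType) (d m : nat) (Phi : interaction R d m).
Arguments Phi : clear implicits.
Hypothesis hPhi : is_quantum_interaction Phi.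
Local Notation site := (site d).
Local Notation box := (box d).
Local Notation shift := Defs.shift.

Lemma opnorm_shift (A : {fset site}) i : opnorm (Phi (shift A i)) = opnorm (Phi A).
Proof.
have H (y : shift A i) : val y - i \in A by rewrite -mem_shift; exact: valP.
pose g (s : conf m A) : conf m (shift A i) := [ffun y : shift A i => s [` H y]%fset].
pose g' (s : conf m (shift A i)) : conf m A := [ffun x : A => s (lmap (@shift_lmapP d A i) x)].
apply/esym/(@opnorm_reindex _ _ _ g).
  exists g' => s; apply/ffunP => x; rewrite !ffunE; congr (s _); apply: val_inj => /=.
    exact: addrK.
  exact: subrK.
move=> s t; apply: hPhi.2.2.1 => x y xy; rewrite !ffunE.
by have -> : [` H y]%fset = x by apply: val_inj; rewrite /= xy addrK.
Qed.

(** Translation invariance moves the norm at the origin to every site, uniformly in the volume. *)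
Lemma qnorm_bound kappa : (qnorm Phi kappa < +oo)%E -> exists2 N : R, 0 <= N &
  forall V i, \sum_(A <- fpowerset V | i \in A) expR (kappa * #|` A|%:R) * opnorm (Phi A) <= N.
Proof.
move=> qf; pose F A := expR (kappa * #|` A|%:R) * opnorm (Phi A).
have F0 A : 0 <= F A by rewrite mulr_ge0 ?expR_ge0 // (kbounded_opnorm (Phi A)).1.
have q0 : (0 <= qnorm Phi kappa)%E by apply: esum_ge0 => A _; rewrite lee_fin; exact: F0.
have qE : qnorm Phi kappa = (fine (qnorm Phi kappa))%:E by rewrite fineK // ge0_fin_numE.
exists (fine (qnorm Phi kappa)); first exact: fine_ge0.
move=> V i; rewrite -lee_fin -qE.
have -> : \sum_(A <- fpowerset V | i \in A) F A =
    \sum_(A <- fpowerset (shift V (- i)) | (0 : site) \in A) F A.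
  rewrite big_mkcond [RHS]big_mkcond /= sum_fpowerset_shift; apply: eq_bigr => A _.
  by rewrite mem_shift sub0r opprK /F opnorm_shift card_shift.
exact: sum_at_le_esum.
Qed.

(** Each beta |Phi(A)| is at most one half, so e^x - 1 <= 2 x applies and the whole sum is at most 2
    beta N. *)
Lemma small_beta kappa N beta V i : 0 <= N -> 0 <= kappa -> 0 <= beta -> beta * N <= 2^-1 -> beta * N <= kappa / 4 ->
  (forall V i, \sum_(A <- fpowerset V | i \in A) expR (kappa * #|` A|%:R) * opnorm (Phi A) <= N) ->
  \sum_(A <- fpowerset V | i \in A)
    (expR (`|- beta| * opnorm (Phi A)) - 1) * expR kappa ^+ #|` A| <= kappa / 2.
Proof.
move=> N0 k0 b0 bN bk hN; rewrite normrN ger0_norm //.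
have op0 A : 0 <= opnorm (Phi A) by exact: (kbounded_opnorm (Phi A)).1.
have opN (A : {fset site}) : i \in A -> opnorm (Phi A) <= N.
  move=> iA; apply: le_trans (hN A i).
  rewrite (big_rem A) /=; last by rewrite fpowersetE.
  rewrite iA -[X in X <= _]addr0; apply: lerD; last first.
    by apply: sumr_ge0 => B _; rewrite mulr_ge0 ?expR_ge0.
  by rewrite ler_peMl // -expR0 ler_expR mulr_ge0.
apply: (@le_trans _ _ (\sum_(A <- fpowerset V | i \in A) (2 * beta) * (expR (kappa * #|` A|%:R) * opnorm (Phi A)))).
  apply: ler_sum => A iA.
  have -> : expR kappa ^+ #|` A| = expR (kappa * #|` A|%:R) by rewrite expRM_natr.
  rewrite mulrCA mulrC ler_wpM2l ?expR_ge0 // -mulrA; apply: expR_sub1_le; first exact: mulr_ge0.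
  by apply: le_trans bN; rewrite ler_wpM2l // opN.
rewrite -big_distrr /=; apply: le_trans (ler_wpM2l _ (hN V i)) _; first by rewrite mulr_ge0.
by lra.
Qed.

Variables (beta : R).
Variables (X : 'I_m -> 'I_m -> R[i]) (x0 : R) (sp' : seq R) (Q : R -> 'I_m -> 'I_m -> R[i]).
Hypothesis m0 : (0 < m)%N.
Hypothesis dec : spectral_decomposition X (x0 :: sp') Q.
Variables (k s : R).
Hypothesis s0 : 0 <= s.
Hypothesis sk : s + s <= k.
Hypothesis small : forall V i, \sum_(A <- fpowerset V | i \in A)
  (expR (`|- beta| * opnorm (Phi A)) - 1) * expR k ^+ #|` A| <= s.
Local Notation S := (spT x0 sp').
Local Notation p := (spproj (x0 := x0) (sp' := sp') Q).
Local Notation q := (qw (x0 := x0) (sp' := sp') Q).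
Local Notation prob := (pr Phi beta Q).
Implicit Types (w : site -> option S) (A L V : {fset site}).

(** Turns the product of a priori weights in [pr_ratio] into a one-body interaction. *)
Definition spin A w : R := if #|` A| == 1%N then \sum_(y <- A) ln (q (w y)) else 0.
(** The signs are reversed because [phi] and ln q add to the log-probability, whereas a potential is
    an energy. *)
Definition pot A w : R := - phi Phi p (- beta) A w - spin A w.
Definition spinb : R := \sum_(j : option S) `|ln (q j)|.
Definition potb A : R := cphi Phi p (- beta) None A + (#|` A| == 1%N)%:R * spinb.

Lemma spinb_ge0 : 0 <= spinb. Proof. exact: sumr_ge0. Qed.

Lemma potb_ge0 A : 0 <= potb A.
Proof. by rewrite addr_ge0 ?maxabs_ge0 // mulr_ge0 ?ler0n // spinb_ge0. Qed.

Lemma pot_le A w : `|pot A w| <= potb A.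
Proof.
rewrite /pot -opprD normrN; apply: le_trans (ler_normD _ _) _; apply: lerD; first exact: phi_le.
rewrite /spin; have [/cardfs1P[z ->]|_] := boolP (#|` A| == 1%N); last by rewrite normr0 mul0r.
rewrite big_seq_fset1 mul1r /spinb (bigD1 (w z)) //= lerDl; exact: sumr_ge0.
Qed.

Lemma potb_sum V i : \sum_(A <- fpowerset V | i \in A) potb A <= expR s - 1 + spinb.
Proof.
rewrite /potb big_split /=; apply: lerD; last exact: sum_single_site_le spinb_ge0.
exact: (sum_cphi hPhi (proj_sa dec) (proj_id dec) (proj_pos m0 dec) None s0 sk small).
Qed.

Lemma pot_local A w w' : (forall y, y \in A -> w y = w' y) -> pot A w = pot A w'.
Proof.
move=> h; rewrite /pot (phi_local _ _ _ h) /spin; congr (_ - _); case: ifP => // _.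
by rewrite big_seq [RHS]big_seq; apply: eq_bigr => y yA; rewrite h.
Qed.

Lemma pot0 w : pot fset0 w = 0.
Proof.
rewrite /pot /spin cardfs0 /= subr0.
have -> : phi Phi p (- beta) fset0 w = ln (ZL Phi p (- beta) fset0 w).
  by rewrite -sum_phi fpowerset0 big_seq_fset1.
rewrite /ZL kZ_zero ?ln1 ?oppr0 //.
  by apply: ktrace_kprod_gt0 => y; [exact: proj_sa dec _|exact: proj_pos m0 dec _].
move=> t t'; rewrite /hamiltonian fpowerset0 big_seq_fset1 /embed.
case: ifP => // _; rewrite big1 // => u _; rewrite big1 // => u' _.
exact: hPhi.2.1.
Qed.

Lemma pot_shift A i w : pot (shift A i) w = pot A (fun y => w (y + i)).
Proof.
rewrite /pot (phi_shift _ hPhi (proj_sa dec) (proj_pos m0 dec)) /spin card_shift; congr (_ - _).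
case: ifP => // _; rewrite -(big_map (fun y => y + i) predT (fun y => ln (q (w y)))) /=.
apply: perm_big; apply: uniq_perm; rewrite ?fset_uniq //.
  by rewrite (map_inj_uniq (@addi_inj d i)) fset_uniq.
move=> y; rewrite mem_shift; apply/idP/mapP => [yA|[x xA ->]]; last by rewrite addrK.
by exists (y - i); rewrite ?subrK.
Qed.

(** The exponents agree exactly in every box containing [L], by [single_site_sum]; both sides are
    limits along boxes. *)
Lemma pr_gibbs V L w w' : fsupp V w' -> (forall y, y \notin L -> w y = w' y) ->
  prob w = prob w' * expR (tsum (pot^~ w') L - tsum (pot^~ w) L).
Proof.
move=> wV ww; rewrite (pr_ratio hPhi m0 dec s0 sk small wV ww) -mulrA; congr (_ * _).
have q0 j : 0 < q j by exact: qw_gt0 m0 dec _.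
have -> : \prod_(y <- L) (q (w y) / q (w' y)) = expR (\sum_(y <- L) (ln (q (w y)) - ln (q (w' y)))).
  rewrite expR_sum; apply: eq_bigr => y _.
  by rewrite expRD expRN !lnK ?posrE.
rewrite -expRD; congr expR.
have c1 : (fun n => bsum (pot^~ w') L n - bsum (pot^~ w) L n) @ \oo --> tsum (pot^~ w') L - tsum (pot^~ w) L.
  by apply: cvgB; apply: (cvg_bsum potb_ge0 potb_sum) => A; exact: pot_le.
have c2 : (fun n => \sum_(y <- L) (ln (q (w y)) - ln (q (w' y))) +
    bsum (fun A => phi Phi p (- beta) A w - phi Phi p (- beta) A w') L n) @ \oo -->
    \sum_(y <- L) (ln (q (w y)) - ln (q (w' y))) +
    tsum (fun A => phi Phi p (- beta) A w - phi Phi p (- beta) A w') L.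
  apply: cvgD; first exact: cvg_cst.
  apply: (cvg_bsum (@cp_ge0 _ _ _ _ _ _ _ _) (sum_cp hPhi m0 dec s0 sk small)) => A.
  exact: phi_diff_le.
have E n : (L `<=` box n)%fset -> bsum (pot^~ w') L n - bsum (pot^~ w) L n =
    \sum_(y <- L) (ln (q (w y)) - ln (q (w' y))) +
    bsum (fun A => phi Phi p (- beta) A w - phi Phi p (- beta) A w') L n.
  move=> Ln; rewrite -bsumB -(single_site_sum _ Ln) /bsum -big_split /=; apply: eq_bigr => A _.
  rewrite /pot /spin; case: ifP => _; last by ring.
  by rewrite sumrB; ring.
have c3 : (fun n => bsum (pot^~ w') L n - bsum (pot^~ w) L n) @ \oo -->
    \sum_(y <- L) (ln (q (w y)) - ln (q (w' y))) +
    tsum (fun A => phi Phi p (- beta) A w - phi Phi p (- beta) A w') L.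
  apply: cvg_trans c2; apply: near_eq_cvg; near=> n; rewrite E //.
  by near: n; exact: near_fsub_box.
by rewrite -(cvg_lim _ c3) // -(cvg_lim _ c1).
Unshelve. all: by end_near. Qed.

Lemma cnorm0_pot : (cnorm0 (Psi pot) < +oo)%E.
Proof.
apply: (@le_lt_trans _ _ (expR s - 1 + spinb)%:E); last exact: ltry.
apply: le_trans (esum_at_le potb_ge0 (fun V => potb_sum V 0)).
apply: le_esum => A _; apply: ub_ereal_sup => _ [w _ <-].
by rewrite lee_fin; exact: pot_le.
Qed.

Lemma gibbsian_restriction : exists mu : probability (OmegaM R d x0 sp') R,
  classical_restriction Phi beta Q mu /\ gibbsian mu.
Proof.
have [mu muE] := kolmogorov_extension
  (fun L w h => ltW (pr_gt0 hPhi m0 dec s0 sk small h))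
  (pr_split hPhi m0 dec s0 sk small) (pr_emptyk hPhi m0 dec s0 sk small).
exists mu; split; last first.
  exists (Psi pot); split; last split; first split.
  - move=> A w w' h; apply: pot_local => y yA /=; by rewrite h.
  - split; first by move=> w; exact: pot0.
    by move=> A i w; exact: pot_shift.
  - exact: cnorm0_pot.
  - move=> L xi E; apply: (dlr muE pot_local pot_le potb_ge0 potb_sum) => V L' w w'.
    exact: pr_gibbs.
move=> L xi.
have sL : fsupp L (cfg xi) by move=> y yL; rewrite /cfg insubN.
have -> : fine (mu (cyl xi)) = prob (cfg xi).
  by rewrite cylE [X in fine X](muE _ _ sL).
have gE : \forall n \near \oo, gibbs_state Phi beta (embed (box n) (Qprod Q xi)) =
    Complex (pn Phi beta Q (box n) (cfg xi)) 0.
  near=> n; apply: (gibbs_stateE _ hPhi m0 dec); near: n; exact: near_fsub_box.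
split.
  apply: cvg_trans (cvg_pn hPhi m0 dec s0 sk small sL); apply: near_eq_cvg.
  by near=> n; rewrite (near gE n).
apply: cvg_near_cst.
by near=> n; rewrite (near gE n).
Unshelve. all: by end_near. Qed.

End Gibbsian.

Theorem theorem1 (R : realType) (d m : nat) (Phi : interaction R d m) (kappa : R) :
  (0 < d)%N -> (2 <= m)%N ->
  is_quantum_interaction Phi ->
  0 < kappa -> (qnorm Phi kappa < +oo)%E ->
  exists beta_max : R, 0 < beta_max /\
    forall beta : R, 0 < beta -> beta <= beta_max ->
    forall (X : 'I_m -> 'I_m -> R[i]) (x0 : R) (sp' : seq R)
           (Q : R -> 'I_m -> 'I_m -> R[i]),
      kselfadjoint X ->
      spectral_decomposition X (x0 :: sp') Q ->
      exists mu : probability (OmegaM R d x0 sp') R,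
        classical_restriction Phi beta Q mu /\ gibbsian mu.
Proof.
move=> _ m2 hPhi k0 /(qnorm_bound hPhi)[N N0 hN].
(* One half is for the linearisation of e^x - 1; kappa / 4 makes 2 beta N at most kappa / 2. *)
pose c := Num.min (2^-1) (kappa / 4); have c0 : 0 < c by rewrite lt_min; apply/andP; split; lra.
have N1 : 0 < N + 1 by lra.
(* The added 1 keeps the denominator positive when the interaction vanishes. *)
exists (c / (N + 1)); split; first exact: divr_gt0.
move=> beta b0; rewrite ler_pdivlMr // => bN X x0 sp' Q _ dec.
have bNc : beta * N <= c by lra.
have : c <= 2^-1 by rewrite ge_min lexx.
have : c <= kappa / 4 by rewrite ge_min lexx orbT.
(* The choice s = kappa / 2 is the largest allowed by s + s <= k with k = kappa. *)
move=> ck c2; apply: (gibbsian_restriction hPhi (ltnW m2) dec (k := kappa) (s := kappa / 2)).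
- by lra.
- by lra.
- by move=> V i; apply: (@small_beta _ _ _ Phi kappa N) => //; lra.
Qed.
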